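(* Let $G$ be an abelian group, let $\mathcal D$ be a real $G$-graded division algebra with $\mathcal D_e$ isomorphic to $\mathbb R$, $\mathbb C$ or $\mathbb H$ and support $T$, let $\varphi_0$ be a degree-preserving involution on $\mathcal D$ restricting to the conjugation on $\mathcal D_e$, and let $\delta\in\{\pm1\}$, where $\delta=1$ if $\varphi_0|_{Z(\mathcal D)}\ne\mathrm{id}$. If $\mathbb C\cong\mathcal D_e\subseteq Z(\mathcal D)$, assume that $T$ is finite and $\mathcal D_e=Z(\mathcal D)$. Let $(g_0,\kappa,\sigma)$ and $(g_0',\kappa',\sigma')$ be elements of the parameter set $\mathsf X(G,\mathcal D,\varphi_0,\delta)$. Then the graded algebras with involution $M(\mathcal D,\varphi_0,g_0,\kappa,\sigma,\delta)$ and $M(\mathcal D,\varphi_0,g_0',\kappa',\sigma',\delta)$ are isomorphic if and only if $(g_0,\kappa,\sigma)$ and $(g_0',\kappa',\sigma')$ lie in the same $G\times(C\rtimes A)$-orbit.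
   Context: $G$ is an abelian group, written multiplicatively, with identity $e$. A graded division algebra is a unital (nonzero) associative $G$-graded algebra in which every nonzero homogeneous element is invertible; its support is a subgroup of $G$. Isomorphisms of graded algebras with involution preserve degrees and intertwine the involutions. Conjugation on $\mathcal D_e=\mathbb R$ means the identity. Notation. $K=T$ if $\mathcal D_e=\mathbb R$ or $\mathcal D_e\cong\mathbb H$, and $K=\{t\in T\mid \mathcal D_t \text{ commutes elementwise with }\mathcal D_e\}$ if $\mathcal D_e\cong\mathbb C$. For each $t\in T$ fix $0\ne X_t\in\mathcal D_t$ such that: $X_t$ commutes with $\mathcal D_e$ if $\mathcal D_e\cong\mathbb H$; $\varphi_0(X_t)=\delta X_t$ if $\mathcal D_e\cong\mathbb C$ and $t\in K$ (such choices exist). Then $\varphi_0(X_t)=\eta(t)X_t$ with $\eta(t)\in\{\pm1\}$. Define $\beta:K\times K\to Z(\mathcal D_e)^\times$ by $X_sX_t=\beta(s,t)X_tX_s$. Fix a section $\xi:G/T\to G$ of the quotient map. For $g_0\in G$ let $(G/T)_{g_0}=\{gT\mid g_0g^2\in T\}$ and $\tau(x)=g_0\xi(x)^2\in T$ for $x\in(G/T)_{g_0}$. Admissible multiplicity function (for $g_0$): a map $\kappa:G/T\to\mathbb Z_{\ge0}$ (not identically zero) with finite support such that $\kappa(g_0^{-1}x^{-1})=\kappa(x)$ for all $x$; if $\mathcal D_e=\mathbb R$, $\kappa(x)$ is even whenever $x\in(G/T)_{g_0}$ and $\eta(\tau(x))=-\delta$; if $\mathcal D_e\cong\mathbb C$,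 $\kappa(x)$ is even whenever $x\in(G/T)_{g_0}$, $\tau(x)\in T\setminus K$ and $\eta(\tau(x))=-\delta$. Write $|\kappa|=\sum_x\kappa(x)$. Signature function for $(g_0,\kappa)$: a map $\sigma:G/T\to\mathbb Z$ with $|\sigma(x)|\le\kappa(x)$ for all $x$, and: if $\mathcal D_e=\mathbb R$ or $\cong\mathbb H$, then $\sigma(x)\equiv\kappa(x)\pmod 2$ when $x\in(G/T)_{g_0}$ and $\eta(\tau(x))=\delta$, and $\sigma(x)=0$ otherwise; if $\mathcal D_e\cong\mathbb C$, then $\sigma(x)\equiv\kappa(x)\pmod2$ when $x\in(G/T)_{g_0}$ and $\tau(x)\in K$, and $\sigma(x)=0$ otherwise. $\mathsf X(G,\mathcal D,\varphi_0,\delta)$ is the set of triples $(g_0,\kappa,\sigma)$ with $g_0\in G$, $\kappa$ an admissible multiplicity function for $g_0$, $\sigma$ a signature function for $(g_0,\kappa)$. $M(\mathcal D,\varphi_0,g_0,\kappa,\sigma,\delta)$: let $x_1,\dots,x_s$ be the distinct elements of the support of $\kappa$, ordered so that $x_1,\dots,x_m\in(G/T)_{g_0}$ and the others come in pairs with $x_{m+2j-1}x_{m+2j}=g_0^{-1}T$, $j=1,\dots,r$, $m+2r=s$. Let $g_i=\xi(x_i)$, $k_i=\kappa(x_i)$, $k=|\kappa|$. The algebra is $M_k(\mathcal D)=M_k(\mathbb R)\otimes\mathcal D$, partitioned into $s^2$ blocks according to $k=k_1+\dots+k_s$, with $\deg(E\otimes d)=g_itg_j^{-1}$ for a matrix unit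 $E$ in the $(i,j)$ block and $d\in\mathcal D_t$. The involution is $\varphi(X)=\Phi^{-1}\varphi_0(X^T)\Phi$ ($\varphi_0$ applied entrywise), where $\Phi=X_{t_1}S_1\oplus\dots\oplus X_{t_{m+r}}S_{m+r}$ with: for $1\le j\le r$, $t_{m+j}=g_0g_{m+2j-1}g_{m+2j}$ and $S_{m+j}=\begin{pmatrix}0&I_{k_{m+2j}}\\ \delta\eta(t_{m+j})I_{k_{m+2j}}&0\end{pmatrix}$; for $1\le i\le m$, $t_i=\tau(x_i)$ and - if $\mathcal D_e=\mathbb R$ or $\cong\mathbb H$ with $\eta(t_i)=\delta$, or $\mathcal D_e\cong\mathbb C$ with $t_i\in K$: $S_i=\mathrm{diag}(I_{p_i},-I_{q_i})$ with $p_i=\frac12(\kappa(x_i)+\sigma(x_i))$, $q_i=\frac12(\kappa(x_i)-\sigma(x_i))$; - if $\mathcal D_e=\mathbb R$ with $\eta(t_i)=-\delta$, or $\mathcal D_e\cong\mathbb C$ with $t_i\in T\setminus K$, $\eta(t_i)=-\delta$: $S_i=\begin{pmatrix}0&I_{k_i/2}\\-I_{k_i/2}&0\end{pmatrix}$; - if $\mathcal D_e\cong\mathbb C$ with $t_i\in T\setminus K$, $\eta(t_i)=\delta$: $S_i=I_{k_i}$; - if $\mathcal D_e\cong\mathbb H$ with $\eta(t_i)=-\delta$: $S_i=\mathbf i I_{k_i}$, $\mathbf i$ a fixed imaginary unit in $\mathcal D_e$. Groups. $C$ is the group of nonzero homogeneous elements $c\in Z(\mathcal D)$ with $\varphi_0(c)=c$.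 The group $A$ of degree-preserving automorphisms of $\mathcal D$ is: (i) if it is not the case that $\mathbb C\cong\mathcal D_e\subseteq Z(\mathcal D)$: all degree-preserving automorphisms $\psi_0$ with $\psi_0|_{\mathcal D_e}=\mathrm{id}$; each has the form $\psi_0(X_t)=X_t\nu(t)$ with $\nu(t)\in Z(\mathcal D_e)^\times$, and $\nu(t)\in\mathbb R^\times$ for $t\in K$; (ii) if $\mathbb C\cong\mathcal D_e=Z(\mathcal D)$: trivial if $T$ is not an elementary $2$-group; if $T$ is an elementary $2$-group, $A=\langle\psi_0\rangle$ has order 2, where $\psi_0$ is the automorphism restricting to the conjugation on $\mathcal D_e$ with $\psi_0(X_t)=X_t\nu(t)$, for a fixed $\nu:T\to\{\pm1\}$ satisfying $\nu(st)=\nu(s)\nu(t)\beta(s,t)$ (such $\nu$ exists; for $\mathrm{id}\in A$ put $\nu=1$). All elements of $A$ commute with $\varphi_0$, so $A$ acts on $C$ by evaluation, giving $C\rtimes A$. Actions on $\mathsf X(G,\mathcal D,\varphi_0,\delta)$ (in each formula the new signature is $0$ wherever the old signature value on the right is $0$; where it is nonzero the sign factors are signs of nonzero real numbers): - $\psi_0\in A$: $\psi_0\cdot(g_0,\kappa,\sigma)=(g_0,\kappa,\underline\sigma)$, $\underline\sigma(x)=\mathrm{sign}(\nu(g_0\xi(x)^2))\,\sigma(x)$; - $c\in C$: $c\cdot(g_0,\kappa,\sigma)=(g_0\deg c,\kappa,\underline\sigma)$, $\underline\sigma(x)=\mathrm{sign}\big(X_{g_0\xi(x)^2\deg c}^{-1}X_{g_0\xi(x)^2}c\big)\sigma(x)$;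 - $g\in G$: $g\cdot(g_0,\kappa,\sigma)=(g^{-2}g_0,g\cdot\kappa,\underline\sigma)$, $(g\cdot\kappa)(x)=\kappa(g^{-1}x)$, $\underline\sigma(x)=\eta(u)\,\mathrm{sign}\big(X_{tu^2}^{-1}X_uX_tX_u\big)\sigma(g^{-1}x)$, with $t=g_0\xi(g^{-1}x)^2$ and $u=\xi(g^{-1}x)^{-1}g^{-1}\xi(x)\in T$. These combine to an action of $G\times(C\rtimes A)$, with $(g,c,\psi_0)$ acting as $g\cdot(c\cdot(\psi_0\cdot{}))$. *)

(* Defs.v *)
From HB Require Import structures.
From mathcomp Require Import all_boot all_order all_algebra.
From mathcomp Require Import all_classical all_reals.
From mathcomp Require Import complex.
From mathcomp Require Import generic_quotient ring_quotient ring.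

Set Implicit Arguments.
Unset Strict Implicit.
Unset Printing Implicit Defensive.

Import GRing.Theory.

Local Open Scope quotient_scope.
Local Open Scope ring_scope.

(* The abelian group G is a zmodType, hence written                           *)
(* additively: the identity e is 0, g h is g + h, g^-1 is - g, g^2 is g *+ 2. *)
(* The support T is a subgroup, T : zmodClosed G, and G/T is {quot T}.        *)

Notation "{ 'quot' I }" := (Quotient.quot I) : type_scope.

Section Quaternions.
Variable R : comNzRingType.

Record quat : Type := Quat { qre : R; qi : R; qj : R; qk : R }.

Definition quat_tuple (q : quat) := (qre q, qi q, qj q, qk q).
Definition tuple_quat (t : R * R * R * R) :=
  let: (a, b, c, d) := t in Quat a b c d.
Lemma quat_tupleK : cancel quat_tuple tuple_quat. Proof. by case. Qed.

HB.instance Definition _ := Choice.copy quat (can_type quat_tupleK).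

Definition addq (p q : quat) :=
  Quat (qre p + qre q) (qi p + qi q) (qj p + qj q) (qk p + qk q).
Definition oppq (p : quat) := Quat (- qre p) (- qi p) (- qj p) (- qk p).
Definition scaleq (a : R) (p : quat) :=
  Quat (a * qre p) (a * qi p) (a * qj p) (a * qk p).
Definition mulq (p q : quat) :=
  Quat (qre p * qre q - qi p * qi q - qj p * qj q - qk p * qk q)
       (qre p * qi q + qi p * qre q + qj p * qk q - qk p * qj q)
       (qre p * qj q - qi p * qk q + qj p * qre q + qk p * qi q)
       (qre p * qk q + qi p * qj q - qj p * qi q + qk p * qre q).
Definition conjq (p : quat) := Quat (qre p) (- qi p) (- qj p) (- qk p).

Fact addqA : associative addq.
Proof. by move=> p q r; congr Quat; rewrite /= addrA. Qed.
Fact addqC : commutative addq.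
Proof. by move=> p q; congr Quat; rewrite /= addrC. Qed.
Fact add0q : left_id (Quat 0 0 0 0) addq.
Proof. by move=> [a b c d]; congr Quat; rewrite /= add0r. Qed.
Fact addNq : left_inverse (Quat 0 0 0 0) oppq addq.
Proof. by move=> p; congr Quat; rewrite /= addNr. Qed.
HB.instance Definition _ := GRing.isZmodule.Build quat addqA addqC add0q addNq.

Fact mulqA : associative mulq.
Proof. by move=> p q r; congr Quat => /=; ring. Qed.
Fact mul1q : left_id (Quat 1 0 0 0) mulq.
Proof. by move=> [a b c d]; congr Quat => /=; ring. Qed.
Fact mulq1 : right_id (Quat 1 0 0 0) mulq.
Proof. by move=> [a b c d]; congr Quat => /=; ring. Qed.
Fact mulqDl : left_distributive mulq addq.
Proof. by move=> p q r; congr Quat => /=; ring. Qed.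
Fact mulqDr : right_distributive mulq addq.
Proof. by move=> p q r; congr Quat => /=; ring. Qed.
Fact oneq_neq0 : Quat 1 0 0 0 != 0.
Proof. by apply/eqP => -[/eqP]; rewrite oner_eq0. Qed.
HB.instance Definition _ := GRing.Zmodule_isNzRing.Build quat
  mulqA mul1q mulq1 mulqDl mulqDr oneq_neq0.

Fact scaleqA a b p : scaleq a (scaleq b p) = scaleq (a * b) p.
Proof. by congr Quat; rewrite /= mulrA. Qed.
Fact scale1q : left_id 1 scaleq.
Proof. by move=> [a b c d]; congr Quat; rewrite /= mul1r. Qed.
Fact scaleqDr : right_distributive scaleq +%R.
Proof. by move=> a p q; congr Quat; rewrite /= mulrDr. Qed.
Fact scaleqDl p : {morph scaleq^~ p : a b / a + b}.
Proof. by move=> a b; congr Quat; rewrite /= mulrDl. Qed.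
HB.instance Definition _ := GRing.Zmodule_isLmodule.Build R quat
  scaleqA scale1q scaleqDr scaleqDl.

Fact scaleqAl (a : R) (p q : quat) : a *: (p * q) = (a *: p) * q.
Proof. by congr Quat => /=; ring. Qed.
HB.instance Definition _ := GRing.Lmodule_isLalgebra.Build R quat scaleqAl.

End Quaternions.

(* The isomorphism type of D_e: R, C or H.                                    *)
Inductive De_kind := De_R | De_C | De_H.

(* Graded algebras with involution.  This bundles the data only; a            *)
(* pzRingType is used because 'M[D]_k is an R-algebra through the entrywise   *)
(* scaling by R, whereas its canonical lmodType structure is over D.          *)
Record ginvAlg (R : Type) (G : Type) := GinvAlg {
  ga_ring : pzRingType;
  ga_scale : R -> ga_ring -> ga_ring;
  ga_comp : G -> set ga_ring;
  ga_inv : ga_ring -> ga_ring }.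

Definition ginvAlg_iso (R G : Type) (A B : ginvAlg R G) : Prop :=
  exists f : {rmorphism ga_ring A -> ga_ring B},
    [/\ bijective f,
        forall a x, f (ga_scale a x) = ga_scale a (f x),
        forall g x, ga_comp g x <-> ga_comp g (f x)
      & forall x, f (ga_inv x) = ga_inv (f x)].

Section GradedDivision.
(* Every nonzero R-algebra is classically a unitAlgType whose units are       *)
(* exactly its invertible elements, so D is an arbitrary real algebra.        *)
Variables (R : realType) (G : zmodType) (D : unitAlgType R).
Variable Dg : G -> set D.

Record is_grading : Prop := IsGrading {
  grading0 : forall g, Dg g 0;
  gradingP : forall g (a : R) (x y : D), Dg g x -> Dg g y -> Dg g (a *: x + y);
  gradingM : forall g h (x y : D), Dg g x -> Dg h y -> Dg (g + h) (x * y);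
  grading_span : forall d : D, exists (s : seq G) (f : G -> D),
    (forall g, Dg g (f g)) /\ d = \sum_(g <- s) f g;
  grading_free : forall (s : seq G) (f : G -> D), uniq s ->
    (forall g, Dg g (f g)) -> \sum_(g <- s) f g = 0 ->
    forall g, g \in s -> f g = 0 }.

Definition graded_division : Prop :=
  is_grading /\
  forall g (d : D), Dg g d -> d != 0 -> d \is a GRing.unit.

Definition is_support (T : {pred G}) : Prop :=
  forall t, t \in T <-> exists2 d, Dg t d & d != 0.

Definition is_involution (phi0 : {linear D -> D}) : Prop :=
  {morph phi0 : x y / x * y >-> y * x} /\ involutive phi0.

Definition central (d : D) : Prop := forall e : D, d * e = e * d.

Definition De_iso (B : lalgType R) (f : {lrmorphism B -> D}) : Prop :=
  injective f /\ (forall d, Dg 0 d <-> exists b, f b = d).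

(* D_e is isomorphic to the algebra designated by kind, and phi0 restricts to *)
(* the conjugation on D_e.                                                    *)
Definition De_conjugation (kind : De_kind) (phi0 : D -> D) : Prop :=
  match kind with
  | De_R => exists2 f : {lrmorphism R^o -> D},
      De_iso f & forall b, phi0 (f b) = f b
  | De_C => exists2 f : {lrmorphism Rcomplex R -> D},
      De_iso f & forall b, phi0 (f b) = f (conjc b)
  | De_H => exists2 f : {lrmorphism quat R -> D},
      De_iso f & forall b, phi0 (f b) = f (conjq b)
  end.

Definition commutes_De (d : D) : Prop := forall e, Dg 0 e -> d * e = e * d.

Definition De_C_central (kind : De_kind) : Prop :=
  kind = De_C /\ forall d, Dg 0 d -> central d.

(* The sign of a for d = a.1 with a real; the junk value is 0 when d is not a *)
(* real multiple of 1.                                                        *)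
Definition rsign (d : D) : int := sgz (xget 0 [set a : R | d = a%:A]).

Variables (T : zmodClosed G) (phi0 : {linear D -> D}) (delta : int).
Variable kind : De_kind.

Local Notation pi := (\pi_{quot T}).

Definition elementary2 : Prop := forall t, t \in T -> t *+ 2 = 0.

Definition inK (t : G) : bool :=
  (t \in T) && (if kind is De_C then `[< forall d, Dg t d -> commutes_De d >]
                else true).

(* The values of X, eta and nu outside T are irrelevant junk. *)
Variables (X : G -> D) (eta : G -> int) (xi : {quot T} -> G).
Variables (iu : D) (nu : G -> int).

Definition X_choice : Prop :=
  forall t, t \in T ->
    [/\ Dg t (X t), X t != 0,
        kind = De_H -> commutes_De (X t)
      & kind = De_C -> inK t -> phi0 (X t) = X t *~ delta].

Definition eta_spec : Prop :=
  forall t, t \in T ->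
    (eta t = 1 \/ eta t = -1) /\ phi0 (X t) = X t *~ eta t.

(* X_s X_t = beta(s,t) X_t X_s *)
Definition beta (s t : G) : D := (X s * X t) / (X t * X s).

Definition nu_choice : Prop :=
  De_C_central kind -> elementary2 ->
    (forall t, t \in T -> nu t = 1 \/ nu t = -1) /\
    (forall s t, s \in T -> t \in T ->
       (nu (s + t))%:~R = (nu s * nu t)%:~R * beta s t).

Definition selfdual (g0 : G) : set {quot T} :=
  [set x | exists2 g, x = pi g & g0 + g *+ 2 \in T].

Definition tau (g0 : G) (x : {quot T}) : G := g0 + xi x *+ 2.

Definition multiplicity (g0 : G) (kappa : {quot T} -> nat) : Prop :=
  [/\ exists x, kappa x <> 0%N,
      finite_set [set x | kappa x <> 0%N],
      forall x, kappa (- pi g0 - x) = kappa x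
    & match kind with
      | De_R => forall x, selfdual g0 x -> eta (tau g0 x) = - delta ->
          ~~ odd (kappa x)
      | De_C => forall x, selfdual g0 x -> ~~ inK (tau g0 x) ->
          eta (tau g0 x) = - delta -> ~~ odd (kappa x)
      | De_H => True
      end].

Definition signature_supp (g0 : G) (x : {quot T}) : Prop :=
  selfdual g0 x /\
  match kind with
  | De_C => inK (tau g0 x)
  | _ => eta (tau g0 x) = delta
  end.

Definition signature (g0 : G) (kappa : {quot T} -> nat)
    (sigma : {quot T} -> int) : Prop :=
  forall x,
    [/\ (absz (sigma x) <= kappa x)%N,
        signature_supp g0 x -> (sigma x = (kappa x)%:Z %[mod 2])%Z
      & ~ signature_supp g0 x -> sigma x = 0].

Record param := Param {
  p_g : G; p_kappa : {quot T} -> nat; p_sigma : {quot T} -> int }.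

Definition paramX (p : param) : Prop :=
  multiplicity (p_g p) (p_kappa p) /\
  signature (p_g p) (p_kappa p) (p_sigma p).

(* For 0-based block indices i and j: x_i and x_j are the first and second    *)
(* member of one of the r pairs that follow the m self-dual elements.         *)
Definition pair_index (m i j : nat) : bool :=
  [&& (m <= i)%N, ~~ odd (i - m) & j == i.+1].

Definition enumeration (p : param) (m r : nat)
    (x : 'I_(m + r.*2) -> {quot T}) : Prop :=
  [/\ injective x,
      forall y, p_kappa p y <> 0%N <-> exists i, x i = y,
      forall i : 'I_(m + r.*2), (i < m)%N -> selfdual (p_g p) (x i)
    & forall i j : 'I_(m + r.*2), pair_index m i j -> x i + x j = - pi (p_g p)].

(* Entries of the blocks I_k, diag(I_p, -I_(k-p)) and (0, I_h; -I_h, 0).      *)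
Definition Sid (a b : nat) : D := (a == b)%:R.
Definition Sdiag (p a b : nat) : D :=
  if a == b then if (a < p)%N then 1 else -1 else 0.
Definition Salt (h a b : nat) : D :=
  if b == (a + h)%N then 1 else if a == (b + h)%N then -1 else 0.

Definition S_entry (t : G) (k : nat) (sg : int) : nat -> nat -> D :=
  let p := absz ((k%:Z + sg) %/ 2)%Z in
  match kind with
  | De_R => if eta t == delta then Sdiag p else Salt k./2
  | De_C => if inK t then Sdiag p
            else if eta t == delta then Sid else Salt k./2
  | De_H => if eta t == delta then Sdiag p else fun a b => iu * Sid a b
  end.

Section Algebra.
Variables (p : param) (m r : nat) (x : 'I_(m + r.*2) -> {quot T}).

Local Notation s := (m + r.*2)%N.
Local Notation k_ i := (p_kappa p (x i)).
Local Notation g_ i := (xi (x i)).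

Definition Phi_entry (i j : 'I_s) (a b : nat) : D :=
  let t := p_g p + g_ i + g_ j in
  if (i == j) && (i < m)%N then
    X (tau (p_g p) (x i))
      * S_entry (tau (p_g p) (x i)) (k_ i) (p_sigma p (x i)) a b
  else if pair_index m i j then X t * Sid a b
  else if pair_index m j i then X t * (Sid a b *~ (delta * eta t))
  else 0.

Definition Phi : 'M[D]_(\sum_(i < s) k_ i) :=
  \mxblock_(i < s, j < s) \matrix_(a < k_ i, b < k_ j) Phi_entry i j a b.

(* D is noncommutative, so invmx is not available. *)
Definition Phi_inv : 'M[D]_(\sum_(i < s) k_ i) :=
  xget 0 [set Psi | Psi *m Phi = 1%:M /\ Phi *m Psi = 1%:M].

(* d in D_t at an entry of block (i,j) has degree g_i t g_j^-1. *)
Definition M_comp (g : G) : set 'M[D]_(\sum_(i < s) k_ i) :=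
  [set A | forall i j a b, Dg (g - g_ i + g_ j) (submxblock A i j a b)].

Definition Malg : ginvAlg R G :=
  @GinvAlg R G 'M[D]_(\sum_(i < s) k_ i)
    (fun c A => map_mx (fun d => c *: d) A)
    M_comp
    (fun A => Phi_inv *m map_mx phi0 A^T *m Phi).

End Algebra.

Definition groupC (c : D) (h : G) : Prop :=
  [/\ Dg h c, c != 0, central c & phi0 c = c].

Definition groupA (psi : {lrmorphism D -> D}) : Prop :=
  [/\ bijective psi,
      forall g d, Dg g d -> Dg g (psi d),
      ~ De_C_central kind -> forall d, Dg 0 d -> psi d = d
    & De_C_central kind ->
        psi =1 id \/
        [/\ elementary2,
            forall d, Dg 0 d -> psi d = phi0 d
          & forall t, t \in T -> psi (X t) = X t *~ nu t]].

(* X_t^-1 psi(X_t) is the scalar nu(t) with psi(X_t) = X_t nu(t). *)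
Definition actA (psi : D -> D) (p : param) : param :=
  Param (p_g p) (p_kappa p)
    (fun x => let t := tau (p_g p) x in
              rsign ((X t)^-1 * psi (X t)) * p_sigma p x).

Definition actC (c : D) (h : G) (p : param) : param :=
  Param (p_g p + h) (p_kappa p)
    (fun x => let t := tau (p_g p) x in
              rsign ((X (t + h))^-1 * X t * c) * p_sigma p x).

Definition actG (g : G) (p : param) : param :=
  Param (p_g p - g *+ 2) (fun x => p_kappa p (x - pi g))
    (fun x => let y := x - pi g in
              let t := tau (p_g p) y in
              let u := xi x - g - xi y in
              eta u * rsign ((X (t + u *+ 2))^-1 * X u * X t * X u)
                * p_sigma p y).

Definition same_orbit (p p' : param) : Prop :=
  exists (g : G) (c : D) (h : G) (psi : {lrmorphism D -> D}),
    [/\ groupC c h, groupA psi & p' = actG g (actC c h (actA psi p))].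

End GradedDivision.

(* Main.v *)
(* An isomorphism of graded algebras M_k(D) -> M_k'(D) has the form           *)
(* A |-> U psi(A) U^-1, where psi is a degree-preserving automorphism of D and *)
(* U is a homogeneous matrix.  Up to an inner automorphism, which can be moved *)
(* into U, psi belongs to the group A, and then it commutes with phi0.  The    *)
(* involutions correspond if and only if phi0(U)^T Phi' U = c psi(Phi) with    *)
(* c in C.  Homogeneity of U decomposes this equation along G/T.  The blocks   *)
(* that carry a signature become hermitian forms over D_e, compared up to a    *)
(* real factor whose sign is the product of the sign factors of the actions,   *)
(* so that Sylvester's law of inertia applies; all other blocks are determined *)
(* by their size.  Conversely, each row of Phi has only one nonzero entry, and *)
(* a matrix U with one nonzero entry in each row and column can be found.      *)

From HB Require Import structures.
Require Import Defs.
From mathcomp Require Import all_boot all_order all_algebra.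
From mathcomp Require Import all_classical all_reals.
From mathcomp Require Import complex.
From mathcomp Require Import generic_quotient ring_quotient zify ring lra.

Set Implicit Arguments.
Unset Strict Implicit.
Unset Printing Implicit Defensive.

Import Order.TTheory GRing.Theory Num.Theory.

Local Open Scope quotient_scope.
Local Open Scope ring_scope.

(** Each algebra is the algebra of homogeneous endomorphisms of a free graded [D]-module, with the
    involution adjoint to the form whose Gram matrix is [Phi]. The theorem says that the adjoint
    involution determines the form up to a shift by [g], a central factor [c] and a twist by [psi].

    Given an isomorphism, a rank one idempotent recovers [D], and the isomorphism becomes an
    entrywise automorphism of [D] followed by conjugation by a homogeneous matrix [U]
    ([graded_iso_matrix]). An inner automorphism brings the former into the group A
    ([aut_reduction]). Since the involutions correspond, the quotient of the two forms commutes with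
    all matrices, so it is a central scalar [c] ([similitude_of_iso]). Along G/T, ranks determine
    the multiplicities ([similitude_kappa]), and [inertia] over D_e determines the signatures up to
    the sign of a real factor, which is the sign in the action ([similitude_sigma]).

    Given an orbit, the nonzero entries of a Gram matrix pair the rows ([model_neq0]), so a monomial
    [U] decouples the isometry equation into one equation per pair. A pair of distinct rows leaves
    one weight free; a row paired with itself needs a square root or a rescaling in D_e
    ([fixed_weight], [similitude_of_orbit]).

    The case distinctions on D_e are replaced by two intrinsic properties [sig] and [alt] of a
    degree, which the action preserves ([transport_sig], [transport_alt]). *)

(** * Linear systems over a division ring, and square roots of -1 in the quaternions *)

(** Gaussian elimination, by induction on the number of equations. Keeping the division ring [S] as
    a subset lets the lemma apply to the component of degree 0 inside [D]. *)
Lemma underdetermined_system (D : unitRingType) (S : set D)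
    (S0 : S 0) (S1 : S 1)
    (SB : forall a b, S a -> S b -> S (a - b))
    (SM : forall a b, S a -> S b -> S (a * b))
    (SV : forall a, S a -> a != 0 -> a \is a GRing.unit /\ S a^-1)
    (I J : finType) (A : {set I}) (B : {set J}) (w : J -> I -> D) :
    (#|B| < #|A|)%N -> (forall j i, S (w j i)) ->
  exists v : I -> D, [/\ forall i, S (v i),
    exists2 i, i \in A & v i != 0
    & forall j, j \in B -> \sum_(i in A) w j i * v i = 0].
Proof.
have SN a : S a -> S (- a) by move=> Sa; rewrite -[- a]add0r; exact: SB.
have SD a b : S a -> S b -> S (a + b).
  by move=> Sa Sb; rewrite -[b]opprK; apply: SB => //; exact: SN.
elim: {B}#|B| {-2}B A w (erefl #|B|) => [|n IHn] B A w cB ltBA Sw.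
  have /card_gt0P[i0 i0A] : (0 < #|A|)%N by rewrite cB in ltBA.
  exists (fun i => (i == i0)%:R); split.
  - by move=> i; case: eqP.
  - by exists i0 => //; rewrite eqxx oner_eq0.
  - by move=> j; rewrite (cards0_eq cB) inE.
have /card_gt0P[j0 j0B] : (0 < #|B|)%N by rewrite cB.
have cB' : #|B :\ j0| = n by move: cB; rewrite (cardsD1 j0) j0B => -[].
have [/exists_inP[i0 i0A w0]|] := boolP [exists i in A, w j0 i != 0];
  last first.
  rewrite negb_exists_in => /forall_inP w0.
  have [|//|v [Sv nzv eqv]] := IHn _ A w cB'.
    by apply: leq_ltn_trans ltBA; rewrite cB' cB.
  exists v; split=> // j jB; have [->|jj0] := eqVneq j j0.
    by apply: big1 => i /w0; rewrite negbK => /eqP->; rewrite mul0r.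
  by apply: eqv; rewrite !inE jj0.
have [uw Sw0] := SV _ (Sw j0 i0) w0.
(* Subtracting multiples of the pivot row [j0] eliminates the unknown [i0], whose value [z] is later
   read off from the pivot equation. *)
pose w' j i := w j i - w j i0 * (w j0 i0)^-1 * w j0 i.
have [||v [Sv [i1 i1A nzv] eqv]] := IHn _ (A :\ i0) w' cB'.
- by move: ltBA; rewrite cB' cB (cardsD1 i0 A) i0A.
- by move=> j i; apply: SB => //; do 2![apply: (SM) => //].
pose z := - ((w j0 i0)^-1 * \sum_(i in A :\ i0) w j0 i * v i).
exists (fun i => if i == i0 then z else v i); split.
- move=> i; case: eqP => // _; apply: (SN); apply: (SM) => //.
  by apply: big_ind => // k _; apply: SM.
- move: i1A; rewrite !inE => /andP[/negPf i10 i1A].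
  by exists i1 => //; rewrite i10.
move=> j jB; rewrite (big_setD1 i0) //= eqxx.
rewrite (eq_bigr (fun i => w j i * v i)); last first.
  by move=> i; rewrite !inE => /andP[/negPf->].
have [->|jj0] := eqVneq j j0.
  by rewrite /z mulrN mulVKr // addNr.
have := eqv j; rewrite !inE jj0 => /(_ jB) eqj.
apply: etrans eqj; rewrite /w'.
rewrite [RHS](eq_bigr (fun i => w j i * v i -
  w j i0 * ((w j0 i0)^-1 * (w j0 i * v i)))) => [|i _].
  by rewrite sumrB -!mulr_sumr /z mulrN addrC.
by rewrite mulrBl !mulrA.
Qed.

(** The imaginary components of [q * q] are [2ab], [2ac], [2ae]; if [a] is nonzero they force [q] to
    be real, and a real square is not [-1]. *)
Lemma quat_sqrN1 (R : realType) (q : quat R) : q * q = -1 -> qre q = 0.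
Proof.
case: q => a b c e [] /= E0 E1 E2 E3.
apply/eqP; apply: contraT => a0.
have b0 : b = 0 by apply: (mulfI a0); lra.
have c0 : c = 0 by apply: (mulfI a0); lra.
have e0 : e = 0 by apply: (mulfI a0); lra.
by have := sqr_ge0 a; rewrite expr2; subst; lra.
Qed.

(** * Identities in abelian groups *)

(** Reflection for the tactic [zmod]: both sides are read as integer combinations of common atoms,
    and equality of the coefficients is decided by computation. *)
Inductive zterm :=
  ZVar of nat | ZZero | ZOpp of zterm | ZAdd of zterm & zterm.

Fixpoint zdenote (G : zmodType) (env : seq G) (t : zterm) : G :=
  match t with
  | ZVar k => env`_k
  | ZZero => 0
  | ZOpp t => - zdenote env t
  | ZAdd t u => zdenote env t + zdenote env u
  end.

Fixpoint zcoef (k : nat) (t : zterm) : int :=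
  match t with
  | ZVar j => (k == j)%:Z
  | ZZero => 0
  | ZOpp t => - zcoef k t
  | ZAdd t u => zcoef k t + zcoef k u
  end.

Lemma zdenoteE (G : zmodType) (env : seq G) t :
  zdenote env t = \sum_(k < size env) env`_k *~ zcoef k t.
Proof.
elim: t => [j||t /= ->|t /= -> u ->] /=.
- have [lt_j|le_j] := ltnP j (size env).
    rewrite (bigD1 (Ordinal lt_j)) //= eqxx mulr1z big1 ?addr0 // => k.
    by rewrite -val_eqE /= => /negPf->.
  rewrite nth_default // big1 // => k _.
  by rewrite ltn_eqF // (leq_trans (ltn_ord k)).
- by rewrite big1.
- by rewrite -sumrN; apply: eq_bigr => k _; rewrite mulrNz.
- by rewrite -big_split; apply: eq_bigr => k _; rewrite mulrzDr.
Qed.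

Lemma zdenote_eq (G : zmodType) (env : seq G) t u :
  all (fun k => zcoef k t == zcoef k u) (iota 0 (size env)) ->
  zdenote env t = zdenote env u.
Proof.
move=> /allP E; rewrite !zdenoteE; apply: eq_bigr => k _.
by rewrite (eqP (E k _)) // mem_iota /=.
Qed.

Ltac zmod_insert x env :=
  match env with
  | nil => constr:(x :: nil)
  | ?y :: _ => let _ := match goal with _ => unify x y end in env
  | ?y :: ?e => let e' := zmod_insert x e in constr:(y :: e')
  end.

Ltac zmod_atoms t env :=
  lazymatch t with
  | GRing.zero => env
  | GRing.opp ?a => zmod_atoms a env
  | GRing.natmul ?a 2 => zmod_atoms a env
  | GRing.add ?a ?b => let e := zmod_atoms a env in zmod_atoms b e
  | ?a => zmod_insert a env
  end.

Ltac zmod_index x env :=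
  match env with
  | ?y :: _ => let _ := match goal with _ => unify x y end in constr:(0%N)
  | _ :: ?e => let k := zmod_index x e in constr:(S k)
  end.

Ltac zmod_reify t env :=
  lazymatch t with
  | GRing.zero => constr:(ZZero)
  | GRing.opp ?a => let a' := zmod_reify a env in constr:(ZOpp a')
  | GRing.natmul ?a 2 =>
      let a' := zmod_reify a env in constr:(ZAdd a' a')
  | GRing.add ?a ?b =>
      let a' := zmod_reify a env in
      let b' := zmod_reify b env in constr:(ZAdd a' b')
  | ?a => let k := zmod_index a env in constr:(ZVar k)
  end.

Ltac zmod :=
  lazymatch goal with
  | |- ?a = ?b =>
      let T := type of a in
      let e := zmod_atoms a (@nil T) in
      let e := zmod_atoms b e in
      let a' := zmod_reify a e in
      let b' := zmod_reify b e in
      exact: (@zdenote_eq _ e a' b' isT)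
  end.

(** * The Skolem-Noether theorem for the quaternions *)

Section QuaternionConjugation.
Variables (D : pzRingType) (i j I J : D).
Hypotheses (ii : i * i = -1) (jj : j * j = -1) (ji : j * i = - (i * j)).
Hypotheses (II : I * I = -1) (JJ : J * J = -1) (JI : J * I = - (I * J)).

(** The sum of [H * q * h^-1] over [h] in [1, i, j, i * j], where [H] is the same word in [I], [J];
    the last three [h] have inverse [- h]. *)
Definition intertwiner q := q - I * q * i - J * q * j - I * J * q * (i * j).

Let xii x : x * i * i = - x. Proof. by rewrite -mulrA ii mulrN1. Qed.
Let xjj x : x * j * j = - x. Proof. by rewrite -mulrA jj mulrN1. Qed.
Let xji x : x * j * i = - (x * i * j). Proof. by rewrite -!mulrA ji mulrN. Qed.

Lemma intertwinerl q : I * intertwiner q = intertwiner q * i.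
Proof.
rewrite /intertwiner !(mulrBr, mulrBl) !mulrA II !xii !xji xii.
by rewrite !mulNr !mul1r !opprK; zmod.
Qed.

Lemma intertwinerr q : J * intertwiner q = intertwiner q * j.
Proof.
have xJJ x : x * J * J = - x by rewrite -mulrA JJ mulrN1.
rewrite /intertwiner !(mulrBr, mulrBl) !mulrA JJ JI !mulNr !mul1r !xJJ !xjj.
by rewrite !mulNr !opprK; zmod.
Qed.

(** The sum of [intertwiner q * q^-1] over the four [q] is [4]: for [h] other than [1], the element
    [q * h^-1 * q^-1] is twice [h^-1] and twice [- h^-1]. *)
Lemma intertwiner_neq0 : (4%:R : D) != 0 ->
  exists2 q, q \in [:: 1; i; j; i * j] & intertwiner q != 0.
Proof.
move=> D4; apply/hasP; apply: contraNT D4; rewrite /= orbF !negb_or !negbK.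
have xiji x : x * i * j * i = x * j by rewrite xji xii mulNr opprK.
move=> /and4P[/eqP y1 /eqP yi /eqP yj /eqP yk]; apply/eqP.
have := congr1 (fun x => x * (i * j)) yk.
have := congr1 (fun x => x * j) yj; have := congr1 (fun x => x * i) yi.
move: y1; rewrite /intertwiner !mulr1 !mulrBl !mul0r !mulrA.
rewrite ?(ii, jj, ji, xii, xjj, xji, mulrN, mulNr, mul1r, opprK, xiji).
move=> E1 E2 E3 E4.
have E : 1 - I * i - J * j - I * J * i * j -
    (-1 + I * i - J * j - I * J * i * j) -
    (-1 - I * i + J * j - I * J * i * j) -
    (-1 - I * i - J * j + I * J * i * j) = 0 by rewrite E1 E2 E3 E4 !subr0.
by rewrite -[RHS]E -[LHS]/(1 + (1 + (1 + 1))); zmod.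
Qed.

End QuaternionConjugation.

(** * Homogeneous elements and the component of degree 0 *)

Section GradedDivisionAlgebra.
Variables (R : realType) (G : zmodType) (D : unitAlgType R).
Variables (Dg : G -> set D) (T : zmodClosed G) (phi0 : {linear D -> D}).
Variables (delta : int) (kind : De_kind).
Variables (X : G -> D) (eta : G -> int) (xi : {quot T} -> G).
Variables (iu : D) (nu : G -> int).
Hypothesis hD : graded_division Dg.
Hypothesis hT : is_support Dg T.
Hypothesis hinv : is_involution phi0.
Hypothesis hdeg : forall g d, Dg g d -> Dg g (phi0 d).
Hypothesis hDe : De_conjugation Dg kind phi0.
Hypothesis hdelta : delta = 1 \/ delta = -1.
Hypothesis hdeltaZ : (exists2 z, central z & phi0 z <> z) -> delta = 1.
Hypothesis hC : De_C_central Dg kind ->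
  finite_set [set t | t \in T] /\ (forall d, central d <-> Dg 0 d).
Hypothesis hX : X_choice Dg T phi0 delta kind X.
Hypothesis heta : eta_spec T phi0 X eta.
Hypothesis hxi : forall x, \pi_{quot T} (xi x) = x.
Hypothesis hiu : kind = De_H -> Dg 0 iu /\ iu ^+ 2 = -1.
Hypothesis hnu : nu_choice Dg T kind X nu.

Local Notation pi := (\pi_{quot T}).

Lemma phi0M x y : phi0 (x * y) = phi0 y * phi0 x.
Proof. exact: (proj1 hinv). Qed.

Lemma phi0K : involutive phi0.
Proof. exact: (proj2 hinv). Qed.

Lemma phi01 : phi0 1 = 1.
Proof.
have /(congr1 phi0) : phi0 1 * 1 = phi0 1 by rewrite mulr1.
by rewrite phi0M phi0K mulr1.
Qed.

Lemma phi0_unit x : x \is a GRing.unit -> phi0 x \is a GRing.unit.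
Proof.
move=> ux; apply/unitrP; exists (phi0 x^-1).
by rewrite -!phi0M mulVr // divrr // phi01.
Qed.

Lemma phi0V x : x \is a GRing.unit -> phi0 x^-1 = (phi0 x)^-1.
Proof.
move=> ux; apply: (mulrI (phi0_unit ux)).
by rewrite divrr ?phi0_unit // -phi0M mulVr // phi01.
Qed.

Lemma Dg0 g : Dg g 0.
Proof. by case: hD => -[]. Qed.

Lemma DgP g (a : R) x y : Dg g x -> Dg g y -> Dg g (a *: x + y).
Proof. by case: hD => -[] _ + _ _ _ _; apply. Qed.

Lemma DgD g x y : Dg g x -> Dg g y -> Dg g (x + y).
Proof. by move=> gx gy; rewrite -[x]scale1r; exact: DgP. Qed.

Lemma DgZ g (a : R) x : Dg g x -> Dg g (a *: x).
Proof. by move=> gx; rewrite -[_ *: _]addr0; apply: DgP => //; exact: Dg0. Qed.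

Lemma DgN g x : Dg g x -> Dg g (- x).
Proof. by move=> gx; rewrite -scaleN1r; exact: DgZ. Qed.

Lemma DgB g x y : Dg g x -> Dg g y -> Dg g (x - y).
Proof. by move=> gx gy; apply: DgD => //; exact: DgN. Qed.

Lemma DgMz g x (e : int) : Dg g x -> Dg g (x *~ e).
Proof. by move=> gx; rewrite -scaler_int; exact: DgZ. Qed.

Lemma Dg_sum g (I : Type) (r : seq I) (P : pred I) (F : I -> D) :
  (forall i, P i -> Dg g (F i)) -> Dg g (\sum_(i <- r | P i) F i).
Proof. by move=> gF; elim/big_ind: _ => //; [exact: Dg0|exact: DgD]. Qed.

Lemma DgM g h x y : Dg g x -> Dg h y -> Dg (g + h) (x * y).
Proof. by case: hD => -[] _ _ + _ _ _; apply. Qed.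

Lemma DgMe k g h x y : k = g + h -> Dg g x -> Dg h y -> Dg k (x * y).
Proof. by move=> ->; exact: DgM. Qed.

Lemma Dg_unit g x : Dg g x -> x != 0 -> x \is a GRing.unit.
Proof. by case: hD => _; apply. Qed.

Lemma Dg_inj g h x : Dg g x -> Dg h x -> x != 0 -> g = h.
Proof.
move=> gx hx x0; apply/eqP; apply: contraT => gh.
case: hD => -[_ _ _ _ fr] _.
pose f k := if k == g then x else if k == h then - x else 0.
have := fr [:: g; h] f; rewrite /= inE gh => /(_ isT) H.
have : f g = 0.
  apply: H; last by rewrite inE eqxx.
    move=> k; rewrite /f; case: eqP => [->//|_].
    by case: eqP => [->|_]; [exact: DgN|exact: Dg0].
  by rewrite !big_cons big_nil /f !eqxx [h == g]eq_sym (negPf gh) addr0 subrr.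
by rewrite /f eqxx => /eqP; rewrite (negPf x0).
Qed.

Lemma Dg_decomp d : exists (s : seq G) (f : G -> D),
  [/\ uniq s, forall g, Dg g (f g) & d = \sum_(g <- s) f g].
Proof.
case: hD => -[_ _ _ sp _] _; have [s [f [gf ->]]] := sp d.
exists (undup s), (fun g => f g *+ count_mem g s); split.
- exact: undup_uniq.
- by move=> g; rewrite -[_ *+ _]/(_ *~ (Posz _)); exact: DgMz.
- by rewrite -big_undup_iterop_count.
Qed.

(** Subtracting the sum itself, as an element of degree [k], leaves a vanishing sum over distinct
    degrees, to which independence of the components applies. *)
Lemma Dg_component k (s : seq G) (f : G -> D) :
  uniq s -> (forall g, Dg g (f g)) -> Dg k (\sum_(g <- s) f g) ->
  \sum_(g <- s) f g = if k \in s then f k else 0.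
Proof.
move=> us gf kS; case: hD => -[_ _ _ _ fr] _.
set z := \sum_(g <- s) f g in kS *.
have [ks|ks] := boolP (k \in s).
  pose F g := if g == k then f g - z else f g.
  have := fr s F us => H; suff: F k = 0.
    by rewrite /F eqxx => /eqP; rewrite subr_eq0 => /eqP.
  apply: H => // [g|].
    by rewrite /F; case: eqP => [->|//]; exact: DgB.
  rewrite (bigD1_seq k) //= /F eqxx (eq_bigr f) => [|g /negPf->//].
  by rewrite addrAC -(bigD1_seq k) //= subrr.
pose F g := if g == k then - z else f g.
have := fr (k :: s) F => H; suff: F k = 0.
  by rewrite /F eqxx => /eqP; rewrite oppr_eq0 => /eqP.
apply: H; last by rewrite inE eqxx.
- by rewrite /= ks.
- by move=> g; rewrite /F; case: eqP => [->|//]; exact: DgN.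
rewrite big_cons /F eqxx [X in _ + X]big_seq (eq_bigr f) => [|g]; last first.
  by case: eqP ks => [->|//] /negPf->.
by rewrite -big_seq addNr.
Qed.

Lemma Dg1 : Dg 0 1.
Proof.
case: kind hDe => -[f [_ fP] _]; apply/fP;
  by exists 1; exact: rmorph1.
Qed.

(** Since [x * x^-1 = 1] has degree 0, the component of [x^-1] of degree [- g] is already an inverse
    of [x]. *)
Lemma Dg_inv g x : Dg g x -> x != 0 -> Dg (- g) x^-1.
Proof.
move=> gx x0; have ux := Dg_unit gx x0.
have [s [f [us gf xE]]] := Dg_decomp x^-1.
have us' : uniq [seq g + h | h <- s] by rewrite map_inj_uniq //; exact: addrI.
have gf' h : Dg h (x * f (h - g)) by apply: (DgMe _ gx (gf _));
  rewrite addrC subrK.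
have := Dg_component (k := 0) us' gf'.
rewrite big_map; under eq_bigr do rewrite addrC addKr.
rewrite -mulr_sumr -xE divrr // => /(_ Dg1).
case: ifP => [_ H|_ /eqP]; last by rewrite oner_eq0.
rewrite sub0r in H; have -> : x^-1 = f (- g); last exact: gf.
by apply: (mulrI ux); rewrite divrr.
Qed.

Lemma De_mul a b : Dg 0 a -> Dg 0 b -> Dg 0 (a * b).
Proof. by move=> a0 b0; apply: (DgMe _ a0 b0); rewrite addr0. Qed.

Lemma De_unit a : Dg 0 a -> a != 0 -> a \is a GRing.unit /\ Dg 0 a^-1.
Proof.
move=> a0 an0; split; first exact: Dg_unit a0 an0.
by rewrite -oppr0; exact: Dg_inv.
Qed.

Lemma unit_neq0 (x : D) : x \is a GRing.unit -> x != 0.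
Proof. by apply: contraTneq => ->; rewrite unitr0. Qed.

Lemma DgM_neq0 g h x y :
  Dg g x -> Dg h y -> x != 0 -> y != 0 -> x * y != 0.
Proof.
move=> gx hy x0 y0; apply: unit_neq0.
by rewrite unitrMl ?(Dg_unit gx) ?(Dg_unit hy).
Qed.

Lemma inv_neq0 (x : D) : x \is a GRing.unit -> x^-1 != 0.
Proof. by move=> ux; apply: unit_neq0; rewrite unitrV. Qed.

Lemma Dg_support g x : Dg g x -> x != 0 -> g \in T.
Proof. by move=> gx x0; apply/hT; exists x. Qed.

Lemma central_homogeneous d :
  (forall g x, Dg g x -> d * x = x * d) -> central d.
Proof.
move=> hom e; have [s [f [_ gf ->]]] := Dg_decomp e.
by rewrite mulr_sumr mulr_suml; apply: eq_bigr => g _; exact: hom.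
Qed.

Lemma scaler1_inj : injective (fun a : R => a%:A : D).
Proof. exact: (fmorph_inj (in_alg D)). Qed.

Lemma rsignE (a : R) : rsign (a%:A : D) = sgz a.
Proof.
rewrite /rsign; congr sgz; case: xgetP => [b -> /= /scaler1_inj //|].
by move=> /(_ a) /=.
Qed.

Lemma phi0_fixed_real d : Dg 0 d -> phi0 d = d -> exists a : R, d = a%:A.
Proof.
case: kind hDe => /= -[f [finj fP] fphi] /fP[b <-]; rewrite fphi.
- by move=> _; exists b; rewrite -[in RHS](rmorph1 f) -linearZ /= [_ *: _]mulr1.
- move=> /finj; case: b => a b [] Eb; have -> : b = 0 by lra.
  exists a; rewrite -[in RHS](rmorph1 f) -linearZ /=; congr (f _).
  by apply/eqP; rewrite eq_complex /= mulr1 mulr0 !eqxx.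
- move=> /finj; case: b => a b c e [] Eb Ec Ee.
  have [-> -> ->] : [/\ b = 0, c = 0 & e = 0] by split; lra.
  exists a; rewrite -[in RHS](rmorph1 f) -linearZ /=; congr (f _).
  by congr Quat; rewrite ?mulr1 ?mulr0.
Qed.

(** [phi0 d * d] is the sum of the squares of the real coordinates of [d]. The law of inertia rests
    on this positivity. *)
Lemma phi0_norm d : Dg 0 d ->
  exists a : R, [/\ 0 <= a, phi0 d * d = a%:A & a = 0 -> d = 0].
Proof.
case: kind hDe => /= -[f [finj fP] fphi] /fP[b <-]; rewrite fphi -rmorphM.
- exists (b ^+ 2); split; first exact: sqr_ge0.
    by rewrite -[in RHS](rmorph1 f) -linearZ /= [_ *: _]mulr1.
  by move/eqP; rewrite sqrf_eq0 => /eqP->; rewrite rmorph0.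
- case: b => a b; exists (a ^+ 2 + b ^+ 2); split.
  + by rewrite addr_ge0 ?sqr_ge0.
  + rewrite -[in RHS](rmorph1 f) -linearZ /=; congr (f _).
    by apply/eqP; rewrite eq_complex /=; apply/andP; split; apply/eqP; ring.
  + move/eqP; rewrite paddr_eq0 ?sqr_ge0 // !sqrf_eq0 => /andP[/eqP-> /eqP->].
    exact: (rmorph0 f).
- case: b => a b c e; exists (a ^+ 2 + b ^+ 2 + c ^+ 2 + e ^+ 2); split.
  + by rewrite !addr_ge0 ?sqr_ge0.
  + rewrite -[in RHS](rmorph1 f) -linearZ /=; congr (f _).
    by congr Quat => /=; ring.
  + move/eqP; rewrite !paddr_eq0 ?addr_ge0 ?sqr_ge0 // !sqrf_eq0.
    by move=> /andP[/andP[/andP[/eqP-> /eqP->] /eqP->] /eqP->];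
      exact: (rmorph0 f).
Qed.

Lemma De_R_real d : kind = De_R -> Dg 0 d -> exists a : R, d = a%:A.
Proof.
move=> kR /[dup] d0 d0'; apply: phi0_fixed_real => //.
by move: hDe d0; rewrite kR => -[f [_ fP] fphi] /fP[b <-].
Qed.

Lemma De_C_comm d e : kind = De_C -> Dg 0 d -> Dg 0 e -> d * e = e * d.
Proof.
move=> kC; move: hDe; rewrite kC => -[f [_ fP] _] /fP[a <-] /fP[b <-].
by rewrite -!rmorphM mulrC.
Qed.

Lemma De_C_sqrt d : kind = De_C -> Dg 0 d -> exists2 e, Dg 0 e & e * e = d.
Proof.
move=> kC; move: hDe; rewrite kC => -[f [_ fP] _] /fP[a <-].
exists (f (sqrtc a)); first by apply/fP; exists (sqrtc a).
by rewrite -rmorphM; congr (f _); have := sqr_sqrtc a; rewrite expr2.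
Qed.

Lemma De_C_basis : kind = De_C -> exists i : D,
  [/\ Dg 0 i, i * i = -1, phi0 i = - i
    & forall d, Dg 0 d -> exists a b : R, d = a%:A + b *: i].
Proof.
move=> kC; move: hDe; rewrite kC => -[f [_ fP] fphi].
pose i0 : Rcomplex R := (0 +i* 1)%C.
exists (f i0); split.
- by apply/fP; exists i0.
- rewrite -rmorphM -(rmorph1 f) -rmorphN; congr (f _).
  by apply/eqP; rewrite eq_complex /= !mulr0 !mul0r mulr1 sub0r addr0 oppr0
    !eqxx.
- rewrite fphi -rmorphN; congr (f _).
  by apply/eqP; rewrite eq_complex /= oppr0 !eqxx.
- move=> d /fP[[a b] <-]; exists a, b.
  rewrite -(rmorph1 f) -!linearZ -rmorphD /=; congr (f _).
  by apply/eqP; rewrite eq_complex /= !mulr1 !mulr0 addr0 add0r !eqxx.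
Qed.

Lemma De_H_basis : kind = De_H -> exists i j : D,
  [/\ Dg 0 i /\ Dg 0 j, i * i = -1 /\ j * j = -1, j * i = - (i * j)
    & forall d, Dg 0 d -> exists a b c e : R,
        d = a%:A + b *: i + c *: j + e *: (i * j)].
Proof.
move=> kH; move: hDe; rewrite kH => -[f [_ fP] fphi].
pose i0 : quat R := Quat 0 1 0 0; pose j0 : quat R := Quat 0 0 1 0.
exists (f i0), (f j0); split.
- by split; apply/fP; [exists i0|exists j0].
- by split; rewrite -rmorphM -(rmorph1 f) -rmorphN; congr (f _);
    congr Quat => /=; ring.
- by rewrite -!rmorphM -rmorphN; congr (f _); congr Quat => /=; ring.
- move=> d /fP[[a b c e] <-]; exists a, b, c, e.
  rewrite -(rmorph1 f) -rmorphM -!linearZ -!rmorphD /=; congr (f _).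
  by congr Quat => /=; ring.
Qed.

Lemma De_H_center d : kind = De_H -> Dg 0 d ->
  (forall e, Dg 0 e -> d * e = e * d) -> exists a : R, d = a%:A.
Proof.
move=> kH; move: hDe; rewrite kH => -[f [finj fP] _] /fP[[a b c e] <-] com.
have := com (f (Quat 0 1 0 0)) (proj2 (fP _) (ex_intro _ _ erefl)).
rewrite -!rmorphM => /finj -[] _ _ /eqP E1 /eqP E2.
have := com (f (Quat 0 0 1 0)) (proj2 (fP _) (ex_intro _ _ erefl)).
rewrite -!rmorphM => /finj -[] _ _ _ /eqP E3.
exists a; rewrite -[in RHS](rmorph1 f) -linearZ /=; congr (f _).
by congr Quat => /=; lra.
Qed.

(* For [mu < 0], [z] is a multiple of an imaginary quaternion orthogonal to   *)
(* [iu]: conjugating by it changes the sign of [iu].                          *)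
Lemma De_H_rescale (mu : R) : kind = De_H -> mu != 0 ->
  exists2 z, Dg 0 z & phi0 z * iu * z = mu *: iu.
Proof.
move=> kH; move: hDe (hiu kH); rewrite kH => -[f [finj fP] fphi] [/fP[q qE]].
rewrite -qE expr2 -rmorphM -(rmorph1 f) -rmorphN => /finj qq mu0.
suff [z zE] : exists z, conjq z * q * z = mu *: q.
  exists (f z); first by apply/fP; exists z.
  by rewrite fphi -!rmorphM zE -linearZ.
move/quat_sqrN1: (qq); case: q qq {qE} => a b c e [] /= E0 _ _ _ a0.
subst a; have [mu_ge0|mu_lt0] := leP 0 mu.
  have [r rE] : exists r, mu = r ^+ 2.
    by exists (Num.sqrt mu); rewrite sqr_sqrtr.
  by exists (Quat r 0 0 0); congr Quat => /=; rewrite rE; ring.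
have [bc0|bc0] := eqVneq (b ^+ 2 + c ^+ 2) 0.
  move/eqP: bc0; rewrite paddr_eq0 ?sqr_ge0 // !sqrf_eq0 =>
    /andP[/eqP b0 /eqP c0].
  have [r rE] : exists r, mu = - r ^+ 2.
    by exists (Num.sqrt (- mu)); rewrite sqr_sqrtr ?opprK // oppr_ge0 ltW.
  by subst b c; exists (Quat 0 r 0 0); congr Quat => /=; rewrite rE; ring.
have [r rE] : exists r, mu = - (r ^+ 2 * (b ^+ 2 + c ^+ 2)).
  exists (Num.sqrt (- mu / (b ^+ 2 + c ^+ 2))).
  rewrite sqr_sqrtr ?divfK ?opprK // divr_ge0 ?addr_ge0 ?sqr_ge0 //.
  by rewrite oppr_ge0 ltW.
exists (Quat 0 (- r * c) (r * b) 0).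
by congr Quat => /=; rewrite rE; ring.
Qed.

Lemma phi0_imaginary i : kind = De_H -> Dg 0 i -> i * i = -1 -> phi0 i = - i.
Proof.
move=> kH; move: hDe; rewrite kH => -[f [finj fP] fphi] /fP[q <-].
rewrite -rmorphM -(rmorph1 f) -rmorphN => /finj /quat_sqrN1.
case: q => a b c e /= a0; rewrite fphi -rmorphN; congr (f _).
by congr Quat => //=; rewrite a0 oppr0.
Qed.

(** * The support, the chosen elements [X t] and the types of self-dual blocks *)

Lemma T0 : 0 \in T.
Proof. exact: rpred0. Qed.

Lemma TD s t : s \in T -> t \in T -> s + t \in T.
Proof. exact: rpredD. Qed.

Lemma TN t : t \in T -> - t \in T.
Proof. by rewrite rpredN. Qed.

Lemma eq_pi a b : (pi a = pi b) <-> (a - b \in T).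
Proof. by rewrite Quotient.idealrBE; split => [->|/eqP]. Qed.

Lemma piD a b : pi (a + b) = pi a + pi b.
Proof. exact: Quotient.pi_add. Qed.

Lemma piN a : pi (- a) = - pi a.
Proof. exact: Quotient.pi_opp. Qed.

Lemma selfdualE g0 y : selfdual g0 y <-> tau xi g0 y \in T.
Proof.
split=> [[g -> gT]|tT]; last by exists (xi y); rewrite ?hxi.
have /eq_pi e : pi (xi (pi g)) = pi g by rewrite hxi.
rewrite /tau; have -> : g0 + xi (pi g) *+ 2 =
    g0 + g *+ 2 + (xi (pi g) - g) + (xi (pi g) - g) by zmod.
by do 2!apply: TD => //.
Qed.

Lemma Xg t : t \in T -> Dg t (X t).
Proof. by case/hX. Qed.
Lemma X0 t : t \in T -> X t != 0.
Proof. by case/hX. Qed.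
Lemma Xu t : t \in T -> X t \is a GRing.unit.
Proof. by move=> tT; apply: (Dg_unit (Xg tT)); exact: X0. Qed.

Lemma Xinv t : t \in T -> Dg (- t) (X t)^-1.
Proof. by move=> tT; apply: Dg_inv; [exact: Xg|exact: X0]. Qed.

Lemma XDe t d : t \in T -> Dg t d -> exists2 z, Dg 0 z & d = X t * z.
Proof.
move=> tT dt; exists ((X t)^-1 * d); last by rewrite mulVKr ?Xu.
by apply: (DgMe _ (Xinv tT) dt); rewrite addNr.
Qed.

Lemma eta_pm t : t \in T -> eta t = 1 \/ eta t = -1.
Proof. by case/heta. Qed.

Lemma phi0X t : t \in T -> phi0 (X t) = X t *~ eta t.
Proof. by case/heta. Qed.

Lemma mulz_sign_inj (x : D) (a b : int) : x != 0 ->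
  a = 1 \/ a = -1 -> b = 1 \/ b = -1 -> x *~ a = x *~ b -> a = b.
Proof.
move=> x0; have xx : x <> - x.
  move/eqP; rewrite -addr_eq0 -mulr2n -scaler_nat scaler_eq0 (negPf x0) orbF.
  by rewrite pnatr_eq0.
case=> ->; case=> -> //; rewrite ?mulrNz ?mulr1z => E; case: xx => //.
Qed.

Lemma sign_neq (a b : int) : a = 1 \/ a = -1 -> b = 1 \/ b = -1 ->
  a <> b -> a = - b.
Proof. by case=> ->; case=> ->; rewrite ?opprK. Qed.

Lemma De_C_root i d : kind = De_C -> Dg 0 i -> i * i = -1 -> Dg 0 d ->
  d * d = -1 -> d = i \/ d = - i.
Proof.
move=> kC i0 ii d0 dd; have [->|dNi] := eqVneq d i; [by left|right].
have : (d - i) * (d + i) = 0.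
  by rewrite mulrBl !mulrDr ii dd (De_C_comm kC i0 d0) (addrC (-1)) subrr.
have u : d - i \is a GRing.unit.
  by apply: (Dg_unit (DgB d0 i0)); rewrite subr_eq0.
by rewrite -[0](mulr0 (d - i)) => /(mulrI u)/eqP; rewrite addr_eq0 => /eqP.
Qed.

(** Conjugation by [x] preserves the component of degree 0, so it sends [i] to a square root of
    [-1], that is to [i] or [- i]. The first would put [t] in K. *)
Lemma De_C_conj t x z : kind = De_C -> t \in T -> ~~ inK Dg T kind t ->
  Dg t x -> Dg 0 z -> x * z = phi0 z * x.
Proof.
move=> kC tT tK xt z0; have [->|x0] := eqVneq x 0; first by rewrite mul0r mulr0.
have [i [i0 ii phii ib]] := De_C_basis kC.
have ux := Dg_unit xt x0.
have i'0 : Dg 0 (x * i / x).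
  have xi0 : Dg t (x * i) by apply: (DgMe _ xt i0); rewrite addr0.
  by apply: (DgMe _ xi0 (Dg_inv xt x0)); rewrite subrr.
have ii' : (x * i / x) * (x * i / x) = -1.
  by rewrite !mulrA divrK // -[x * i * i]mulrA ii mulrN1 mulNr divrr.
have [E|E] := De_C_root kC i0 ii i'0 ii'; last first.
  have {E} xiE : x * i = - i * x by rewrite -E divrK.
  have [a [b ->]] := ib z z0.
  rewrite raddfD /= !linearZ /= phi01 phii mulrDr mulrDl -!scalerAr -!scalerAl
    xiE.
  by rewrite mulr1 mul1r.
have {}E : x * i = i * x by rewrite -[in RHS]E divrK.
have xc e : Dg 0 e -> x * e = e * x.
  move=> /ib[a [b ->]]; rewrite mulrDr mulrDl -!scalerAr -!scalerAl E.
  by rewrite mulr1 mul1r.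
case/negP: tK; rewrite /inK tT kC; apply/asboolP => d dt e e0.
have d'0 : Dg 0 (x^-1 * d) by apply: (DgMe _ (Dg_inv xt x0) dt); rewrite addNr.
by rewrite -[d](mulVKr ux) -mulrA (De_C_comm kC d'0 e0) !mulrA xc.
Qed.

(* The self-dual blocks [X_t S] carry a signature if [sig t], and they are     *)
(* alternating, hence of even size, if [alt t].                                *)
Definition sig t := [/\ t \in T,
  commutes_De Dg (X t) & phi0 (X t) = X t *~ delta].
Definition alt t := t \in T /\ forall d, Dg t d -> phi0 d = - (d *~ delta).

(** With [d = X t * z], the symmetry conditions give [phi0 z = z], and a fixed point of the
    conjugation is real. The sign factors of the actions are signs of such real numbers. *)
Lemma sig_real t d : sig t -> Dg t d -> commutes_De Dg d ->
  phi0 d = d *~ delta -> exists a : R, d = a *: X t.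
Proof.
move=> [tT Xc phiX] dt dc phid; have [z z0 zE] := XDe tT dt.
have [|a aE] := @phi0_fixed_real z z0; last first.
  by exists a; rewrite zE aE -scalerAr mulr1.
apply: (mulrI (Xu tT)); rewrite Xc; last exact: hdeg.
have : phi0 z * (X t *~ delta) = X t * z *~ delta by rewrite -phiX -phi0M -zE.
by case: hdelta => ->; rewrite ?mulr1z // !mulrNz mulrN => /oppr_inj.
Qed.

(** The property [sig] does not depend on the chosen [X t]: over R and H a witness is a real
    multiple of [X t], and over C the normalisation in [X_choice] makes [X t] symmetric. Thus
    witnesses can be transported. *)
Lemma sigP t : sig t <-> exists d,
  [/\ Dg t d, d != 0, commutes_De Dg d & phi0 d = d *~ delta].
Proof.
split=> [[tT Xc phiX]|[d [dt d0 dc phid]]].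
  by exists (X t); split; rewrite ?X0 //; exact: Xg.
have tT := Dg_support dt d0; have [z z0 zE] := XDe tT dt.
have z_neq0 : z != 0 by apply: contraNneq d0 => z0'; rewrite zE z0' mulr0.
suff [Xc XE] : commutes_De Dg (X t) /\ phi0 (X t) = X t *~ delta by split.
have real : (exists a : R, z = a%:A) -> phi0 (X t) = X t *~ delta.
  move=> [a aE]; have a0 : a != 0.
    by apply: contraNneq z_neq0 => a0; rewrite aE a0 scale0r.
  move: phid; rewrite zE aE -scalerAr mulr1 linearZ /= scalerMzr.
  by move=> /(scalerI a0).
have zu := Dg_unit z0 z_neq0.
case kE : kind.
- split; last exact: real (De_R_real kE z0).
  move=> e /(De_R_real kE)[a ->].
  by rewrite -scalerAr -scalerAl mulr1 mul1r.
- have Xc : commutes_De Dg (X t).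
    move=> e e0; apply: (mulIr zu); rewrite -[LHS]mulrA -[in RHS]mulrA.
    by rewrite -zE (De_C_comm kE e0 z0) mulrA -zE dc.
  split=> //; case: (hX tT) => _ _ _; apply=> //.
  rewrite /inK tT kE; apply/asboolP => d' /(XDe tT)[z' z'0 ->] e e0.
  by rewrite -mulrA (De_C_comm kE z'0 e0) !mulrA Xc.
- have Xc : commutes_De Dg (X t) by case: (hX tT) => _ _ /(_ kE).
  split=> //; apply: real; apply: (De_H_center kE z0) => e e0.
  apply: (mulrI (Xu tT)); rewrite !mulrA -zE dc // Xc //.
  by rewrite zE mulrA.
Qed.

Local Notation Sent := (S_entry Dg T delta kind eta iu).

Lemma inKP t : kind = De_C -> inK Dg T kind t <-> sig t.
Proof.
move=> kC; split=> [/[dup] tK|[tT Xc phiX]]; last first.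
  rewrite /inK tT kC; apply/asboolP => d /(XDe tT)[z z0 ->] e e0.
  by rewrite -mulrA (De_C_comm kC z0 e0) !mulrA Xc.
rewrite {1}/inK kC => /andP[tT /asboolP Kt]; split=> //.
  by apply: Kt; exact: Xg.
by case: (hX tT) => _ _ _; apply.
Qed.

(** Over R and H the element [X t] commutes with D_e by its choice, so only [eta] matters; over C
    this is [inKP]. *)
Lemma supp_sig g0 y :
  signature_supp Dg delta kind eta xi g0 y <-> sig (tau xi g0 y).
Proof.
have eta_sig : tau xi g0 y \in T -> kind <> De_C ->
    (eta (tau xi g0 y) = delta <-> sig (tau xi g0 y)).
  set t := tau xi g0 y => tT kC; split=> [etaE|[_ _]]; last first.
    by rewrite phi0X //; apply: mulz_sign_inj; rewrite ?X0 //; exact: eta_pm.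
  split=> //; last by rewrite phi0X // etaE.
  case kE : kind kC => // _; last by case: (hX tT) => _ _ /(_ kE).
  move=> e /(De_R_real kE)[a ->].
  by rewrite -scalerAr -scalerAl mulr1 mul1r.
split=> [[/selfdualE tT]|sigt].
  case kE : kind => [||].
  - by move/(proj1 (eta_sig tT _)); apply; rewrite kE.
  - by rewrite -kE => /(inKP _ kE).
  - by move/(proj1 (eta_sig tT _)); apply; rewrite kE.
have tT : tau xi g0 y \in T by case: sigt.
split; first exact/selfdualE.
case kE : kind.
- by apply/eta_sig => //; rewrite kE.
- by rewrite -kE; apply/(inKP _ kE).
- by apply/eta_sig => //; rewrite kE.
Qed.

(** Conjugation by [X u] acts on D_e as the identity or, over C outside K, as the conjugation; both
    are involutive, so one [e'] serves both equations. *)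
Lemma X_swap u e : u \in T -> Dg 0 e ->
  exists e', [/\ Dg 0 e', X u * e = e' * X u & X u * e' = e * X u].
Proof.
move=> uT e0; have [com|] := pselect (commutes_De Dg (X u)).
  by exists e; rewrite com.
case kE : kind => [||] ncom.
- case: ncom => e' /(De_R_real kE)[a ->].
  by rewrite -scalerAr -scalerAl mulr1 mul1r.
- have uK : ~~ inK Dg T kind u.
    by apply/negP => /(inKP _ kE)[_ ? _].
  exists (phi0 e); split; first exact: hdeg.
    exact: De_C_conj kE uT uK (Xg uT) e0.
  by rewrite (De_C_conj kE uT uK (Xg uT) (hdeg e0)) phi0K.
- by case: ncom; case: (hX uT) => _ _ /(_ kE).
Qed.

Lemma phi0Xinv u : u \in T -> phi0 (X u)^-1 = (X u)^-1 *~ eta u.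
Proof.
move=> uT; rewrite phi0V ?Xu // phi0X //; case: (eta_pm uT) => ->.
  by rewrite !mulr1z.
by rewrite !mulrNz invrN !mulr1z.
Qed.

Lemma Xphi0_self u x y : u \in T -> x = X u \/ x = (X u)^-1 ->
  phi0 (x * y * x) = x * phi0 y * x.
Proof.
move=> uT xE; rewrite !phi0M mulrA; suff [e [epm ->]] : exists e : int,
    (e = 1 \/ e = -1) /\ phi0 x = x *~ e.
  by case: epm => ->; rewrite ?mulrNz ?mulr1z // mulrN !mulNr opprK.
exists (eta u); split; first exact: eta_pm.
by case: xE => ->; [exact: phi0X|exact: phi0Xinv].
Qed.

(** * Invariance of the block types under the action *)

Definition graded_aut (psi : {lrmorphism D -> D}) :=
  [/\ bijective psi, forall g d, Dg g d -> Dg g (psi d)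
    & forall d, phi0 (psi d) = psi (phi0 d)].

Lemma rmorph_unit_neq0 (psi : {lrmorphism D -> D}) d g :
  Dg g d -> d != 0 -> psi d != 0.
Proof. by move=> dg d0; apply: unit_neq0; apply: rmorph_unit;
  exact: Dg_unit dg d0. Qed.

(** [psi] carries components to components, so [psi d] is the image of the component of degree [g]
    alone. It follows that the inverse of [psi] preserves degrees too. *)
Lemma aut_reflects_Dg (psi : {lrmorphism D -> D}) g d :
  injective psi -> (forall g d, Dg g d -> Dg g (psi d)) ->
  Dg g (psi d) -> Dg g d.
Proof.
move=> psi_inj psiD; have [s [f [us fg ->]]] := Dg_decomp d.
rewrite raddf_sum => gS.
rewrite (psi_inj (\sum_(k <- s) f k) (if g \in s then f g else 0)).
  by case: ifP => _; [exact: fg|exact: Dg0].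
rewrite raddf_sum (Dg_component us _ gS); last by move=> k; exact: psiD.
by case: ifP => _ //; rewrite raddf0.
Qed.

Lemma groupC_T c h : groupC Dg phi0 c h -> h \in T.
Proof. by case=> ch c0 _ _; exact: Dg_support ch c0. Qed.

Section Transport.
Variables (psi : {lrmorphism D -> D}) (c : D) (h u t : G).
Hypothesis psiA : graded_aut psi.
Hypothesis cC : groupC Dg phi0 c h.
Hypotheses (uT : u \in T) (tT : t \in T).

Local Notation t' := (t + h + u *+ 2).
(* How the action of [(g, c, psi)] changes the entries of a self-dual block,   *)
(* [t] and [t'] being its degrees before and after.                            *)
Definition transport x := X u * (psi x * c) * X u.

Lemma groupC_unit : c \is a GRing.unit.
Proof. by case: cC => ch c0 _ _; exact: Dg_unit ch c0. Qed.

Lemma transport_inT : t' \in T.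
Proof. by rewrite mulr2n !TD // (groupC_T cC). Qed.

Lemma transport_Dg x : Dg t x -> Dg t' (transport x).
Proof.
case: cC => ch _ _ _; case: psiA => _ psiD _ tx.
rewrite /transport; apply: (DgMe _ (DgM (Xg uT) (DgM (psiD _ _ tx) ch)) (Xg
  uT)).
zmod.
Qed.

Lemma transport_neq0 x : Dg t x -> x != 0 -> transport x != 0.
Proof.
move=> tx x0; apply: unit_neq0; rewrite unitrMl ?Xu //.
by rewrite unitrMr ?Xu // unitrMl ?groupC_unit // rmorph_unit // (Dg_unit tx).
Qed.

Lemma transport_phi0 x : phi0 (transport x) = transport (phi0 x).
Proof.
case: cC => _ _ cZ phic; case: psiA => _ _ psiphi.
by rewrite /transport (Xphi0_self _ uT) ?phi0M ?phic ?psiphi -?cZ //; left.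
Qed.

Lemma transport_surj y : Dg t' y -> exists2 x, Dg t x & transport x = y.
Proof.
case: (cC) => ch c0 _ _; case: psiA => -[psi' psiK psi'K] psiD _ ty.
exists (psi' ((X u)^-1 * y / X u / c)).
  apply: (aut_reflects_Dg (can_inj psiK) psiD); rewrite psi'K.
  apply: (DgMe _ (DgM (DgM (Xinv uT) ty) (Xinv uT)) (Dg_inv ch c0)); zmod.
by rewrite /transport psi'K divrK ?groupC_unit // mulrA divrK ?mulVKr ?Xu.
Qed.

Lemma aut_commutes x : commutes_De Dg (psi x) <-> commutes_De Dg x.
Proof.
case: psiA => -[psi' psiK psi'K] psiD _; split=> com e e0.
  by apply: (can_inj psiK); rewrite !rmorphM com //; exact: psiD.
rewrite -[e]psi'K -!rmorphM com //.
by apply: (aut_reflects_Dg (can_inj psiK) psiD); rewrite psi'K.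
Qed.

(** The two factors [X u] twist D_e by the same involution ([X_swap]), so the twists cancel, and [c]
    is central. *)
Lemma transport_commutes x :
  commutes_De Dg (transport x) <-> commutes_De Dg x.
Proof.
have uX := Xu uT; case: cC => _ _ cZ _; have uc := groupC_unit.
rewrite -(aut_commutes x); split=> com e e0.
  have [e' [e'0 E1 E2]] := X_swap uT e0.
  have := com e' e'0; rewrite /transport -!mulrA E2 [e' * _]mulrA -E1 !mulrA.
  move=> /(mulIr uX); rewrite -!mulrA => /(mulrI uX).
  by rewrite cZ !mulrA => /(mulIr uc).
have [e' [e'0 E1 E2]] := X_swap uT e0.
rewrite /transport -[LHS]mulrA E1 !mulrA -E2; congr (_ * X u).
by rewrite -!mulrA; congr (X u * _); rewrite cZ !mulrA com.
Qed.

Lemma transport_sig : sig t <-> sig t'.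
Proof.
split=> /sigP[x [tx x0 xc phix]]; apply/sigP.
  exists (transport x); split; first exact: transport_Dg.
  - exact: transport_neq0.
  - exact/transport_commutes.
  - rewrite transport_phi0 phix; case: hdelta => ->; rewrite ?mulrNz ?mulr1z //.
    by rewrite /transport raddfN !(mulrN, mulNr).
have [y ty yE] := transport_surj tx; exists y; split=> //.
- by apply: contraNneq x0 => y0;
    rewrite -yE y0 /transport raddf0 mul0r mulr0 mul0r.
- by apply/transport_commutes; rewrite yE.
move: phix; rewrite -yE transport_phi0 => E.
case: psiA => -[psi' psiK _] _ _; apply: (can_inj psiK).
apply: (mulIr groupC_unit); apply: (mulrI (Xu uT)); apply: (mulIr (Xu uT)).
rewrite -/(transport _) E; case: hdelta => ->; rewrite ?mulrNz ?mulr1z //.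
by rewrite /transport raddfN !(mulrN, mulNr).
Qed.

Lemma transport_alt : alt t <-> alt t'.
Proof.
have trN x : transport (- (x *~ delta)) = - (transport x *~ delta).
  rewrite /transport raddfN raddfMz /=; case: hdelta => ->.
    by rewrite !mulr1z !(mulrN, mulNr).
  by rewrite !mulrNz !mulr1z !opprK.
split=> -[_ tphi]; split=> //; first exact: transport_inT.
  by move=> y /transport_surj[x tx <-]; rewrite transport_phi0 tphi.
move=> x tx; have := tphi _ (transport_Dg tx); rewrite transport_phi0 -trN => E.
case: psiA => -[psi' psiK _] _ _; apply: (can_inj psiK).
by apply: (mulIr groupC_unit); apply: (mulrI (Xu uT)); apply: (mulIr (Xu uT)).
Qed.

End Transport.

Lemma alt_nsig t : alt t -> ~ sig t.
Proof.
move=> [_ tphi] [tT _]; rewrite tphi; last exact: Xg.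
have := X0 tT; move: (X t) => x x0 /eqP; rewrite eq_sym -addr_eq0.
rewrite -mulr2n -scaler_nat scaler_eq0 pnatr_eq0 /=.
by case: hdelta => ->; rewrite ?mulrNz ?oppr_eq0 mulr1z (negPf x0).
Qed.

(** Over H an imaginary [i] gives [X t] and [X t * i] opposite signs under [phi0], which is then no
    scalar on the component; over R, and over C outside K, it is the scalar [eta t]. *)
Lemma altE t : t \in T -> alt t <-> [/\ kind <> De_H,
  eta t = - delta & ~ sig t].
Proof.
move=> tT; split=> [at_|[kH etaE nsig]].
  have etaE : eta t = - delta.
    apply: (mulz_sign_inj (X0 tT) (eta_pm tT)).
      by case: hdelta => ->; rewrite ?opprK; [right|left].
    by rewrite -phi0X // mulrNz; case: at_ => _; apply; exact: Xg.
  split=> //; last exact: alt_nsig.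
  move=> kH; have [i [_ [[i0 _] [ii _] _ _]]] := De_H_basis kH.
  have phii := phi0_imaginary kH i0 ii.
  have ti : Dg t (X t * i) by apply: (DgMe _ (Xg tT) i0); rewrite addr0.
  case: at_ => _ /(_ _ ti); rewrite phi0M phii phi0X // etaE.
  case: (hX tT) => _ _ /(_ kH) Xc _.
  have y0 : X t * i != 0.
    apply: (DgM_neq0 (Xg tT) i0) => //; first exact: X0.
    apply: contra_eq_neq ii => ->.
    by rewrite mul0r eq_sym oppr_eq0 oner_eq0.
  have yE : i * X t = X t * i by rewrite Xc.
  have y2 : X t * i + X t * i <> 0.
    move/eqP; rewrite -mulr2n -scaler_nat scaler_eq0 pnatr_eq0 /=.
    by rewrite (negPf y0).
  case: hdelta => ->; rewrite ?opprK ?mulrNz ?mulr1z ?mulrNN ?mulNr ?opprK yE.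
    by move/eqP; rewrite -addr_eq0 => /eqP.
  by move/eqP; rewrite eq_sym -addr_eq0 => /eqP.
split=> // d td; case kE : kind kH => [||] // _.
  have [z z0 ->] := XDe tT td; have [a ->] := De_R_real kE z0.
  rewrite -scalerAr mulr1 linearZ /= phi0X // etaE mulrNz scalerN scalerMzr //.
have tK : ~~ inK Dg T kind t by apply/negP => /(inKP _ kE).
have [z z0 ->] := XDe tT td; rewrite phi0M phi0X // etaE mulrzAr.
by rewrite -(De_C_conj kE tT tK (Xg tT) z0) mulrNz.
Qed.

Local Notation p_ k sg := (absz ((k%:Z + sg) %/ 2)%Z).

Lemma sig_eta t : sig t -> eta t = delta.
Proof.
case=> tT _ phiX; apply: (mulz_sign_inj (X0 tT) (eta_pm tT)) => //.
by rewrite -phi0X.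
Qed.

Lemma S_entry_sig t k sg : sig t -> Sent t k sg = Sdiag D (p_ k sg).
Proof.
move=> st; rewrite /S_entry (sig_eta st) eqxx.
by case kE : kind => //; rewrite -kE; move/(inKP _ kE): st => ->.
Qed.

Lemma S_entry_alt t k sg : alt t -> Sent t k sg = Salt D k./2.
Proof.
move=> /[dup] at_ [tT _]; have [kH etaE nsig] := proj1 (altE tT) at_.
have etaN : eta t == delta = false by rewrite etaE; case: hdelta => ->.
rewrite /S_entry etaN; case kE : kind kH => // _.
by rewrite -kE; case: ifP => // /(inKP _ kE).
Qed.

(* The self-dual blocks that are neither: [S = s0 I] with [s0] in [1; iu].    *)
Definition scalar_type t s0 :=
  (kind = De_C /\ ~~ inK Dg T kind t /\ s0 = 1 /\ eta t = delta) \/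
  (kind = De_H /\ s0 = iu /\ eta t = - delta).

Lemma S_entry_scalar t : t \in T -> ~ sig t -> ~ alt t ->
  exists s0, scalar_type t s0 /\
    forall k sg a b, Sent t k sg a b = s0 * Sid D a b.
Proof.
move=> tT nsig nalt; rewrite /scalar_type /S_entry.
have etaE : eta t <> - delta -> eta t = delta.
  by case: (eta_pm tT) => ->; case: hdelta => ->.
have nK : kind = De_C -> ~~ inK Dg T kind t.
  by move=> kC; apply/negP => /(inKP _ kC).
case kE : kind => [||].
- case: nalt; apply/altE => //; split=> //; first by rewrite kE.
  apply: contrapT => /etaE eE; apply: nsig; split=> //.
    move=> e /(De_R_real kE)[a ->].
    by rewrite -scalerAr -scalerAl mulr1 mul1r.
  by rewrite phi0X // eE.
- have eE : eta t = delta.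
    by apply: etaE => eE; apply: nalt; apply/altE => //; split; rewrite ?kE.
  exists 1; split=> [|k sg a b]; first by left; rewrite -kE; split;
    last split; auto.
  by rewrite eE eqxx -kE (negPf (nK kE)) mul1r.
- have eE : eta t <> delta.
    move=> eE; apply: nsig; split=> //; last by rewrite phi0X // eE.
    by case: (hX tT) => _ _ /(_ kE).
  exists iu; split=> [|k sg a b]; last by rewrite (negPf (introN eqP eE)).
  right; split=> //; split=> //; apply: sign_neq => //; exact: eta_pm.
Qed.

(** For [h = 0] the two tests in [Salt h] coincide and would put [1] on the diagonal of an
    alternating block; the hypothesis on [k./2] excludes this. In the scalar case over H the sign of
    [phi0 iu] turns [eta t = - delta] into [delta]. *)
Lemma S_entry_herm t k sg a b : t \in T -> (alt t -> 0 < k./2)%N ->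
  phi0 (X t * Sent t k sg a b) = (X t * Sent t k sg b a) *~ delta.
Proof.
move=> tT kh; have [st|nst] := pselect (sig t).
  rewrite !S_entry_sig // /Sdiag [b == a]eq_sym; case: eqP => [->|_].
    have [_ _ phiX] := st.
    by case: ifP => _; rewrite ?mulrN ?raddfN /= mulr1 phiX ?mulNrz.
  by rewrite !mulr0 raddf0 mul0rz.
have [at_|nat_] := pselect (alt t).
  rewrite !S_entry_alt //; have h0 := kh at_; case: at_ => _ phiX.
  rewrite phiX; last first.
    rewrite /Salt; case: eqP => _; first by rewrite mulr1; exact: Xg.
    case: eqP => _; first by rewrite mulrN1; apply: DgN; exact: Xg.
    by rewrite mulr0; exact: Dg0.
  rewrite -mulNrz -mulrN; congr (X t * _ *~ _); rewrite /Salt.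
  have [->|ba] := eqVneq b (a + k./2)%N.
    by case: eqP => //; lia.
  by case: eqP => _; rewrite ?opprK ?oppr0.
have [s0 [st SE]] := S_entry_scalar tT nst nat_;
  rewrite !SE /Sid [b == a]eq_sym.
case: eqP => _; last by rewrite !mulr0 raddf0 mul0rz.
rewrite !mulr1 phi0M phi0X //; case: st => [[kC [tK [-> ->]]]|[kH [-> ->]]].
  by rewrite phi01 mulr1 mul1r.
have [iu0 iuu] := hiu kH; rewrite phi0_imaginary -?expr2 //.
have XE : X t * iu = iu * X t by case: (hX tT) => _ _ /(_ kH) Xc _; exact: Xc.
by case: hdelta => ->; rewrite ?opprK ?mulrNz !mulr1z ?mulrNN ?mulNr ?opprK XE.
Qed.

(* [F] is the matrix [Phi], whose rows are indexed by their class in [G/T] and *)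
(* their position in the block, so that the order of the blocks is irrelevant. *)
Record model (p : param T) (n : nat) (cls : 'I_n -> {quot T})
    (loc : 'I_n -> nat) (F : 'M[D]_n) : Prop := Model {
  model_inj : forall a b, cls a = cls b -> loc a = loc b -> a = b;
  model_lt : forall a, (loc a < p_kappa p (cls a))%N;
  model_surj : forall y k, (k < p_kappa p y)%N ->
    exists a, cls a = y /\ loc a = k;
  model_self : forall a b, tau xi (p_g p) (cls a) \in T -> cls b = cls a ->
    F a b = X (tau xi (p_g p) (cls a)) *
      Sent (tau xi (p_g p) (cls a)) (p_kappa p (cls a)) (p_sigma p (cls a))
        (loc a) (loc b);
  model_pair : forall a b, tau xi (p_g p) (cls a) \notin T ->
    cls a + cls b = - pi (p_g p) ->
    exists e : int, (e = 1 \/ e = -1) /\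
      F a b = X (p_g p + xi (cls a) + xi (cls b)) * (Sid D (loc a) (loc b) *~
        e);
  model_zero : forall a b, cls a + cls b <> - pi (p_g p) -> F a b = 0;
  model_herm : forall a b, phi0 (F a b) = F b a *~ delta }.

Lemma degree_inT g y z : y + z = - pi g <-> g + xi y + xi z \in T.
Proof.
rewrite -{1}(hxi y) -{1}(hxi z) -piD -piN eq_pi.
by have -> : xi y + xi z - - g = g + xi y + xi z by zmod.
Qed.

Lemma alt_even p y : paramX Dg delta kind eta xi p ->
  alt (tau xi (p_g p) y) -> ~~ odd (p_kappa p y).
Proof.
move=> [[_ _ _ hk] _] at_; have [tT _] := at_.
have [kH etaE nsig] := proj1 (altE tT) at_; move/selfdualE in tT.
case kE : kind kH hk => [||] // _ hk; first exact: hk.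
by apply: hk => //; rewrite -kE; apply/negP => /(inKP _ kE).
Qed.

(** * The Gram matrix [Phi] and the positions of its nonzero entries *)

Section PhiModel.
Variables (p : param T) (m r : nat) (x : 'I_(m + r.*2) -> {quot T}).
Hypothesis hp : paramX Dg delta kind eta xi p.
Hypothesis hx : enumeration p x.

Local Notation Phi_xp := (Phi Dg delta kind X eta xi iu p x).

Lemma pair_indexN i j : pair_index m i j -> ~~ pair_index m j i.
Proof. by rewrite /pair_index => /and3P[mi oi /eqP->];
  apply/negP => /and3P[_ _]; lia. Qed.

Lemma pair_index_ex (i : 'I_(m + r.*2)) : (m <= i)%N ->
  exists j : 'I_(m + r.*2), pair_index m i j || pair_index m j i.
Proof.
move=> mi; have lti := ltn_ord i; have [oi|ei] := boolP (odd (i - m)).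
  have lt : (i.-1 < m + r.*2)%N by lia.
  by exists (Ordinal lt); rewrite /pair_index /=; apply/orP; right;
    apply/and3P; split; lia.
have lt : (i.+1 < m + r.*2)%N by lia.
by exists (Ordinal lt); rewrite /pair_index /=; apply/orP; left; apply/and3P;
  split; lia.
Qed.

Lemma pair_index_sum (i j : 'I_(m + r.*2)) :
  pair_index m i j || pair_index m j i ->
  x i + x j = - pi (p_g p).
Proof.
case: hx => _ _ _ hpair; case/orP => /hpair //.
by rewrite addrC.
Qed.

(** A self-dual class is its own partner, whereas the two members of a pair are distinct by
    injectivity of [x]. *)
Lemma pair_index_nself (i : 'I_(m + r.*2)) :
  (m <= i)%N -> tau xi (p_g p) (x i) \notin T.
Proof.
move=> mi; have [j ij] := pair_index_ex mi; apply/negP => tT.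
have jE : x j = x i.
  apply: (addrI (x i)); rewrite (pair_index_sum ij); apply/esym/degree_inT.
  by rewrite -addrA -mulr2n.
case: hx => xinj _ _ _; move: ij; rewrite (xinj _ _ jE) /pair_index.
by rewrite orbb => /and3P[_ _ /eqP]; lia.
Qed.

Lemma model_Phi : model p (fun a => x (tagnat.sig1 a))
  (fun a => nat_of_ord (tagnat.sig2 a)) Phi_xp.
Proof.
have [xinj xsurj xself xpair] := hx.
have PhiE a b : Phi_xp a b = Phi_entry Dg delta kind X eta xi iu p x
    (tagnat.sig1 a) (tagnat.sig1 b) (tagnat.sig2 a) (tagnat.sig2 b).
  by rewrite !mxE.
have selfi (i : 'I_(m + r.*2)) : (i < m)%N = (tau xi (p_g p) (x i) \in T).
  apply/idP/idP => [/xself/selfdualE //|]; apply: contraLR; rewrite -leqNgt.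
  exact: pair_index_nself.
have selfE a b : tau xi (p_g p) (x (tagnat.sig1 a)) \in T ->
    x (tagnat.sig1 b) = x (tagnat.sig1 a) -> Phi_xp a b =
    X (tau xi (p_g p) (x (tagnat.sig1 a))) *
      Sent (tau xi (p_g p) (x (tagnat.sig1 a))) (p_kappa p (x (tagnat.sig1 a)))
        (p_sigma p (x (tagnat.sig1 a))) (tagnat.sig2 a) (tagnat.sig2 b).
  move=> tT /xinj e; rewrite PhiE /Phi_entry selfi tT.
  by have -> : tagnat.sig1 a == tagnat.sig1 b by rewrite e.
have zeroE a b : x (tagnat.sig1 a) + x (tagnat.sig1 b) <> - pi (p_g p) ->
    Phi_xp a b = 0.
  move=> sum; rewrite PhiE /Phi_entry.
  case: ifP => [/andP[/eqP e]|_].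
    rewrite selfi /tau mulr2n addrA => /degree_inT.
    by rewrite {2}e => /sum.
  case: ifP => [ij|_]; first by case: sum; apply: pair_index_sum; rewrite ij.
  by case: ifP => // ij; case: sum; apply: pair_index_sum; rewrite ij orbT.
have partner (i j : 'I_(m + r.*2)) : tau xi (p_g p) (x i) \notin T ->
    x i + x j = - pi (p_g p) -> pair_index m i j || pair_index m j i.
  move=> tT sum; have [|j' ij] := @pair_index_ex i;
    first by rewrite leqNgt selfi.
  rewrite (_ : j = j') //; apply: xinj.
  by apply: (addrI (x i)); rewrite sum (pair_index_sum ij).
split=> //.
- move=> a b /xinj e1 e2; rewrite -[a]tagnat.sig2K -[b]tagnat.sig2K.
  by move: (tagnat.sig2 a) (tagnat.sig2 b) e2; rewrite e1 => a2 b2 /val_inj->.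
- move=> y k lk; have [|i xi_] := (proj1 (xsurj y)); first by lia.
  rewrite -xi_ in lk *; exists (tagnat.Rank _ (Ordinal lk)).
  by split; [rewrite tagnat.Rank1K|rewrite tagnat.Rank2K].
- move=> a b tT sum; rewrite PhiE /Phi_entry selfi (negPf tT) andbF.
  have dT := proj1 (degree_inT _ _ _) sum.
  case/orP: (partner _ _ tT sum) => ab; rewrite ?ab.
    by exists 1; split; [left|rewrite mulr1z].
  rewrite (negPf (pair_indexN ab)); eexists; split; last by [].
  by case: hdelta => ->; case: (eta_pm dT) => ->;
    rewrite ?mulrN ?mulNr ?mulr1 ?opprK; auto.
- move=> a b; have [sum|sum] := pselect (x (tagnat.sig1 a) + x (tagnat.sig1 b)
    = - pi (p_g p));
    last by rewrite !zeroE ?raddf0 ?mul0rz // addrC.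
  have [tT|tT] := boolP (tau xi (p_g p) (x (tagnat.sig1 a)) \in T).
    have e : x (tagnat.sig1 b) = x (tagnat.sig1 a).
      apply: (addrI (x (tagnat.sig1 a))); rewrite sum; apply/esym/degree_inT.
      by rewrite -addrA -mulr2n.
    (* The block contains [a], so its size is positive; in the alternating case it is even, hence at
       least 2, as [S_entry_herm] requires. *)
    have k0 := leq_ltn_trans (leq0n _) (ltn_ord (tagnat.sig2 a)).
    rewrite selfE // [in RHS]selfE ?e //.
    move: (nat_of_ord (tagnat.sig2 a)) (nat_of_ord (tagnat.sig2 b)) => la lb.
    by rewrite e S_entry_herm // => /(alt_even hp); lia.
  have dT := proj1 (degree_inT _ _ _) sum.
  rewrite !PhiE /Phi_entry [tagnat.sig1 b == _]eq_sym.
  have -> : (tagnat.sig1 a == tagnat.sig1 b) && (tagnat.sig1 b < m)%N =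
            (tagnat.sig1 a == tagnat.sig1 b) && (tagnat.sig1 a < m)%N.
    by case: eqP => // ->.
  rewrite selfi (negPf tT) andbF /Sid [tagnat.sig2 b == _ :> nat]eq_sym.
  rewrite [p_g p + xi (x (tagnat.sig1 b)) + _]addrAC.
  set t := p_g p + _ + _ in dT *.
  have phiS (e : int) (k : bool) :
      phi0 (X t * (k%:R *~ e)) = X t * (k%:R *~ (eta t * e)).
    case: k; last by rewrite !mul0rz !mulr0 raddf0.
    by rewrite !mulrzAr !mulr1 raddfMz /= phi0X // mulrzA.
  have phiS1 (k : bool) : phi0 (X t * k%:R) = X t * (k%:R *~ eta t).
    by have := phiS 1 k; rewrite mulr1z mulr1.
  case/orP: (partner _ _ tT sum) => ab; rewrite ab (negPf (pair_indexN ab)).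
    rewrite phiS1 -mulrzAr -mulrzA; congr (_ * (_ *~ _)).
    by case: hdelta => ->; ring.
  rewrite phiS -mulrzAr; congr (_ * (_ *~ _)).
  by case: (eta_pm dT) => ->; ring.
Qed.

End PhiModel.

(** The positions of the nonzero entries of the Gram matrix, by [model_neq0]: [Salt h] pairs
    positions at distance [h], all other blocks pair equal positions. *)
Definition linked (p : param T) (y z : {quot T}) (k l : nat) : Prop :=
  y + z = - pi (p_g p) /\
  if `[< alt (tau xi (p_g p) y) >] then
    l = (k + (p_kappa p y)./2)%N \/ k = (l + (p_kappa p y)./2)%N
  else k = l.

Section ModelTheory.
Variables (p : param T) (n : nat) (cls : 'I_n -> {quot T}) (loc : 'I_n -> nat).
Variable F : 'M[D]_n.
Hypothesis hp : paramX Dg delta kind eta xi p.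
Hypothesis hM : model p cls loc F.

Lemma self_pair y : tau xi (p_g p) y \in T <-> y + y = - pi (p_g p).
Proof. by rewrite degree_inT /tau mulr2n addrA. Qed.

Lemma mulr_sign_unit (x : D) (e : int) : e = 1 \/ e = -1 ->
  (x *~ e == 0) = (x == 0).
Proof. by case=> ->; rewrite ?mulrNz ?oppr_eq0 mulr1z. Qed.

Lemma iu_neq0 : kind = De_H -> iu != 0.
Proof.
move=> /hiu[_ ii]; apply: contra_eq_neq ii => ->.
by rewrite expr0n /= eq_sym oppr_eq0 oner_eq0.
Qed.

Lemma XM_eq0 t x : t \in T -> (X t * x == 0) = (x == 0).
Proof.
move=> tT; apply/eqP/eqP => [|->]; last by rewrite mulr0.
by move=> Xx; apply: (mulrI (Xu tT)); rewrite mulr0.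
Qed.

Lemma model_neq0 a b :
  F a b != 0 <-> linked p (cls a) (cls b) (loc a) (loc b).
Proof.
rewrite /linked; have [sum|nsum] := pselect (cls a + cls b = - pi (p_g p));
  last first.
  by rewrite (model_zero hM nsum) eqxx; split => // -[].
have [tT|tT] := boolP (tau xi (p_g p) (cls a) \in T); last first.
  have -> : `[< alt (tau xi (p_g p) (cls a)) >] = false.
    by apply/asboolP => -[]; rewrite (negPf tT).
  have [e [e1 ->]] := model_pair hM tT sum.
  rewrite XM_eq0 ?mulr_sign_unit //; last exact/degree_inT.
  rewrite /Sid; case: (loc a =P loc b) => [->|ne]; first by rewrite oner_eq0;
    split.
  by rewrite eqxx; split=> // -[].
have cb : cls b = cls a.
  by apply: (addrI (cls a)); rewrite sum; apply/esym/self_pair.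
rewrite (model_self hM tT cb) XM_eq0 //.
have [st|nst] := pselect (sig (tau xi (p_g p) (cls a))).
  have -> : `[< alt (tau xi (p_g p) (cls a)) >] = false.
    by apply/asboolP => /alt_nsig.
  rewrite S_entry_sig // /Sdiag; case: (loc a =P loc b) => [->|ne].
    by case: ifP => _; rewrite ?oppr_eq0 oner_eq0; split.
  by rewrite eqxx; split=> // -[].
have [at_|nat_] := pselect (alt (tau xi (p_g p) (cls a))).
  rewrite (asboolT at_) S_entry_alt // /Salt.
  case: (loc b =P _) => [->|nb]; first by rewrite oner_eq0; split=> // _;
    split=> //; left.
  case: (loc a =P _) => [->|na]; first by rewrite oppr_eq0 oner_eq0;
    split=> // _; split=> //; right.
  by rewrite eqxx; split=> // -[_ []].
rewrite (asboolF nat_); have [s0 [st ->]] := S_entry_scalar tT nst nat_.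
have s0_neq0 : s0 != 0.
  case: st => [[_ [_ [-> _]]]|[kH [-> _]]]; first exact: oner_neq0.
  exact: iu_neq0.
rewrite /Sid; case: (loc a =P loc b) => [->|ne]; first by rewrite mulr1; split.
by rewrite mulr0 eqxx; split=> // -[].
Qed.

Lemma model_Dg a b : Dg (p_g p + xi (cls a) + xi (cls b)) (F a b).
Proof.
have [sum|nsum] := pselect (cls a + cls b = - pi (p_g p)); last first.
  by rewrite (model_zero hM nsum); exact: Dg0.
have dT := proj1 (degree_inT _ _ _) sum.
have [tT|tT] := boolP (tau xi (p_g p) (cls a) \in T); last first.
  have [e [_ ->]] := model_pair hM tT sum.
  rewrite mulrzAr; apply: DgMz; rewrite /Sid; case: eqP => _.
    by rewrite mulr1; exact: Xg.
  by rewrite mulr0; exact: Dg0.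
have cb : cls b = cls a.
  by apply: (addrI (cls a)); rewrite sum; apply/esym/self_pair.
rewrite (model_self hM tT cb) cb -addrA -mulr2n -/(tau xi (p_g p) (cls a)).
apply: (DgMe (esym (addr0 _)) (Xg tT)).
have DSid s0 k l : Dg 0 s0 -> Dg 0 (s0 * Sid D k l).
  by rewrite /Sid; case: eqP => _; rewrite ?mulr1 ?mulr0 // => _; exact: Dg0.
have [st|nst] := pselect (sig (tau xi (p_g p) (cls a))).
  rewrite S_entry_sig // /Sdiag; case: eqP => _; last exact: Dg0.
  by case: ifP => _; [exact: Dg1|apply: DgN; exact: Dg1].
have [at_|nat_] := pselect (alt (tau xi (p_g p) (cls a))).
  rewrite S_entry_alt // /Salt; case: eqP => _; first exact: Dg1.
  by case: eqP => _; [apply: DgN; exact: Dg1|exact: Dg0].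
have [s0 [st ->]] := S_entry_scalar tT nst nat_; apply: DSid.
case: st => [[_ [_ [-> _]]]|[kH [-> _]]]; first exact: Dg1.
by case: (hiu kH).
Qed.

Lemma model_partner a : exists b, F a b != 0.
Proof.
have ka := model_lt hM a.
have kE : p_kappa p (- pi (p_g p) - cls a) = p_kappa p (cls a).
  by case: hp => -[].
suff [l [lk lnk]] : exists l, (l < p_kappa p (cls a))%N /\
    linked p (cls a) (- pi (p_g p) - cls a) (loc a) l.
  have [|b [cb lb]] := model_surj hM (y := - pi (p_g p) - cls a) (k := l).
    by rewrite kE.
  by exists b; apply/model_neq0; rewrite cb lb.
rewrite /linked addrCA subrr addr0.
case: asboolP => [at_|_]; last by exists (loc a).
(* As the block size is even, moving up or down by half of it stays inside the block. *)
have := alt_even hp at_; move: (p_kappa p (cls a)) (loc a) ka => k l lk ok.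
have [lh|lh] := ltnP l k./2.
  by exists (l + k./2)%N; split; [lia|split=> //; left].
by exists (l - k./2)%N; split; [lia|split=> //; right; lia].
Qed.

Lemma linked_uniq y z z' k l l' : linked p y z k l -> linked p y z' k l' ->
  (l < p_kappa p y)%N -> (l' < p_kappa p y)%N -> z = z' /\ l = l'.
Proof.
move=> [s1 c1] [s2 c2] lk lk'; split; first by apply: (addrI y); rewrite s1 s2.
move: c1 c2; case: asboolP => [at_|_ <- <- //].
have := alt_even hp at_; lia.
Qed.

Lemma kappa_pair y z : y + z = - pi (p_g p) -> p_kappa p y = p_kappa p z.
Proof.
case: hp => [[_ _ kap _] _] sum.
by rewrite -(kap z) -sum addrK.
Qed.

Lemma model_partner_uniq a b b' : F a b != 0 -> F a b' != 0 -> b = b'.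
Proof.
move=> /model_neq0 lb /model_neq0 lb'.
have [] := linked_uniq lb lb'; last exact: (model_inj hM).
  by case: lb => /kappa_pair -> _; exact: (model_lt hM).
by case: lb' => /kappa_pair -> _; exact: (model_lt hM).
Qed.

Lemma model_sym a b : (F b a == 0) = (F a b == 0).
Proof.
rewrite -(mulr_sign_unit (F b a) hdelta) -(model_herm hM).
by apply/eqP/eqP => [E|->]; rewrite ?raddf0 // -[F a b]phi0K E raddf0.
Qed.

Lemma model_unit a b : F a b != 0 -> F a b \is a GRing.unit.
Proof. exact: (Dg_unit (model_Dg a b)). Qed.

(** With one nonzero entry in each row and column, [F] is inverted by transposing and inverting
    entrywise; zero entries stay zero since [0^-1 = 0]. *)
Lemma model_inverse : exists Fi : 'M[D]_n, Fi *m F = 1%:M /\ F *m Fi = 1%:M.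
Proof.
exists (\matrix_(a, b) (F b a)^-1); split; apply/matrixP => a b; rewrite !mxE.
  under eq_bigr do rewrite mxE.
  have [c cP] := model_partner a; rewrite (bigD1 c) //= big1 => [|d dc].
    rewrite addr0; have ca : F c a != 0 by rewrite model_sym.
    have [<-|ab] := eqVneq a b; first by rewrite mulVr ?model_unit.
    have [->|cb] := eqVneq (F c b) 0; first by rewrite mulr0.
    by case/eqP: ab; exact: model_partner_uniq ca cb.
  have [->|da] := eqVneq (F d a) 0; first by rewrite invr0 mul0r.
  by case/eqP: dc; apply: (model_partner_uniq (a := a)); rewrite // model_sym.
under eq_bigr do rewrite mxE.
have [c cP] := model_partner a; rewrite (bigD1 c) //= big1 => [|d dc].
  rewrite addr0; have [<-|ab] := eqVneq a b; first by rewrite divrr ?model_unit.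
  have [->|cb] := eqVneq (F b c) 0; first by rewrite invr0 mulr0.
  case/eqP: ab; apply: (model_partner_uniq (a := c)); by rewrite model_sym.
have [->|ad] := eqVneq (F a d) 0; first by rewrite mul0r.
by case/eqP: dc; exact: model_partner_uniq ad cP.
Qed.

End ModelTheory.

(** * Graded isomorphisms between matrix algebras over [D] *)

Lemma lrmorphism_of (psi : D -> D) :
  {morph psi : x y / x + y} -> psi 1 = 1 -> {morph psi : x y / x * y} ->
  (forall (a : R) x, psi (a *: x) = a *: psi x) ->
  exists F : {lrmorphism D -> D}, F =1 psi.
Proof.
move=> psiD psi1 psiM psiZ.
have psiB : zmod_morphism psi.
  by move=> x y; rewrite -scaleN1r psiD psiZ scaleN1r.
pose B := GRing.isZmodMorphism.Build D D psi psiB.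
pose M := GRing.isMonoidMorphism.Build D D psi (psi1, psiM).
pose S := GRing.isScalable.Build R D D *:%R psi psiZ.
pose F : {lrmorphism D -> D} := HB.pack psi B M S.
by exists F.
Qed.

(** Matrices of degree-preserving maps between free graded modules; subtracting [h] from the row
    degrees gives the maps of degree [h]. *)
Definition graded_mx m k (rdeg : 'I_m -> G) (cdeg : 'I_k -> G)
  (A : 'M[D]_(m, k)) := forall i j, Dg (cdeg j - rdeg i) (A i j).

Lemma graded_mulmx m k l (rdeg : 'I_m -> G) (cdeg : 'I_k -> G)
    (edeg : 'I_l -> G) A B :
  graded_mx rdeg cdeg A -> graded_mx cdeg edeg B ->
  graded_mx rdeg edeg (A *m B).
Proof.
move=> gA gB i j; rewrite mxE; apply: Dg_sum => a _.
by apply: (DgMe _ (gA i a) (gB a j)); zmod.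
Qed.

Lemma graded_mx_shift m k (rdeg rdeg' : 'I_m -> G) (cdeg cdeg' : 'I_k -> G) A :
  (forall i j, cdeg' j - rdeg' i = cdeg j - rdeg i) ->
  graded_mx rdeg cdeg A -> graded_mx rdeg' cdeg' A.
Proof. by move=> e gA i j; rewrite e; exact: gA. Qed.

Definition unit_mx n (a b : 'I_n) (d : D) : 'M[D]_n :=
  \matrix_(i, j) if (i == a) && (j == b) then d else 0.

Lemma mul_unit_mx n (a b c e : 'I_n) x y :
  unit_mx a b x *m unit_mx c e y = if b == c then unit_mx a e (x * y) else 0.
Proof.
apply/matrixP => i j; rewrite mxE (bigD1 b) //= big1 => [|k kb].
  rewrite addr0 !mxE eqxx andbT; have [_|_] := eqVneq b c; rewrite mxE /=.
    by case: (i == a); case: (j == e); rewrite ?mul0r ?mulr0.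
  by rewrite mulr0.
by rewrite !mxE (negPf kb) andbF mul0r.
Qed.

Lemma unit_mx_sum n (A : 'M[D]_n) : A = \sum_a \sum_b unit_mx a b (A a b).
Proof.
apply/matrixP => i j; rewrite summxE (bigD1 i) //= summxE (bigD1 j) //=.
rewrite mxE !eqxx /= !big1 ?addr0 // => [a ai|b bj].
  by rewrite summxE big1 // => b _; rewrite mxE [i == a]eq_sym (negPf ai).
by rewrite mxE [j == b]eq_sym (negPf bj) andbF.
Qed.

Lemma unit_mx_corner n (A : 'M[D]_n) a b :
  unit_mx a a 1 *m A *m unit_mx b b 1 = unit_mx a b (A a b).
Proof.
rewrite {1}[A]unit_mx_sum mulmx_sumr mulmx_suml (bigD1 a) //=.
rewrite mulmx_sumr mulmx_suml (bigD1 b) //= !mul_unit_mx !eqxx mul1r.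
rewrite mul_unit_mx eqxx mulr1 !big1 ?addr0 // => [i ia|j jb].
  rewrite mulmx_sumr mulmx_suml big1 // => j _.
  by rewrite mul_unit_mx eq_sym (negPf ia) mul0mx.
by rewrite mul_unit_mx eqxx mul_unit_mx (negPf jb).
Qed.

Section GradedIso.
Variables (n n' : nat) (deg : 'I_n -> G) (deg' : 'I_n' -> G).
Variable f : 'M[D]_n -> 'M[D]_n'.
Hypothesis fD : {morph f : A B / A + B}.
Hypothesis fM : forall A B, f (A *m B) = f A *m f B.
Hypothesis f1 : f 1%:M = 1%:M.
Hypothesis fZ : forall (a : R) A,
  f (map_mx (fun d => a *: d) A) = map_mx (fun d => a *: d) (f A).
Hypothesis fbij : bijective f.
Hypothesis fdeg : forall h A,
  graded_mx (fun a => deg a - h) deg A <->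
  graded_mx (fun a => deg' a - h) deg' (f A).

Local Notation E := unit_mx.

Let f0 : f 0 = 0.
Proof. by apply: (addrI (f 0)); rewrite -fD !addr0. Qed.

Let f_sum (I : finType) (F : I -> 'M[D]_n) :
  f (\sum_i F i) = \sum_i f (F i).
Proof. exact: (big_morph f fD f0). Qed.

Let fE a b c e x y :
  f (E a b x) *m f (E c e y) = if b == c then f (E a e (x * y)) else 0.
Proof. by rewrite -fM mul_unit_mx; case: ifP. Qed.

Let fEdeg a b h x : Dg h x ->
  graded_mx (fun i => deg' i - (h + deg a - deg b)) deg' (f (E a b x)).
Proof.
move=> hx; apply/fdeg => i j; rewrite mxE;
  case: ifP => [/andP[/eqP-> /eqP->]|_].
  by rewrite (_ : _ - _ = h) //; zmod.
exact: Dg0.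
Qed.

(* [f] maps a primitive idempotent [E a0 a0 1] to an idempotent of rank one:  *)
(* it factors as a column times a row.                                        *)
Let rank_one (a0 : 'I_n) : exists (g : G) (u : 'cV[D]_n') (v : 'rV[D]_n'),
  [/\ f (E a0 a0 1) = u *m v, v *m u = 1%:M,
      graded_mx deg' (fun _ => g) u & graded_mx (fun _ => g) deg' v].
Proof.
set P := f _.
have PP : P *m P = P by rewrite /P fE eqxx mulr1.
have finj := bij_inj fbij.
have gP : graded_mx deg' deg' P.
  apply: graded_mx_shift (fEdeg a0 a0 Dg1) => i j; zmod.
have [a1 [b0 Pab]] : exists a1 b0, P a1 b0 != 0.
  apply: contrapT => noP; have P0 : P = 0.
    apply/matrixP => i j; rewrite mxE; apply/eqP; apply: contraT => Pij.
    by case: noP; exists i, j.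
  have := finj (E a0 a0 1) 0; rewrite f0 => /(_ P0) /matrixP/(_ a0 a0)/eqP.
  by rewrite !mxE !eqxx oner_eq0.
pose u := col b0 P.
have Pu : P *m u = u.
  apply/matrixP => i j; rewrite [in RHS]/u -[in RHS]PP !mxE.
  by apply: eq_bigr => k _; rewrite mxE.
have gu : graded_mx deg' (fun _ => deg' b0) u by move=> i j; rewrite mxE.
have u1E : u a1 0 != 0 by rewrite mxE.
have u1u := Dg_unit (gu a1 0) u1E.
pose r0 : 'rV[D]_n' := \row_j if j == a1 then (u a1 0)^-1 else 0.
have gr0 : graded_mx (fun _ => deg' b0) deg' r0.
  move=> i j; rewrite mxE; case: eqP => [->|_]; last exact: Dg0.
  by rewrite -opprB; apply: Dg_inv u1E; exact: gu.
have r0u : r0 *m u = 1%:M.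
  apply/matrixP => i j; rewrite !ord1 mxE (bigD1 a1) //= mxE eqxx mulVr //.
  by rewrite big1 ?addr0 ?mxE // => k k1; rewrite mxE (negPf k1) mul0r.
(* [Q] factors through rank one and lies in the corner cut out by [P], so it is the image of some
   [d] in the corner at [a0]. This [d] is nonzero of degree 0, hence invertible, and multiplying [Q]
   by the image of [d^-1] factors [P] itself. *)
pose Q := P *m (u *m r0) *m P.
have gQ : graded_mx deg' deg' Q.
  exact: graded_mulmx (graded_mulmx gP (graded_mulmx gu gr0)) gP.
have Qu : Q *m u = u by rewrite /Q -!mulmxA Pu r0u mulmx1 Pu.
have [f' fK f'K] := fbij.
pose d := f' Q a0 a0.
have Ed : f (E a0 a0 d) = Q.
  rewrite -unit_mx_corner !fM f'K -/P /Q; rewrite -!mulmxA PP.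
  by rewrite [P *m (P *m _)]mulmxA PP.
have gd : Dg 0 d.
  have := proj2 (fdeg 0 (f' Q)); rewrite f'K => H.
  have {H}/(_ a0 a0) : graded_mx (fun a => deg a - 0) deg (f' Q).
    by apply: H; apply: graded_mx_shift gQ => i j; zmod.
  by rewrite subr0 subrr.
have d0 : d != 0.
  apply: contraNneq u1E => d0; rewrite -Qu -Ed d0.
  suff -> : E a0 a0 0 = 0 :> 'M_n by rewrite f0 mul0mx mxE.
  by apply/matrixP => i j; rewrite !mxE; case: ifP.
have du := Dg_unit gd d0.
pose S := f (E a0 a0 d^-1).
have QS : Q *m S = P by rewrite -Ed fE eqxx divrr.
have gS : graded_mx deg' deg' S.
  by apply: graded_mx_shift (fEdeg a0 a0 (Dg_inv gd d0)) => i j; zmod.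
pose v := r0 *m P *m S.
have PE : P = u *m v.
  by rewrite -[LHS]QS /Q /v -!mulmxA [P *m (u *m _)]mulmxA Pu.
exists (deg' b0), u, v; split=> //; last first.
  exact: graded_mulmx (graded_mulmx gr0 gP) gS.
have : u *m (v *m u) = u by rewrite mulmxA -PE.
move=> /matrixP/(_ a1 0); rewrite mxE big_ord1 => E1.
apply/matrixP => i j; rewrite !ord1; apply: (mulrI u1u).
by rewrite E1 [1%:M _ _]mxE mulr1.
Qed.

(** Since [f (E a0 a0 1) = u *m v], the corner at [a0] acts on the line of [u] through a map [psi],
    by [f (E a0 a0 d) *m u = u *m psim d]. The columns [f (E a a0 1) *m u] form [U], and the rows
    [v *m f (E a0 a 1)] form [V]. *)
Lemma graded_iso_matrix (a0 : 'I_n) :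
  exists (g : G) (psi : {lrmorphism D -> D}) (U : 'M[D]_(n',
    n)) (V : 'M[D]_(n, n')),
  [/\ bijective psi /\ (forall h d, Dg h d -> Dg h (psi d)),
      graded_mx (fun i => deg' i - g) deg U,
      graded_mx deg (fun i => deg' i - g) V,
      V *m U = 1%:M /\ U *m V = 1%:M
    & forall A, f A = U *m map_mx psi A *m V].
Proof.
have [g0 [u [v [uv vu gu gv]]]] := rank_one a0.
have [f' fK f'K] := fbij; have finj := bij_inj fbij.
pose psim d : 'M[D]_1 := v *m f (E a0 a0 d) *m u.
pose psi0 d := psim d 0 0.
have psim_u d : f (E a0 a0 d) *m u = u *m psim d.
  by rewrite /psim !mulmxA -uv fE eqxx mul1r.
have fE_uv a b d : f (E a b d) = f (E a a0 1) *m u *m psim d *m v *m f (E a0 b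
  1).
  rewrite -[_ *m u *m psim d]mulmxA -psim_u !mulmxA fE eqxx mul1r.
  by rewrite -[f _ *m u *m v]mulmxA -uv fE eqxx mulr1 fE eqxx mulr1.
have psimM x y : psim (x * y) = psim x *m psim y.
  rewrite {2}/psim -!mulmxA -psim_u /psim -!mulmxA; congr (v *m _).
  by rewrite mulmxA fE eqxx.
have psim1 : psim 1 = 1%:M by rewrite /psim uv mulmxA vu mul1mx.
have ED a b x y : E a b (x + y) = E a b x + E a b y :> 'M_n.
  by apply/matrixP => i j; rewrite !mxE; case: ifP; rewrite ?addr0.
have psimD x y : psim (x + y) = psim x + psim y.
  by rewrite /psim ED fD mulmxDr mulmxDl.
have EZ (a : R) b c x : E b c (a *: x) = map_mx (fun d =>
  a *: d) (E b c x) :> 'M_n.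
  by apply/matrixP => i j; rewrite !mxE; case: ifP; rewrite ?scaler0.
have psi0Z (a : R) x : psi0 (a *: x) = a *: psi0 x.
  rewrite /psi0 /psim EZ fZ !mxE scaler_sumr; apply: eq_bigr => i _.
  rewrite !mxE !mulr_suml scaler_sumr; apply: eq_bigr => j _.
  by rewrite mxE scalerAl scalerAr.
have [psi psiE] : exists psi : {lrmorphism D -> D}, psi =1 psi0.
  apply: lrmorphism_of => //.
  - by move=> x y; rewrite /psi0 psimD mxE.
  - by rewrite /psi0 psim1 mxE.
  - by move=> x y; rewrite /psi0 psimM mxE big_ord1.
have psimE d : psim d = (psi d)%:M.
  by apply/matrixP => i j; rewrite !ord1 [RHS]mxE psiE.
pose U : 'M[D]_(n', n) := \matrix_(i, a) (f (E a a0 1) *m u) i 0.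
pose V : 'M[D]_(n, n') := \matrix_(a, i) (v *m f (E a0 a 1)) 0 i.
have fA A : f A = U *m map_mx psi A *m V.
  rewrite {1}[A]unit_mx_sum f_sum; apply/matrixP => i j.
  rewrite summxE mxE; under [in RHS]eq_bigr do rewrite mxE mulr_suml.
  rewrite exchange_big; apply: eq_bigr => a _.
  rewrite f_sum summxE; apply: eq_bigr => b _.
  rewrite fE_uv -[_ *m v *m _]mulmxA mxE big_ord1; congr (_ * _);
    last by rewrite [RHS]mxE.
  by rewrite mxE big_ord1 [U _ _]mxE [map_mx _ _ _ _]mxE psiE.
have VU : V *m U = 1%:M.
  apply/matrixP => a b; rewrite !mxE.
  transitivity ((v *m f (E a0 a 1) *m (f (E b a0 1) *m u)) 0 0).
    by rewrite [RHS]mxE; apply: eq_bigr => i _; rewrite !mxE.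
  rewrite mulmxA -[v *m _ *m _]mulmxA fE; case: eqP => [_|_].
    by rewrite mulr1 uv mulmxA vu mul1mx vu mxE.
  by rewrite mulmx0 mul0mx mxE.
exists (g0 - deg a0), psi, U, V; split=> //.
- split.
    (* The matrix [u *m y%:M *m v] lies in the image of the corner at [a0], so its preimage has a
       single entry, which [psi] sends to [y]. *)
    pose psi' y := f' (u *m y%:M *m v) a0 a0.
    have psi'K : cancel psi' psi.
      move=> y; pose M := u *m y%:M *m v.
      have PM : f (E a0 a0 (f' M a0 a0)) = M.
        rewrite -unit_mx_corner !fM f'K uv /M !mulmxA -[u *m v *m u]mulmxA vu
          mulmx1.
        by rewrite -[_ *m v *m u]mulmxA vu mulmx1.
      rewrite psiE /psi0 /psim PM /M !mulmxA vu mul1mx.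
      by rewrite -mulmxA vu mulmx1 mxE.
    exists psi' => //; apply: inj_can_sym => // x y /eqP.
    rewrite -subr_eq0 -raddfB => /eqP;
      move: (x - y) (subr_eq0 x y) => z zE psiz.
    apply/eqP; rewrite -zE; apply/eqP.
    have : f (E a0 a0 z) = f 0.
      by rewrite fE_uv psimE psiz raddf0 mulmx0 !mul0mx f0.
    by move/finj/matrixP/(_ a0 a0); rewrite !mxE !eqxx.
  move=> h d hd; rewrite psiE.
  have gf := fEdeg a0 a0 hd.
  have gv' : graded_mx (fun _ : 'I_1 => g0 - h) (fun i =>
    deg' i - (h + deg a0 - deg a0)) v.
    by apply: graded_mx_shift gv => i j; zmod.
  have := graded_mulmx (graded_mulmx gv' gf) gu; move=> /(_ 0 0).
  by rewrite (_ : g0 - _ = h) //; zmod.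
- move=> i a; rewrite mxE.
  have := graded_mulmx (fEdeg a a0 Dg1) gu; move=> /(_ i 0).
  by rewrite (_ : g0 - _ = deg a - (deg' i - (g0 - deg a0))) //; zmod.
- move=> a i; rewrite mxE.
  have gv' : graded_mx (fun _ : 'I_1 => g0 - (0 + deg a0 - deg a)) (fun i =>
    deg' i - (0 + deg a0 - deg a)) v.
    by apply: graded_mx_shift gv => k j; zmod.
  have := graded_mulmx gv' (fEdeg a0 a Dg1); move=> /(_ 0 i).
  by rewrite (_ : _ - _ = deg' i - (g0 - deg a0) - deg a) //; zmod.
- split=> //; rewrite -f1 fA; congr (_ *m V).
  by rewrite map_mx1 mulmx1.
Qed.

End GradedIso.

(** * Degree-preserving automorphisms of the graded division algebra *)

Lemma X_decomp d : exists (s : seq G) (z : G -> D),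
  [/\ forall t, t \in s -> t \in T, forall t, Dg 0 (z t)
    & d = \sum_(t <- s) X t * z t].
Proof.
have [s [f [us fg ->]]] := Dg_decomp d.
exists [seq t <- s | f t != 0],
  (fun t => if t \in T then (X t)^-1 * f t else 0).
split=> [t|t|].
- by rewrite mem_filter => /andP[ft _]; exact: Dg_support (fg t) ft.
- case: ifP => tT; last exact: Dg0.
  by apply: (DgMe _ (Xinv tT) (fg t)); rewrite addNr.
- rewrite big_filter [LHS](bigID (fun t => f t == 0)) /= big1 ?add0r =>
    [|t /eqP//].
  apply: eq_bigr => t ft; have tT := Dg_support (fg t) ft.
  by rewrite tT mulVKr ?Xu.
Qed.

(** Otherwise D_e would commute with every [X t] and with itself, hence be central. *)
Lemma exists_notK : kind = De_C -> ~ De_C_central Dg kind ->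
  exists2 s, s \in T & ~~ inK Dg T kind s.
Proof.
move=> kE ncen; apply: contrapT => allK; apply: ncen; split=> // e e0 d'.
have [r' [w' [rT' w'0 ->]]] := X_decomp d'.
rewrite mulr_sumr mulr_suml big_seq [RHS]big_seq; apply: eq_bigr => s /rT' sT.
have sK : inK Dg T kind s by apply: contrapT => /negP sK; apply: allK; exists s.
have [_ Xc _] := proj1 (inKP s kE) sK.
by rewrite mulrA -Xc // -!mulrA (De_C_comm kE e0 (w'0 s)).
Qed.

(** It suffices to test D_e and the [X t]. Over R and H, [psi (X t)] is a real multiple of [X t];
    over a central C the definition of A applies; over a noncentral C, [phi0] is the scalar [eta t]
    on the components outside K, and those in K follow. *)
Lemma groupA_phi0 psi : groupA Dg T phi0 kind X nu psi -> graded_aut psi.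
Proof.
case=> psib psiD fixD0 cenD0; split=> // d.
suff H t : t \in T -> phi0 (psi (X t)) = psi (phi0 (X t)).
  have D0 z : Dg 0 z -> phi0 (psi z) = psi (phi0 z).
    move=> z0; have [cen|ncen] := pselect (De_C_central Dg kind).
      case: (cenD0 cen) => [E|[_ E _]]; first by rewrite !E.
      by rewrite !E //; exact: hdeg.
    by rewrite !fixD0 //; exact: hdeg.
  have [s [z [sT z0 ->]]] := X_decomp d; rewrite !raddf_sum /=.
  rewrite big_seq [RHS]big_seq; apply: eq_bigr => t /sT tT.
  by rewrite rmorphM phi0M H // D0 // phi0M rmorphM.
move=> tT; have [cen|ncen] := pselect (De_C_central Dg kind).
  case: (cenD0 cen) => [E|[_ _ E]]; first by rewrite !E.
  by rewrite phi0X // raddfMz /= E // raddfMz /= phi0X // -!mulrzA mulrC.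
have {cenD0}fixD0 := fixD0 ncen.
have real : (exists a : R, psi (X t) = a *: X t) -> phi0 (psi (X t)) = psi
  (phi0 (X t)).
  by move=> [a aE]; rewrite phi0X // raddfMz /= aE linearZ /= phi0X //
    scalerMzr.
have [z z0 zE] := XDe tT (psiD _ _ (Xg tT)).
have realz : (exists a : R, z = a%:A) -> exists a : R, psi (X t) = a *: X t.
  by move=> [a aE]; exists a; rewrite zE aE -scalerAr mulr1.
case kE : kind.
- by apply: real; apply: realz; exact: De_R_real.
- have nK s x : s \in T -> ~~ inK Dg T kind s -> Dg s x ->
      phi0 (psi x) = psi (phi0 x).
    have nKphi y : s \in T -> ~~ inK Dg T kind s -> Dg s y -> phi0 y = y *~
      eta s.
      move=> sT sK sy; have [w w0 ->] := XDe sT sy.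
      by rewrite phi0M phi0X // mulrzAr -(De_C_conj kE sT sK (Xg sT) w0).
    move=> sT sK sx; rewrite (nKphi _ sT sK (psiD _ _ sx)) (nKphi _ sT sK sx).
    by rewrite raddfMz.
  have [tK|tK] := boolP (inK Dg T kind t); last exact: (nK _ _ tT tK (Xg tT)).
  (* For [t] in K, both [s] and [s + t] are outside K, so the claim holds for [X s] and [X s * X t],
     and [X s] can be cancelled. *)
  have [s sT sK] := exists_notK kE ncen.
  have stK : ~~ inK Dg T kind (s + t).
    apply: contra sK => /(inKP _ kE)[stT stc _].
    have [_ Xtc _] := proj1 (inKP t kE) tK.
    have [w w0 wE] := XDe stT (DgM (Xg sT) (Xg tT)).
    rewrite /inK sT kE; apply/asboolP => x /(XDe sT)[v v0 ->] e e0.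
    suff Xsc : X s * e = e * X s.
      by rewrite -mulrA (De_C_comm kE v0 e0) !mulrA Xsc.
    apply: (mulIr (Xu tT)); rewrite -mulrA -Xtc // mulrA wE -[LHS]mulrA.
    by rewrite (De_C_comm kE w0 e0) mulrA stc // -!mulrA wE.
  have Xs := nK _ _ sT sK (Xg sT).
  have := nK _ _ (TD sT tT) stK (DgM (Xg sT) (Xg tT)).
  rewrite rmorphM !phi0M Xs rmorphM; apply: mulIr.
  by rewrite rmorph_unit // phi0_unit // Xu.
- apply: real; apply: realz; apply: (De_H_center kE z0) => e e0.
  case: (hX tT) => _ _ /(_ kE) Xc _.
  apply: (mulrI (Xu tT)); rewrite !mulrA -zE Xc // -mulrA -zE.
  by rewrite -[e](fixD0 e e0) -!rmorphM Xc.
Qed.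

(** Translation by [t0] permutes [T] and multiplies the sum by [chi t0]; the factor [chi t0 - 1] is
    nonzero of degree 0, hence invertible. *)
Lemma character_sum (s : seq G) (chi : G -> D) :
  uniq s -> (forall t, (t \in s) = (t \in T)) ->
  (forall t, t \in T -> Dg 0 (chi t)) ->
  (forall a b, a \in T -> b \in T -> chi (a + b) = chi a * chi b) ->
  (exists2 t, t \in T & chi t <> 1) -> \sum_(t <- s) chi t = 0.
Proof.
move=> us sT chi0 chiM [t0 t0T /eqP chi1].
have perm : perm_eq s [seq t0 + t | t <- s].
  apply: uniq_perm => //; first by rewrite map_inj_uniq //; exact: addrI.
  move=> t; rewrite sT; apply/idP/mapP => [tT|[t1]];
    last by rewrite sT => ? ->; exact: TD.
  by exists (t - t0); [rewrite sT TD // TN|zmod].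
have : (chi t0 - 1) * \sum_(t <- s) chi t = 0.
  rewrite mulrBl mul1r [X in _ - X](perm_big _ perm) big_map mulr_sumr.
  apply/eqP; rewrite subr_eq0; apply/eqP.
  rewrite big_seq [RHS]big_seq; apply: eq_bigr => t; rewrite sT => tT.
  by rewrite chiM.
have u : chi t0 - 1 \is a GRing.unit.
  by apply: (Dg_unit (DgB (chi0 _ t0T) Dg1)); rewrite subr_eq0.
by move=> E; apply: (mulrI u); rewrite mulr0.
Qed.

Section CentralComplex.
Hypothesis cen : De_C_central Dg kind.

(** The commutator of [X s] and [X t], equal to [beta X s t] on [T]; as D_e is central, it is a
    bicharacter independent of the chosen elements. *)
Definition comm_factor s t := X s * X t / X s / X t.

Lemma central_D0 z : Dg 0 z <-> central z.
Proof. by case: (hC cen) => _ ->. Qed.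

Lemma comm_factor_Dg s t : s \in T -> t \in T -> Dg 0 (comm_factor s t).
Proof.
move=> sT tT; apply: (DgMe _ (DgM (DgM (Xg sT) (Xg tT)) (Xinv sT)) (Xinv tT)).
zmod.
Qed.

Lemma comm_factorE s t : s \in T -> t \in T ->
  X s * X t = comm_factor s t * X t * X s.
Proof. by move=> sT tT; rewrite /comm_factor !divrK ?Xu. Qed.

Lemma comm_factor_hom s t x y : s \in T -> t \in T -> Dg s x -> Dg t y ->
  x * y = comm_factor s t * y * x.
Proof.
move=> sT tT /(XDe sT)[z z0 ->] /(XDe tT)[w w0 ->].
have zc := proj1 (central_D0 z) z0; have wc := proj1 (central_D0 w) w0.
rewrite -mulrA [z * _]mulrA (zc (X t)) !mulrA comm_factorE //.
by rewrite -[_ * w * X s]mulrA (wc (X s)) -!mulrA (wc z).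
Qed.

Lemma comm_factor_uniq s t x y b : s \in T -> t \in T -> Dg s x -> Dg t y ->
  x != 0 -> y != 0 -> x * y = b * y * x -> b = comm_factor s t.
Proof.
move=> sT tT sx ty x0 y0; rewrite (comm_factor_hom sT tT sx ty).
by move=> /(mulIr (Dg_unit sx x0)) /(mulIr (Dg_unit ty y0)).
Qed.

Lemma comm_factorDr s t t' : s \in T -> t \in T -> t' \in T ->
  comm_factor s (t + t') = comm_factor s t * comm_factor s t'.
Proof.
move=> sT tT t'T; apply/esym; apply: (comm_factor_uniq sT (TD tT t'T) (Xg sT)
  (DgM (Xg tT) (Xg t'T))).
- exact: X0.
- by apply: (DgM_neq0 (Xg tT) (Xg t'T)); exact: X0.
have cc := proj1 (central_D0 _) (comm_factor_Dg sT t'T).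
have := comm_factorE sT t'T; have := comm_factorE sT tT.
move: (comm_factor s t) (comm_factor s t') cc => b b' cc E E'.
rewrite mulrA E -[LHS]mulrA E' !mulrA.
by rewrite -[_ * X t * b']mulrA -(cc (X t)) !mulrA.
Qed.

Lemma comm_factorDl s s' t : s \in T -> s' \in T -> t \in T ->
  comm_factor (s + s') t = comm_factor s t * comm_factor s' t.
Proof.
move=> sT s'T tT; apply/esym; apply: (comm_factor_uniq (TD sT s'T) tT (DgM (Xg
  sT) (Xg s'T)) (Xg tT)).
- by apply: (DgM_neq0 (Xg sT) (Xg s'T)); exact: X0.
- exact: X0.
have cc := proj1 (central_D0 _) (comm_factor_Dg s'T tT).
have := comm_factorE s'T tT; have := comm_factorE sT tT.
move: (comm_factor s t) (comm_factor s' t) cc => b b' cc E E'.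
rewrite -[LHS]mulrA E' !mulrA -(cc (X s)) -[_ * X s * X t]mulrA E !mulrA.
by rewrite cc.
Qed.

(** [X t] would be central, and the center is the component of degree 0. *)
Lemma central_X_degree t : t \in T ->
  (forall s, s \in T -> comm_factor s t = 1) -> t = 0.
Proof.
move=> tT all1; apply: (Dg_inj (Xg tT) _ (X0 tT)); apply/central_D0.
apply: central_homogeneous => g x gx; have [->|x0] := eqVneq x 0.
  by rewrite mulr0 mul0r.
have gT := Dg_support gx x0.
by rewrite [RHS](comm_factor_hom gT tT gx (Xg tT)) all1 // mul1r.
Qed.

(* Nondegeneracy: the commutation factor represents all characters of the     *)
(* finite group [T].                                                          *)
Lemma inner_character (chi : G -> D) :
  (forall t, t \in T -> Dg 0 (chi t) /\ chi t != 0) ->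
  (forall a b, a \in T -> b \in T -> chi (a + b) = chi a * chi b) ->
  exists2 u, u \in T & forall t, t \in T -> X u * X t = chi t * X t * X u.
Proof.
move=> chi0 chiM; apply: contrapT => noU.
have [s us sT] : exists2 s : seq G, uniq s & forall t, (t \in s) = (t \in T).
  have [/finite_seqP[s sE] _] := hC cen; exists (undup s);
    first exact: undup_uniq.
  move=> t; rewrite mem_undup; have := congr1 (fun A => A t) sE => /= E.
  by apply/idP/idP; rewrite E.
have chi_unit t : t \in T -> chi t \is a GRing.unit.
  by move=> /chi0[d0 d_neq0]; exact: Dg_unit d0 d_neq0.
have chi00 : chi 0 = 1.
  have := chiM 0 0 T0 T0; rewrite addr0 -{1}[chi 0]mulr1.
  by move=> /(mulrI (chi_unit _ T0)).
have chiN t : t \in T -> Dg 0 (chi t)^-1.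
  by move=> /chi0[d0 d_neq0]; rewrite -oppr0; exact: Dg_inv.
(* If no [u] realises [chi], each of these quotients is a nontrivial character of [T]. *)
have inner u : u \in T -> \sum_(t <- s) (comm_factor u t / chi t) = 0.
  move=> uT; apply: character_sum => //.
  - move=> t tT; apply: (DgMe _ (comm_factor_Dg uT tT) (chiN _ tT)).
    by rewrite addr0.
  - move=> a b aT bT; rewrite comm_factorDr // chiM // invrM ?chi_unit //.
    have ca := proj1 (central_D0 _) (chiN _ aT).
    by rewrite -ca -[RHS]mulrA ca !mulrA.
  - apply: contrapT => all1; apply: noU; exists u => // t tT.
    suff <- : comm_factor u t = chi t by exact: comm_factorE.
    have : comm_factor u t / chi t = 1.
      by apply: contrapT => n1; apply: all1; exists t.
    by move=> E; rewrite -[LHS](divrK (chi_unit _ tT)) E mul1r.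
have : \sum_(u <- s) \sum_(t <- s) (comm_factor u t / chi t) = 0.
  by rewrite big_seq big1 // => u; rewrite sT; exact: inner.
(* Summing over [u] first, nondegeneracy kills every nonzero [t], and the term at [0] is the order
   of [T], which is not zero in [D]. *)
rewrite exchange_big /= (bigD1_seq 0) ?sT ?T0 //= [X in _ + X]big_seq_cond.
rewrite [X in _ + X]big1 => [|t /andP[]]; last first.
  rewrite sT => tT t0; rewrite -mulr_suml character_sum ?mul0r //.
  - by move=> u uT; exact: comm_factor_Dg.
  - by move=> a b aT bT; exact: comm_factorDl.
  apply: contrapT => all1; case/eqP: t0.
  apply: central_X_degree => // g gT.
  by apply: contrapT => n1; apply: all1; exists g.
rewrite chi00 addr0 => /eqP; rewrite big_seq (eq_bigr (fun _ => 1)); last first.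
  move=> u; rewrite sT => uT; rewrite divr1; apply/esym.
  apply: (comm_factor_uniq uT T0 (Xg uT) Dg1); rewrite ?X0 ?oner_neq0 //.
  by rewrite !mulr1 mul1r.
rewrite -big_seq big_const_seq count_predT iter_addr_0.
rewrite -scaler_nat scaler_eq0 oner_eq0 orbF pnatr_eq0 => /eqP /size0nil s0.
by have := T0; rewrite -sT s0.
Qed.

End CentralComplex.

Lemma twisted_aut (psi : {lrmorphism D -> D}) u y :
  bijective psi -> (forall g d, Dg g d -> Dg g (psi d)) -> Dg u y -> y != 0 ->
  exists psi' : {lrmorphism D -> D}, [/\ bijective psi',
    forall g d, Dg g d -> Dg g (psi' d) & forall d, psi' d = y^-1 * psi d * y].
Proof.
move=> [psi1 psiK psi1K] psiD uy y0; have yu := Dg_unit uy y0.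
have [||||psi' psi'E] := @lrmorphism_of (fun d => y^-1 * psi d * y).
- by move=> a b; rewrite raddfD mulrDr mulrDl.
- by rewrite rmorph1 mulr1 mulVr.
- by move=> a b; rewrite rmorphM !mulrA mulrK.
- by move=> a b; rewrite linearZ /= -scalerAr -scalerAl.
exists psi'; split=> //.
- exists (fun d => psi1 (y * d / y)) => d.
    by rewrite psi'E !mulrA divrr // mul1r mulrK.
  by rewrite psi'E psi1K !mulrA mulVr // mul1r divrK.
- move=> g d gd; rewrite psi'E.
  by apply: (DgMe _ (DgM (Dg_inv uy y0) (psiD _ _ gd)) uy); zmod.
Qed.

(** Unless D_e is a central C, this is Skolem-Noether for the restriction of [psi] to D_e. For a
    central C, if [psi] is the identity on D_e, then [psi (X t) / X t] is a character, realised by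
    some [X u] ([inner_character]); if [psi] is the conjugation on D_e, the same holds after a
    correction by [nu]. *)
Lemma aut_reduction (psi : {lrmorphism D -> D}) :
  bijective psi -> (forall g d, Dg g d -> Dg g (psi d)) ->
  exists u y (psi' : {lrmorphism D -> D}),
    [/\ Dg u y, y != 0, groupA Dg T phi0 kind X nu psi'
      & forall d, psi d * y = y * psi' d].
Proof.
move=> psib psiD.
suff [u [y [uy y0 yP]]] : exists u y, [/\ Dg u y, y != 0 &
    forall psi' : {lrmorphism D -> D}, bijective psi' ->
      (forall g d, Dg g d -> Dg g (psi' d)) ->
      (forall d, psi' d = y^-1 * psi d * y) -> groupA Dg T phi0 kind X nu psi'].
  have [psi' [b' D' E']] := twisted_aut psib psiD uy y0.
  exists u, y, psi'; split=> //; first exact: yP.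
  by move=> d; rewrite E' !mulrA divrr ?mul1r // (Dg_unit uy).
have [cen|ncen] := pselect (De_C_central Dg kind); last first.
  suff [u [y [uy y0 yP]]] : exists u y, [/\ Dg u y, y != 0 &
      forall d, Dg 0 d -> psi d * y = y * d].
    exists u, y; split=> // psi' b' D' E'; split=> // _ d d0.
    by rewrite E' -mulrA yP // mulKr // (Dg_unit uy).
  case kE : kind.
  - exists 0, 1; split; [exact: Dg1|exact: oner_neq0|].
    move=> d /(De_R_real kE)[a ->]; rewrite mulr1 mul1r linearZ /=.
    by rewrite rmorph1.
  - have [i [i0 ii phii ib]] := De_C_basis kE.
    have reduce u y : Dg u y -> y != 0 -> psi i * y = y * i ->
        exists u y, [/\ Dg u y, y != 0 & forall d, Dg 0 d -> psi d * y = y * d].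
      move=> uy y0 E; exists u, y; split=> // d /ib[a [b ->]].
      rewrite raddfD /= !linearZ /= rmorph1 mulrDl mulrDr -!scalerAl
        -!scalerAr E.
      by rewrite mulr1 mul1r.
    have [||E|E] := @De_C_root i (psi i) kE i0 ii.
    + exact: psiD.
    + by rewrite -rmorphM ii rmorphN rmorph1.
    + by apply: (reduce 0 1 Dg1 (oner_neq0 _)); rewrite E mulr1 mul1r.
    (* Here [psi] is the conjugation on D_e, and so is the inner automorphism of [X s] for [s]
       outside K. *)
    have [s sT sK] : exists2 s, s \in T & ~~ inK Dg T kind s.
      exact: exists_notK.
    apply: (reduce s (X s) (Xg sT) (X0 sT)); rewrite E.
    by rewrite (De_C_conj kE sT sK (Xg sT) i0) phii.
  - have [i [j [[i0 j0] [ii jj] ji ib]]] := De_H_basis kE.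
    have psiN1 x y : x * y = -1 -> psi x * psi y = -1.
      by move=> E; rewrite -rmorphM E rmorphN rmorph1.
    have JI : psi j * psi i = - (psi i * psi j) by rewrite -!rmorphM ji rmorphN.
    have [|q q4 y0] := @intertwiner_neq0 D i j (psi i) (psi j) ii jj ji.
      by rewrite -scaler_nat scaler_eq0 oner_eq0 orbF pnatr_eq0.
    have q0 : Dg 0 q.
      move: q4; rewrite !inE => /or4P[] /eqP-> //; [exact: Dg1|exact: De_mul].
    exists 0, (intertwiner i j (psi i) (psi j) q); split=> //.
      by rewrite /intertwiner; do ?[apply: DgB | apply: De_mul | exact: psiD].
    have El := intertwinerl (psi j) ii ji (psiN1 _ _ ii) q.
    have Er := intertwinerr i jj (psiN1 _ _ jj) JI q.
    move: (intertwiner _ _ _ _ q) El Er => y El Er.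
    move=> d /ib[a [b [c [e ->]]]];
      rewrite !raddfD /= !linearZ /= rmorph1 rmorphM.
    rewrite !(mulrDl, mulrDr) -!scalerAl -!scalerAr El mulr1 mul1r.
    by rewrite -[psi i * psi j * y]mulrA !Er [psi i * (y * j)]mulrA El -mulrA.
have kE : kind = De_C by case: cen.
have [i [i0 ii phii ib]] := De_C_basis kE.
have cD0 z : Dg 0 z -> central z by move/(central_D0 cen).
have psiM x y : psi (x * y) = psi x * psi y by exact: rmorphM.
(* The central element [i] is not fixed by [phi0]. *)
have d1 : delta = 1.
  apply: hdeltaZ; exists i; first exact: cD0.
  rewrite phii => /eqP; rewrite eq_sym -addr_eq0 -mulr2n -scaler_nat scaler_eq0.
  rewrite pnatr_eq0 /= => /eqP iE; move: ii; rewrite iE mul0r => /eqP.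
  by rewrite eq_sym oppr_eq0 oner_eq0.
have phiX t : t \in T -> phi0 (X t) = X t.
  move=> tT; case: (hX tT) => _ _ _ -> //; first by rewrite d1 mulr1z.
  by rewrite /inK tT kE; apply/asboolP => d _ e /cD0 ec; rewrite ec.
pose chi t := psi (X t) / X t.
have chi0 t : t \in T -> Dg 0 (chi t) /\ chi t != 0.
  move=> tT; have gX := psiD _ _ (Xg tT).
  split; first by apply: (DgMe _ gX (Xinv tT)); rewrite subrr.
  apply: (DgM_neq0 gX (Xinv tT)); last by apply: inv_neq0; exact: Xu.
  by apply: (rmorph_unit_neq0 psi (Xg tT)); exact: X0.
have chic t : t \in T -> central (chi t) by move=> /chi0[/cD0].
have chiE t : t \in T -> psi (X t) = chi t * X t.
  by move=> tT; rewrite /chi divrK ?Xu.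
clearbody chi.
have [||E|E] := @De_C_root i (psi i) kE i0 ii; first exact: psiD.
- by rewrite -rmorphM ii rmorphN rmorph1.
- have psi0 z : Dg 0 z -> psi z = z.
    by move=> /ib[a [b ->]]; rewrite raddfD /= !linearZ /= rmorph1 E.
  have [|u uT uP] := inner_character cen chi0.
    move=> a b aT bT; have abX := DgM (Xg aT) (Xg bT).
    have [z z0 zE] := XDe (TD aT bT) abX.
    have abu : X a * X b \is a GRing.unit by rewrite unitrMl ?Xu.
    apply: (mulIr abu); rewrite {1}zE mulrA -chiE ?TD // -{1}[z]psi0 // -psiM.
    rewrite -zE psiM !chiE // -!mulrA; congr (chi a * _).
    by rewrite !mulrA (chic b bT (X a)).
  exists u, (X u); split; [exact: Xg|exact: X0|].
  move=> psi' b' D' E'; split=> // _; left => d.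
  have psi'M x y : psi' (x * y) = psi' x * psi' y by exact: rmorphM.
  have [s [z [sT z0 ->]]] := X_decomp d;
    rewrite raddf_sum /= big_seq [RHS]big_seq.
  apply: eq_bigr => t /sT tT; rewrite psi'M !E' (psi0 _ (z0 t)).
  rewrite -[_ * z t * X u]mulrA (cD0 _ (z0 t) (X u)) mulKr ?Xu //.
  by rewrite chiE // -[_ * (chi t * _) * _]mulrA -uP // mulKr ?Xu.
have psi0 z : Dg 0 z -> psi z = phi0 z.
  move=> /ib[a [b ->]]; rewrite !raddfD /= !linearZ /= rmorph1 phi01.
  by rewrite E phii.
(* The factor [b] is preserved by [psi], being independent of representatives, so it is fixed by
   [phi0]. Applying [phi0] to [X s * X t = b * X t * X s] then reverses the products and gives
   [b * b = 1]. *)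
have factor_inv s t : s \in T -> t \in T ->
    comm_factor s t * comm_factor s t = 1.
  move=> sT tT; have c0 := comm_factor_Dg sT tT.
  have c_neq0 : comm_factor s t != 0.
    apply: unit_neq0; rewrite /comm_factor unitrMl ?unitrV ?Xu //.
    by rewrite unitrMl ?unitrV ?Xu // unitrMl ?Xu.
  have fixed : phi0 (comm_factor s t) = comm_factor s t.
    rewrite -psi0 //.
    apply: (comm_factor_uniq cen sT tT (psiD _ _ (Xg sT)) (psiD _ _ (Xg tT))).
    - by apply: (rmorph_unit_neq0 psi (Xg sT)); exact: X0.
    - by apply: (rmorph_unit_neq0 psi (Xg tT)); exact: X0.
    - by rewrite -!psiM -comm_factorE.
  have E1 := comm_factorE sT tT.
  have cu := Dg_unit c0 c_neq0; have cc := cD0 _ c0.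
  move: (comm_factor s t) cu cc E1 fixed {c0 c_neq0} => b bu bc E1 fixed.
  have := congr1 phi0 E1; rewrite !phi0M !phiX // fixed mulrA -bc E1 => E2.
  apply: (mulIr (Xu tT)); apply: (mulIr (Xu sT)).
  by rewrite mul1r [RHS]E2 !mulrA.
have el2 : elementary2 T.
  move=> t tT; rewrite mulr2n; apply: (central_X_degree cen); first exact: TD.
  by move=> s sT; rewrite comm_factorDr // factor_inv.
have [nu1 nuM] := hnu cen el2.
(* Both [chi] and [nu] fail to be multiplicative by the same factor [comm_factor], whose square is
   1, so the product is a character. *)
pose lam t := chi t *~ nu t.
have [||u uT uP] := @inner_character cen lam.
- move=> t tT; have [c0 c_neq0] := chi0 t tT; split; first exact: DgMz.
  by rewrite mulr_sign_unit //; exact: nu1.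
- move=> a b aT bT; rewrite /lam.
  have abT := TD aT bT.
  have [z z0 zE] := XDe abT (DgM (Xg aT) (Xg bT)).
  have E1 : chi a * chi b * comm_factor a b = chi (a + b).
    have phiE : phi0 z * X (a + b) = X b * X a.
      by rewrite -[X (a + b)]phiX // -phi0M -zE phi0M !phiX.
    apply: (mulIr (Xu bT)); apply: (mulIr (Xu aT)).
    rewrite -mulrA -[_ * _ * (X b * X a)]mulrA [comm_factor a b * _]mulrA.
    rewrite -comm_factorE // -[RHS]mulrA -phiE.
    rewrite (cD0 _ (hdeg z0)) [RHS]mulrA -chiE // -(psi0 _ z0) -psiM -zE psiM
      !chiE //.
    by rewrite -!mulrA; congr (_ * _); rewrite !mulrA (chic b bT).
  have bE : beta X a b = comm_factor a b.
    by rewrite /beta invrM ?Xu // mulrA.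
  have c2 := factor_inv a b aT bT.
  move: (comm_factor a b) bE E1 c2 => c bE E1 c2.
  have := congr1 (fun d => chi (a + b) * d) (nuM a b aT bT).
  rewrite bE mulrzr mulrA mulrzr => ->; rewrite -E1 mulrzAl -!mulrA.
  rewrite c2 mulr1 mulrzAl mulrzAr.
  by rewrite mulrzA; case: (nu1 a aT) => ->; case: (nu1 b bT) => ->.
exists u, (X u); split; [exact: Xg|exact: X0|].
move=> psi' b' D' E'; split=> // _; right; split=> //.
- by move=> z z0; rewrite E' (psi0 _ z0) -mulrA (cD0 _ (hdeg z0)) mulKr ?Xu.
- move=> t tT; rewrite E' chiE // -mulrA; apply: (mulrI (Xu uT)).
  rewrite mulVKr ?Xu // mulrzAr uP // /lam -!mulrzAl.
  by case: (nu1 t tT) => ->; rewrite ?mulrNz ?opprK ?mulr1z.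
Qed.
(** * Isomorphisms and isometries *)

Definition star m k (A : 'M[D]_(m, k)) : 'M[D]_(k, m) := map_mx phi0 A^T.

Lemma star_mul m k l (A : 'M[D]_(m, k)) (B : 'M[D]_(k, l)) :
  star (A *m B) = star B *m star A.
Proof.
apply/matrixP => i j; rewrite !mxE raddf_sum; apply: eq_bigr => a _.
by rewrite !mxE; exact: phi0M.
Qed.

Lemma star1 n : star (1%:M : 'M[D]_n) = 1%:M.
Proof.
apply/matrixP => i j; rewrite !mxE eq_sym; case: eqP => _; first exact: phi01.
exact: raddf0.
Qed.

Lemma starK m k (A : 'M[D]_(m, k)) : star (star A) = A.
Proof. by apply/matrixP => i j; rewrite !mxE phi0K. Qed.

Lemma star_map psi m k (A : 'M[D]_(m, k)) : graded_aut psi ->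
  star (map_mx psi A) = map_mx psi (star A).
Proof. by case=> _ _ E; apply/matrixP => i j; rewrite !mxE. Qed.

Lemma mulmx_scalar_entry m k (A : 'M[D]_(m, k)) a i j :
  (A *m a%:M) i j = A i j * a.
Proof.
rewrite mxE (bigD1 j) //= big1 ?addr0 => [|l lj];
  first by rewrite mxE eqxx mulr1n.
by rewrite mxE (negPf lj) mulr0.
Qed.

Lemma commuting_scalar n (W : 'M[D]_n) (a0 : 'I_n) :
  (forall B, W *m B = B *m W) -> central (W a0 a0) /\ W = (W a0 a0)%:M.
Proof.
move=> WB.
have Wd i a b d : W i a * d = if i == a then d * W b b else 0.
  have := congr1 (fun M : 'M_n => M i b) (WB (unit_mx a b d)); rewrite !mxE.
  rewrite (bigD1 a) //= big1 ?addr0 => [|j ja];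
    last by rewrite mxE (negPf ja) mulr0.
  rewrite mxE !eqxx => ->; rewrite (bigD1 b) //= big1 ?addr0 => [|j jb].
    by rewrite mxE eqxx andbT; case: ifP; rewrite ?mul0r.
  by rewrite mxE (negPf jb) andbF mul0r.
split=> [d|]; first by rewrite (Wd _ _ a0) eqxx.
apply/matrixP => i j; rewrite [RHS]mxE -[LHS]mulr1 (Wd _ _ a0) mul1r.
by case: eqP; rewrite ?mulr1n.
Qed.

Section IsometryOfIso.
Variables (p p' : param T) (n n' : nat).
Variables (cls : 'I_n -> {quot T}) (loc : 'I_n -> nat) (F Fi : 'M[D]_n).
Variables (cls' : 'I_n' -> {quot T}) (loc' : 'I_n' -> nat) (F' Fi' : 'M[D]_n').
Hypothesis hp : paramX Dg delta kind eta xi p.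
Hypothesis hp' : paramX Dg delta kind eta xi p'.
Hypothesis hM : model p cls loc F.
Hypothesis hM' : model p' cls' loc' F'.
Hypothesis hFi : Fi *m F = 1%:M /\ F *m Fi = 1%:M.
Hypothesis hFi' : Fi' *m F' = 1%:M /\ F' *m Fi' = 1%:M.

(* [U] is a matrix of an isometry, up to the twist by [psi] and [c], between  *)
(* the hermitian spaces with Gram matrices [F] and [F'].                      *)
Definition similitude g c psi (U : 'M[D]_(n', n)) (V : 'M[D]_(n, n')) :=
  [/\ V *m U = 1%:M /\ U *m V = 1%:M,
      graded_mx (fun i => xi (cls' i) - g) (fun a => xi (cls a)) U,
      graded_mx (fun a => xi (cls a)) (fun i => xi (cls' i) - g) V
    & star U *m F' *m U = c *: map_mx psi F].

Lemma model_inhabited : exists a : 'I_n, True.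
Proof.
case: hp => -[[y /eqP ky] _ _ _] _.
by have [|a _] := model_surj hM (y := y) (k := 0); [rewrite lt0n|exists a].
Qed.

Variable f : 'M[D]_n -> 'M[D]_n'.
Hypothesis fD : {morph f : A B / A + B}.
Hypothesis fM : forall A B, f (A *m B) = f A *m f B.
Hypothesis f1 : f 1%:M = 1%:M.
Hypothesis fZ : forall (a : R) A,
  f (map_mx (fun d => a *: d) A) = map_mx (fun d => a *: d) (f A).
Hypothesis fbij : bijective f.
Hypothesis fdeg : forall h A,
  graded_mx (fun a => xi (cls a) - h) (fun a => xi (cls a)) A <->
  graded_mx (fun a => xi (cls' a) - h) (fun a => xi (cls' a)) (f A).
Hypothesis fphi : forall A, f (Fi *m star A *m F) = Fi' *m star (f A) *m F'.

(** The involutions are adjoint to [F] and [F']; comparing them shows that [W], the quotient of the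
    pulled back form by [psi] of [F], commutes with every matrix, hence is a central scalar [c]. *)
Lemma similitude_of_iso : exists g c h psi U V,
  [/\ groupC Dg phi0 c h, groupA Dg T phi0 kind X nu psi,
      p_g p' = p_g p + h - g *+ 2 & similitude g c psi U V].
Proof.
have [a0 _] := model_inhabited.
have [g1 [psi1 [U1 [V1 [[psi1b psi1D] gU1 gV1 [VU1 UV1] fE1]]]]] :=
  graded_iso_matrix fD fM f1 fZ fbij fdeg a0.
have [u [y [psi [uy y0 psiA psiE]]]] := aut_reduction psi1b psi1D.
have yu := Dg_unit uy y0.
have psiG := groupA_phi0 psiA; have [[psi' psiK psi'K] psiD psiphi] := psiG.
pose U := U1 *m y%:M; pose V := y^-1%:M *m V1.
have VU : V *m U = 1%:M.
  by rewrite /V /U !mulmxA -[_ *m V1 *m U1]mulmxA VU1 mulmx1 -scalar_mxM mulVr.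
have UV : U *m V = 1%:M.
  by rewrite /V /U !mulmxA -[U1 *m _ *m _]mulmxA -scalar_mxM divrr // mulmx1.
have fE A : f A = U *m map_mx psi A *m V.
  rewrite fE1 /U /V !mulmxA; congr (_ *m V1).
  rewrite -2![RHS]mulmxA; congr (_ *m _).
  have -> : map_mx psi1 A = y%:M *m map_mx psi A *m y^-1%:M;
    last by rewrite !mulmxA.
  apply/matrixP => i j; rewrite mulmx_scalar_entry mul_scalar_mx !mxE.
  by rewrite -psiE mulrK.
have gU : graded_mx (fun i => xi (cls' i) - (g1 + u)) (fun a => xi (cls a)) U.
  move=> i a; rewrite /U mulmx_scalar_entry.
  by apply: (DgMe _ (gU1 i a) uy); zmod.
have gV : graded_mx (fun a => xi (cls a)) (fun i => xi (cls' i) - (g1 + u)) V.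
  move=> a i; rewrite /V mul_scalar_mx mxE.
  by apply: (DgMe _ (Dg_inv uy y0) (gV1 a i)); zmod.
clearbody U V; move: {g1 u uy gU1 gV1}(g1 + u) gU gV => g gU gV.
have [FiF FFi] := hFi; have [Fi'F' F'Fi'] := hFi'.
pose W := star U *m F' *m U *m map_mx psi Fi.
have [cZ WE] : central (W a0 a0) /\ W = (W a0 a0)%:M.
  apply: commuting_scalar => B.
  (* Chosen so that [psi] takes [star A] to the arbitrary matrix [B]. *)
  pose A := star (map_mx psi' B).
  have AE : map_mx psi (star A) = B.
    by rewrite /A starK; apply/matrixP => i j; rewrite !mxE psi'K.
  have := fphi A; rewrite !fE !map_mxM /= AE !star_mul star_map // AE => E.
  have {E} := congr1 (fun M => star U *m F' *m M *m U *m map_mx psi Fi) E.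
  rewrite !mulmxA -/W.
  rewrite -[W *m B *m _ *m V *m U]mulmxA VU mulmx1.
  rewrite -[W *m B *m _ *m _]mulmxA -map_mxM FFi map_mx1 mulmx1 => ->.
  rewrite -[star U *m F' *m Fi']mulmxA F'Fi' mulmx1 -star_mul VU star1.
  by rewrite mul1mx.
set c := W a0 a0 in cZ WE.
have iso : star U *m F' *m U = c *: map_mx psi F.
  by rewrite -mul_scalar_mx -WE /W -[RHS]mulmxA -map_mxM FiF map_mx1 mulmx1.
have gS a b : Dg (g *+ 2 + p_g p' + xi (cls a) + xi (cls b)) ((star U *m F' *m
  U) a b).
  rewrite mxE; apply: Dg_sum => j _; rewrite mxE.
  have -> : g *+ 2 + p_g p' + xi (cls a) + xi (cls b) =
      (g *+ 2 + p_g p' + xi (cls a) + xi (cls b)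
       - (xi (cls b) - (xi (cls' j) - g))) + (xi (cls b) - (xi (cls' j) - g))
           by zmod.
  apply: DgM (gU j b); apply: Dg_sum => i _; rewrite !mxE.
  by apply: (DgMe _ (hdeg (gU i a)) (model_Dg hM' i j)); zmod.
have [b0 Fb0] := model_partner hp hM a0.
have psiF_neq0 : psi (F a0 b0) != 0 by apply: rmorph_unit_neq0 (model_Dg hM a0
  b0) Fb0.
have gpsiF := psiD _ _ (model_Dg hM a0 b0).
(* The degree of [c], from comparing a nonzero entry on both sides of [iso]. *)
pose h := g *+ 2 + p_g p' - p_g p.
have gc : Dg h c.
  have <- : (star U *m F' *m U) a0 b0 / psi (F a0 b0) = c.
    by rewrite iso !mxE mulrK // (Dg_unit gpsiF).
  by apply: (DgMe _ (gS a0 b0) (Dg_inv gpsiF psiF_neq0)); rewrite /h; zmod.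
have c0 : c != 0.
  apply/eqP => c0; move: iso; rewrite c0 scale0r => E.
  have [i _] : exists i : 'I_n', True.
    case: hp' => -[[y1 /eqP ky] _ _ _] _.
    by have [|a _] := model_surj hM' (y := y1) (k := 0);
      [rewrite lt0n|exists a].
  have [j /eqP[]] := model_partner hp' hM' i.
  have <- : (star V *m (star U *m F' *m U) *m V) i j = F' i j.
    rewrite !mulmxA -star_mul UV star1 mul1mx -mulmxA UV mulmx1 //.
  by rewrite E mulmx0 mul0mx mxE.
(* Both forms are [delta]-hermitian, so applying [star] to [iso] replaces [c] by [phi0 c]. *)
have phic : phi0 c = c.
  have := congr1 (@star _ _) iso; rewrite !star_mul starK.
  have -> : star F' = F' *~ delta.
    apply/matrixP => i j; rewrite !mxE (model_herm hM').
    by case: hdelta => ->; rewrite ?mulrNz !mulr1z // !mxE.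
  move=> E; have {E} : star (c *: map_mx psi F) = (c *: map_mx psi F) *~ delta.
    rewrite -E -iso -mulmxA; case: hdelta => ->; rewrite ?mulrNz !mulr1z //.
    by rewrite mulNmx mulmxN.
  move=> /matrixP/(_ b0 a0); rewrite !mxE phi0M psiphi (model_herm hM).
  have -> : ((c *: map_mx psi F) *~ delta) b0 a0 = c * psi (F b0 a0) *~ delta.
    by case: hdelta => ->; rewrite ?mulrNz !mulr1z !mxE.
  have F0 : F b0 a0 != 0 by rewrite (model_sym hM).
  have := Dg_unit (psiD _ _ (model_Dg hM b0 a0)) (rmorph_unit_neq0 psi
    (model_Dg hM b0 a0) F0).
  move=> pu; rewrite raddfMz /= mulrzAl [c * _]cZ => E.
  apply: (mulrI pu); move: E; case: hdelta => ->; rewrite ?mulrNz ?mulr1z //.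
  by move/oppr_inj.
exists g, c, h, psi, U, V; split=> //.
by rewrite /h; zmod.
Qed.

End IsometryOfIso.
(** * Signatures *)

Lemma real_scalar_neq0 (a : R) (x : D) : a *: x != 0 -> a != 0.
Proof. by apply: contraNneq => ->; rewrite scale0r. Qed.

Section OrbitSign.
Variables (psi : {lrmorphism D -> D}) (c : D) (h u t : G).
Hypothesis psiA : graded_aut psi.
Hypothesis cC : groupC Dg phi0 c h.
Hypotheses (uT : u \in T) (st : sig t).

(** The product of the sign factors contributed by [actG], [actC] and [actA]; see [acted_sigma]. *)
Definition orbit_sign : int :=
  eta u * rsign ((X (t + h + u *+ 2))^-1 * X u * X (t + h) * X u)
  * rsign ((X (t + h))^-1 * X t * c) * rsign ((X t)^-1 * psi (X t)).

(** The elements [psi (X t)], [X t * c] and [transport psi c u (X t)] keep the symmetry of [X t], so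
    [sig_real] makes them real multiples of the chosen elements of their degrees. *)
Lemma orbit_factors : exists r1 r2 r3 : R,
  [/\ [/\ r1 != 0, r2 != 0 & r3 != 0],
      [/\ X u * X (t + h) * X u = r1 *: X (t + h + u *+ 2),
          X t * c = r2 *: X (t + h) & psi (X t) = r3 *: X t]
    & orbit_sign = eta u * sgz (r1 * r2 * r3)].
Proof.
have [tT Xc phiX] := st; have [ch c0 cZ phic] := cC.
have [[psi' psiK psi'K] psiD psiphi] := psiA.
have Xtc_neq0 : X t * c != 0 by apply: (DgM_neq0 (Xg tT) ch); rewrite ?X0.
have Xtc_com : commutes_De Dg (X t * c) by move=> e e0;
  rewrite -mulrA cZ !mulrA Xc.
have Xtc_phi : phi0 (X t * c) = (X t * c) *~ delta.
  by rewrite phi0M phic phiX mulrzAr cZ.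
have Xtcg := DgM (Xg tT) ch.
have st1 : sig (t + h) by apply/sigP; exists (X t * c).
have st2 := proj1 (transport_sig t psiA cC uT) st.
have [r3 E3] : exists r3, psi (X t) = r3 *: X t.
  apply: sig_real => //; first by apply: psiD; exact: Xg.
    exact/(aut_commutes psiA).
  by rewrite psiphi phiX raddfMz.
have [r2 E2] := sig_real st1 Xtcg Xtc_com Xtc_phi.
have [r E] : exists r, transport psi c u (X t) = r *: X (t + h + u *+ 2).
  apply: sig_real => //; first exact: transport_Dg (Xg tT).
    exact/(transport_commutes psiA cC uT).
  rewrite (transport_phi0 psiA cC uT) phiX /transport raddfMz /=.
  by rewrite mulrzAl mulrzAr mulrzAl.
have r3_neq0 : r3 != 0.
  by apply: (@real_scalar_neq0 _ (X t)); rewrite -E3;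
    apply: rmorph_unit_neq0 (Xg tT) (X0 tT).
have r2_neq0 : r2 != 0 by apply: (@real_scalar_neq0 _ (X (t + h))); rewrite -E2.
have r_neq0 : r != 0.
  apply: (@real_scalar_neq0 _ (X (t + h + u *+ 2))); rewrite -E.
  exact: (transport_neq0 psi cC uT (Xg tT) (X0 tT)).
have E1 : X u * X (t + h) * X u = ((r3 * r2)^-1 * r) *: X (t + h + u *+ 2).
  rewrite -scalerA -E /transport E3 -scalerAl E2 -scalerAr -scalerAr -!scalerAl.
  by rewrite !scalerA mulVf ?scale1r // mulf_neq0.
set r1 := _ * r in E1; have r1_neq0 : r1 != 0.
  by rewrite mulf_neq0 // invr_neq0 // mulf_neq0.
exists r1, r2, r3; split=> //.
have [t1T _ _] := st1; have [t2T _ _] := st2.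
rewrite /orbit_sign -!mulrA [X u * (_ * _)]mulrA E1 E2 E3 -!scalerAr !mulVr
  ?Xu //.
by rewrite !rsignE !sgzM !mulrA.
Qed.

End OrbitSign.

Definition normD (d : D) : R := xget 0 [set a : R | phi0 d * d = a%:A].

Lemma normDP d : Dg 0 d -> [/\ 0 <= normD d, phi0 d * d = (normD d)%:A
  & normD d = 0 -> d = 0].
Proof.
move=> d0; have [a [a0 aE ad]] := phi0_norm d0; suff -> : normD d = a by [].
rewrite /normD; case: xgetP => [b -> /=|/(_ a)/=]; last by rewrite aE.
by rewrite aE => /scaler1_inj.
Qed.

(* Sylvester's law of inertia: if the positive part were larger on the left,  *)
(* some nonzero vector in it would have an image in the nonpositive part.     *)
Lemma inertia (I J : finType) (A : {set I}) (B : {set J}) (W : J -> I -> D)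
    (e : I -> R) (e' : J -> R) :
  (forall j i, Dg 0 (W j i)) ->
  (forall a b, a \in A -> b \in A ->
     \sum_(j in B) phi0 (W j a) * (e' j *: W j b) =
     if a == b then (e a)%:A else 0) ->
  (#|[set a in A | (0 < e a)%R]| <= #|[set j in B | (0 < e' j)%R]|)%N.
Proof.
move=> W0 gram; rewrite leqNgt; apply/negP => ltn.
have [v [v0 [a1 a1A va1] vE]] :=
  underdetermined_system (Dg0 0) Dg1 (@DgB 0) De_mul De_unit ltn W0.
set A0 := [set a in A | 0 < e a] in a1A vE.
set B0 := [set j in B | 0 < e' j] in vE.
pose Z j := \sum_(a in A0) W j a * v a.
have Z0 j : Dg 0 (Z j) by apply: Dg_sum => a _; exact: De_mul.
have E : \sum_(j in B) phi0 (Z j) * (e' j *: Z j) =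
         \sum_(a in A0) (e a * normD (v a))%:A.
  have A0A a : a \in A0 -> a \in A by rewrite inE => /andP[].
  transitivity (\sum_(a in A0) \sum_(b in A0)
      phi0 (v a) * (\sum_(j in B) phi0 (W j a) * (e' j *: W j b)) * v b).
    under [RHS]eq_bigr do under eq_bigr do rewrite mulr_sumr mulr_suml.
    rewrite [RHS](eq_bigr (fun a => \sum_(j in B) \sum_(b in A0)
      phi0 (v a) * (phi0 (W j a) * (e' j *: W j b)) * v b)) => [|a _];
        last first.
      exact: exchange_big.
    rewrite exchange_big; apply: eq_bigr => j _.
    rewrite raddf_sum mulr_suml; apply: eq_bigr => a _ /=.
    rewrite scaler_sumr mulr_sumr; apply: eq_bigr => b _.
    by rewrite phi0M scalerAl !mulrA.
  apply: eq_bigr => a aA0; rewrite (bigD1 a) //= [X in _ + X]big1 ?addr0.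
    rewrite gram ?A0A // eqxx -scalerAr -scalerAl mulr1.
    by have [_ -> _] := normDP (v0 a); rewrite scalerA.
  move=> b /andP[bA0 ba].
  by rewrite gram ?A0A // eq_sym (negPf ba) mulr0 mul0r.
have lhs : \sum_(j in B) phi0 (Z j) * (e' j *: Z j) =
    (\sum_(j in B) e' j * normD (Z j))%:A.
  rewrite scaler_suml; apply: eq_bigr => j _.
  by have [_ E' _] := normDP (Z0 j); rewrite -scalerAr E' scalerA.
move: E; rewrite lhs -scaler_suml => /scaler1_inj E.
have : \sum_(j in B) e' j * normD (Z j) <= 0.
  apply: sumr_le0 => j jB; have [nZ _ _] := normDP (Z0 j).
  have [e'j|e'j] := ltP 0 (e' j); last by rewrite mulr_le0_ge0.
  suff Zj : Z j = 0.
    have [_ + _] := normDP (Z0 j); rewrite Zj mulr0 => /esym/eqP.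
    rewrite scaler_eq0 oner_eq0 orbF => /eqP->; by rewrite mulr0.
  by apply: vE; rewrite inE jB.
rewrite E leNgt => /negP; apply.
rewrite (bigD1 a1) //= ltr_pwDl //.
  have [n1 _ n10] := normDP (v0 a1).
  rewrite mulr_gt0 //; first by move: a1A; rewrite inE => /andP[].
  by rewrite lt_neqAle n1 andbT eq_sym; apply: contra va1 => /eqP nv;
    apply/eqP; exact: n10.
apply: sumr_ge0 => a /andP[aA0 _]; have [na _ _] := normDP (v0 a).
by rewrite mulr_ge0 //; move: aA0; rewrite inE => /andP[_ /ltW].
Qed.

Lemma card_ord_lt n q : (q <= n)%N -> #|[set k : 'I_n | (k < q)%N]| = q.
Proof.
move=> qn; rewrite -sum1_card (eq_bigl (fun k : 'I_n => (k < q)%N)) => [|k].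
  by rewrite (big_ord_narrow qn) sum1_card card_ord.
by rewrite inE.
Qed.

Lemma model_card p n (cls : 'I_n -> {quot T}) loc F y (P : pred nat) :
  model p cls loc F ->
  #|[set a | (cls a == y) && P (loc a)]| = #|[set k : 'I_(p_kappa p y) | P k]|.
Proof.
move=> hM; have /choice[s sP] : forall k : 'I_(p_kappa p y), exists a,
    cls a = y /\ loc a = k by move=> k; apply: (model_surj hM); exact: ltn_ord.
have s_inj : injective s.
  by move=> k l E; apply: val_inj; case: (sP k) (sP l);
    rewrite E => _ /= <- [_ ->].
rewrite -(card_imset _ s_inj); congr #|pred_of_set _|; apply/setP => a.
rewrite inE; apply/andP/imsetP => [[/eqP ay Pa]|[k]]; last first.
  by rewrite inE => Pk ->; case: (sP k) => -> ->.
have la : (loc a < p_kappa p y)%N by rewrite -ay; exact: (model_lt hM).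
exists (Ordinal la); first by rewrite inE.
by case: (sP (Ordinal la)) => e1 e2; apply: (model_inj hM); rewrite ?e1 ?e2.
Qed.

Lemma model_card_class p n (cls : 'I_n -> {quot T}) loc F y :
  model p cls loc F -> #|[set a | cls a == y]| = p_kappa p y.
Proof.
move=> hM; rewrite -[RHS](card_ord_lt (leqnn _)) -(model_card y (fun l =>
  l < p_kappa p y)%N hM).
apply: eq_card => a; rewrite !inE; case: eqP => //= <-.
by rewrite (model_lt hM).
Qed.

Lemma graded_mx_class n n' (cls : 'I_n -> {quot T}) (cls' : 'I_n' -> {quot T})
    (U : 'M[D]_(n', n)) g i a :
  graded_mx (fun i => xi (cls' i) - g) (fun a => xi (cls a)) U ->
  U i a != 0 -> cls' i = cls a + pi g.
Proof.
move=> gU /(Dg_support (gU i a)) uT.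
rewrite -(hxi (cls' i)) -(hxi (cls a)) -piD; apply/eq_pi.
have -> : xi (cls' i) - (xi (cls a) + g) = - (xi (cls a) - (xi (cls' i) - g)).
  zmod.
exact: TN.
Qed.

Lemma similitude_shift g y : xi (y + pi g) - g - xi y \in T.
Proof.
have -> : xi (y + pi g) - g - xi y = xi (y + pi g) - (xi y + g) by zmod.
by apply/eq_pi; rewrite piD !hxi.
Qed.

(** By degrees, the injective [U] maps coordinates of class [y] to coordinates of class [y + pi g].
    Multiplying by [X u] moves this block to degree 0, where a smaller target would leave a kernel
    vector. *)
Lemma similitude_kappa_le p p' n n' (cls : 'I_n -> {quot T}) loc F
    (cls' : 'I_n' -> {quot T}) loc' F' g (U : 'M[D]_(n', n)) V y :
  model p cls loc F -> model p' cls' loc' F' ->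
  graded_mx (fun i => xi (cls' i) - g) (fun a => xi (cls a)) U ->
  V *m U = 1%:M -> (p_kappa p y <= p_kappa p' (y + pi g)%R)%N.
Proof.
move=> hM hM' gU VU.
rewrite -(model_card_class y hM) -(model_card_class (y + pi g) hM').
rewrite leqNgt; apply/negP => ltn; set u := xi (y + pi g) - g - xi y.
have uT : u \in T := similitude_shift g y.
pose w i a := if (cls a == y) && (cls' i == y + pi g) then X u * U i a else 0.
have w0 i a : Dg 0 (w i a).
  rewrite /w; case: ifP => [/andP[/eqP ca /eqP ci]|_]; last exact: Dg0.
  by apply: (DgMe _ (Xg uT) (gU i a)); rewrite ca ci /u; zmod.
have [v [_ [a1 a1y va1] vE]] :=
  underdetermined_system (Dg0 0) Dg1 (@DgB 0) De_mul De_unit ltn w0.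
pose v' : 'cV[D]_n := \col_a (if cls a == y then v a else 0).
have Uv : U *m v' = 0.
  apply/matrixP => i j; rewrite !mxE (bigID (fun a => cls a == y)) /=.
  rewrite [X in _ + X]big1 ?addr0 => [|a /negPf ay];
    last by rewrite mxE ay mulr0.
  have [ci|ci] := eqVneq (cls' i) (y + pi g); last first.
    apply: big1 => a /eqP ay; have [->|Ui] := eqVneq (U i a) 0;
      first by rewrite mul0r.
    by move/eqP: ci; rewrite (graded_mx_class gU Ui) ay.
  apply: (mulrI (Xu uT)); rewrite mulr0 mulr_sumr.
  rewrite -[RHS](vE i) ?inE ?ci //.
  apply: eq_big => [a|a ay]; first by rewrite inE.
  by rewrite /w ay ci eqxx mxE ay mulrA.
have : V *m (U *m v') = 0 by rewrite Uv mulmx0.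
rewrite mulmxA VU mul1mx => /matrixP/(_ a1 0)/eqP.
by move: a1y; rewrite !mxE inE => ->; rewrite (negPf va1).
Qed.

Lemma signature_split (k : nat) (s : int) :
  (absz s <= k)%N -> (s = k%:Z %[mod 2])%Z ->
  let q := absz ((k%:Z + s) %/ 2)%Z in (q <= k)%N /\ s = q%:Z *+ 2 - k%:Z.
Proof. by move=> sk sm /=; split; lia. Qed.

Lemma card_ord_ge n q : (q <= n)%N -> #|[set k :
  'I_n | ~~ (k < q)%N]| = (n - q)%N.
Proof.
move=> qn; rewrite cardsCs card_ord -{2}(card_ord_lt qn);
  congr (_ - #|pred_of_set _|)%N.
by apply/setP => k; rewrite !inE negbK.
Qed.

Lemma signature_eq (k q q' : nat) : (q <= k)%N -> (q' <= k)%N ->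
  (q <= q')%N -> (k - q <= k - q')%N ->
  q'%:Z *+ 2 - k%:Z = q%:Z *+ 2 - k%:Z :> int.
Proof. lia. Qed.

Lemma signature_opp (k q q' : nat) : (q <= k)%N -> (q' <= k)%N ->
  (k - q <= q')%N -> (q <= k - q')%N ->
  q'%:Z *+ 2 - k%:Z = - (q%:Z *+ 2 - k%:Z) :> int.
Proof. lia. Qed.

Definition eps (q l : nat) : R := if (l < q)%N then 1 else -1.

Lemma sgz_pm (mu : R) : mu != 0 -> (0 < mu /\ sgz mu = 1) \/ (mu < 0 /\ sgz mu
  = -1).
Proof.
move=> mu0; case: (ltrgt0P mu) => // [mu1|mu1|mu1];
  last by rewrite mu1 eqxx in mu0.
  by left; rewrite gtr0_sgz.
by right; rewrite ltr0_sgz.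
Qed.

Section SimilitudeSign.
Variables (p p' : param T) (n n' : nat).
Variables (cls : 'I_n -> {quot T}) (loc : 'I_n -> nat) (F : 'M[D]_n).
Variables (cls' : 'I_n' -> {quot T}) (loc' : 'I_n' -> nat) (F' : 'M[D]_n').
Hypothesis hp : paramX Dg delta kind eta xi p.
Hypothesis hp' : paramX Dg delta kind eta xi p'.
Hypothesis hM : model p cls loc F.
Hypothesis hM' : model p' cls' loc' F'.
Variables (g : G) (c : D) (h : G) (psi : {lrmorphism D -> D}).
Variables (U : 'M[D]_(n', n)) (V : 'M[D]_(n, n')).
Hypothesis cC : groupC Dg phi0 c h.
Hypothesis psiA : graded_aut psi.
Hypothesis hg : p_g p' = p_g p + h - g *+ 2.
Hypothesis hU : similitude cls F cls' F' g c psi U V.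

Lemma similitude_kappa y : p_kappa p' (y + pi g) = p_kappa p y.
Proof.
have [[VU UV] gU gV _] := hU; apply/eqP; rewrite eqn_leq.
apply/andP; split; last exact: (similitude_kappa_le y hM hM' gU VU).
have -> : p_kappa p y = p_kappa p (y + pi g + pi (- g)) by rewrite piN addrK.
apply: (similitude_kappa_le (g := - g) (U := V) _ hM' hM _ UV).
by apply: graded_mx_shift gV => i j; zmod.
Qed.

Variable y : {quot T}.
Local Notation x := (y + pi g).
Local Notation t := (tau xi (p_g p) y).
Local Notation u := (xi x - g - xi y).
Hypothesis st : sig t.

Lemma tau_shift : tau xi (p_g p') x = t + h + u *+ 2.
Proof. by rewrite /tau hg; zmod. Qed.

(** Multiplying the block of [U] by [X u] gives a matrix [W] over D_e under which the form with
    diagonal [eps q'] pulls back to [mu] times that with diagonal [eps q], where [mu] is real of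
    sign [orbit_sign]. Applying [inertia] to this identity and to its negative gives two
    inequalities that determine [q']. *)
Lemma similitude_sigma : p_sigma p' x = orbit_sign psi c h u t * p_sigma p y.
Proof.
have uT : u \in T := similitude_shift g y; have uX := Xu uT.
have [r1 [r2 [r3 [[r1_neq0 r2_neq0 r3_neq0] [E1 E2 E3] ->]]]] :=
  orbit_factors psiA cC uT st.
have [[VU UV] gU gV iso] := hU; have [tT Xc phiX] := st.
have [ch c0 cZ phic] := cC; have [_ psiD _] := psiA.
have st2 := proj1 (transport_sig t psiA cC uT) st.
have [t2T _ _] := st2.
have X1c : commutes_De Dg (X (t + h)).
  move=> e e0; have : r2 *: (X (t + h) * e) = r2 *: (e * X (t + h)).
    by rewrite scalerAl scalerAr -E2 -mulrA cZ !mulrA Xc.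
  exact: scalerI.
have u1 : X (t + h) \is a GRing.unit by rewrite Xu // TD // (groupC_T cC).
have E1' : (X u)^-1 * X (t + h + u *+ 2) * (X u)^-1 = r1^-1 *: X (t + h).
  apply: (mulrI uX); apply: (mulIr uX); rewrite !mulrA divrr // mul1r divrK //.
  by rewrite -scalerAr -scalerAl E1 scalerA mulVf // scale1r.
pose k := p_kappa p y; pose q := absz ((k%:Z + p_sigma p y) %/ 2)%Z.
pose q' := absz ((k%:Z + p_sigma p' x) %/ 2)%Z.
have [sk _ sm] : [/\ (absz (p_sigma p y) <= k)%N, True &
    (p_sigma p y = k%:Z %[mod 2])%Z].
  by case: hp => _ /(_ y)[? sm _]; split=> //; apply: sm; exact/supp_sig.
have [sk' _ sm'] : [/\ (absz (p_sigma p' x) <= k)%N, True &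
    (p_sigma p' x = k%:Z %[mod 2])%Z].
  case: hp' => _ /(_ x); rewrite similitude_kappa => -[? sm' _]; split=> //.
  by apply: sm'; apply/supp_sig; rewrite tau_shift.
have [qk sE] := signature_split sk sm;
  have [qk' sE'] := signature_split sk' sm'.
rewrite -/q in qk sE; rewrite -/q' in qk' sE'.
pose mu := r1 * r2 * r3 *~ eta u.
have eta1 := eta_pm uT.
have mu_neq0 : mu != 0.
  rewrite /mu; case: eta1 => ->; rewrite ?mulrNz ?oppr_eq0 mulr1z;
  by rewrite !mulf_neq0.
have -> : eta u * sgz (r1 * r2 * r3) = sgz mu.
  by rewrite /mu; case: eta1 => ->;
    rewrite ?mulrNz ?mulr1z ?sgzN ?mulN1r ?mul1r.
pose A := [set a | cls a == y]; pose B := [set i | cls' i == x].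
pose W i a := if (cls a == y) && (cls' i == x) then X u * U i a else 0.
have W0 i a : Dg 0 (W i a).
  rewrite /W; case: ifP => [/andP[/eqP ca /eqP ci]|_]; last exact: Dg0.
  by apply: (DgMe _ (Xg uT) (gU i a)); rewrite ca ci; zmod.
have UW i a : cls a == y -> cls' i == x -> U i a = (X u)^-1 * W i a.
  by move=> ca ci; rewrite /W ca ci mulKr.
have F'E i j : cls' i == x -> cls' j == x ->
    F' i j = if i == j then eps q' (loc' i) *: X (t + h + u *+ 2) else 0.
  move=> /eqP ci /eqP cj; rewrite (model_self hM') ci ?tau_shift //.
  rewrite S_entry_sig // similitude_kappa -/k -/q' /Sdiag.
  have -> : (loc' i == loc' j) = (i == j).
    by apply/eqP/eqP => [|-> //]; apply: (model_inj hM'); rewrite ci.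
  case: ifP => _; last by rewrite mulr0.
  by rewrite /eps; case: ifP => _; rewrite ?mulr1 ?scale1r ?mulrN1 ?scaleN1r.
have FE a b : cls a == y -> cls b == y ->
    F a b = if a == b then eps q (loc a) *: X t else 0.
  move=> /eqP ca /eqP cb; rewrite (model_self hM) ca //.
  rewrite S_entry_sig // -/k -/q /Sdiag.
  have -> : (loc a == loc b) = (a == b).
    by apply/eqP/eqP => [|-> //]; apply: (model_inj hM); rewrite ca.
  case: ifP => _; last by rewrite mulr0.
  by rewrite /eps; case: ifP => _; rewrite ?mulr1 ?scale1r ?mulrN1 ?scaleN1r.
have gram a b : a \in A -> b \in A ->
    \sum_(i in B) phi0 (W i a) * (eps q' (loc' i) *: W i b) =
    if a == b then (mu * eps q (loc a))%:A else 0.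
  rewrite !inE => ca cb.
  have lhs : (star U *m F' *m U) a b = (r1^-1 *~ eta u) *:
      (X (t + h) * \sum_(i in B) phi0 (W i a) * (eps q' (loc' i) *: W i b)).
    rewrite mxE (bigID (fun j => cls' j == x)) /= [X in _ + X]big1 ?addr0;
      last first.
      move=> j /negPf nj; have [->|/(graded_mx_class gU)] := eqVneq (U j b) 0.
        by rewrite mulr0.
      by rewrite (eqP cb) => E; rewrite E eqxx in nj.
    rewrite mulr_sumr scaler_sumr; apply: eq_big => [j|j cj];
      first by rewrite inE.
    rewrite mxE (bigD1 j) //= [X in _ + X]big1 ?addr0; last first.
      move=> i ij; have [Ui|/(graded_mx_class gU) ci] := eqVneq (U i a) 0.
        by rewrite !mxE Ui raddf0 mul0r.
      by rewrite F'E ?(negPf ij) ?mulr0 // ci (eqP ca).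
    rewrite !mxE F'E // eqxx !UW // phi0M phi0Xinv //.
    transitivity ((eps q' (loc' j) *~ eta u) *: (phi0 (W j a) *
        ((X u)^-1 * X (t + h + u *+ 2) * (X u)^-1) * W j b)).
      rewrite mulrzAr mulrzAl mulrzAl -scalerAr -scalerAl scalerMzl !mulrA.
      by case: eta1 => ->; rewrite ?mulrNz ?mulr1z.
    rewrite E1' -!scalerAr -!scalerAl.
    rewrite -(X1c _ (hdeg (W0 j a))) !scalerA -!mulrA; congr (_ *: _).
    by case: eta1 => ->; rewrite ?mulrNz !mulr1z; ring.
  have rhs : (star U *m F' *m U) a b =
      if a == b then (r2 * r3 * eps q (loc a)) *: X (t + h) else 0.
    rewrite iso !mxE FE //; case: eqP => _; last by rewrite raddf0 mulr0.
    rewrite linearZ /= E3 scalerA -scalerAr [c * _]cZ E2 scalerA;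
      congr (_ *: _); ring.
  have r1e : r1^-1 *~ eta u != 0.
    by case: eta1 => ->; rewrite ?mulrNz ?oppr_eq0 mulr1z invr_neq0.
  apply: (mulrI u1); apply: (scalerI r1e); rewrite -lhs rhs; case: eqP => _.
    rewrite -scalerAr mulr1 scalerA; congr (_ *: _); rewrite /mu.
    by case: eta1 => ->; rewrite ?mulrNz !mulr1z; field.
  by rewrite mulr0 scaler0.
have cA (P : pred nat) (e : 'I_n -> R) : (forall a, (0 < e a) = P (loc a)) ->
    #|[set a in A | (0 < e a)%R]| = #|[set l : 'I_k | P l]|.
  move=> eP; rewrite -(model_card y P hM); apply: eq_card => a.
  by rewrite !inE eP.
have cB (P : pred nat) (e : 'I_n' -> R) : (forall i, (0 < e i) = P (loc' i)) ->
    #|[set i in B | (0 < e i)%R]| = #|[set l : 'I_k | P l]|.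
  move=> eP; rewrite /k -similitude_kappa -(model_card x P hM').
  by apply: eq_card => i; rewrite !inE eP.
have le1 := inertia W0 gram.
have gramN a b : a \in A -> b \in A ->
    \sum_(i in B) phi0 (W i a) * ((- eps q' (loc' i)) *: W i b) =
    if a == b then (- (mu * eps q (loc a)))%:A else 0.
  move=> aA bA; under eq_bigr do rewrite scaleNr mulrN.
  by rewrite sumrN gram //; case: ifP; rewrite ?oppr0 // scaleNr.
have le2 := inertia W0 gramN.
have epsP r l : ((0 < eps r l) = (l < r)%N) * ((0 < - eps r l) = ~~ (l < r)%N).
  by rewrite /eps; case: ifP; rewrite ?oppr_gt0 ?opprK ?ltr01 ?ltr10 ?ltrN10
    ?oppr_lt0 ?ltr0N1.
rewrite (cB (fun l => l < q')%N) in le1; last by move=> i; rewrite epsP.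
rewrite (cB (fun l => ~~ (l < q')%N)) in le2; last by move=> i; rewrite epsP.
rewrite card_ord_lt // in le1; rewrite card_ord_ge // in le2.
(* A negative [mu] exchanges the positive and negative indices of the source form. *)
case: (sgz_pm mu_neq0) => -[mu_sign ->].
  rewrite (cA (fun l => l < q)%N) ?card_ord_lt // in le1; last first.
    by move=> a; rewrite pmulr_rgt0 // epsP.
  rewrite (cA (fun l => ~~ (l < q)%N)) ?card_ord_ge // in le2; last first.
    by move=> a; rewrite -mulrN pmulr_rgt0 // epsP.
  by rewrite sE sE' mul1r; exact: signature_eq.
rewrite (cA (fun l => ~~ (l < q)%N)) ?card_ord_ge // in le1; last first.
  by move=> a; rewrite nmulr_rgt0 // -oppr_gt0 epsP.
rewrite (cA (fun l => l < q)%N) ?card_ord_lt // in le2; last first.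
  by move=> a; rewrite -mulrN nmulr_rgt0 // oppr_lt0 epsP.
by rewrite sE sE' mulN1r; exact: signature_opp.
Qed.

End SimilitudeSign.

Lemma sigma_nsig p y : paramX Dg delta kind eta xi p ->
  ~ sig (tau xi (p_g p) y) -> p_sigma p y = 0.
Proof. by case=> _ /(_ y)[_ _ +] nst; apply=> /supp_sig. Qed.

Lemma acted_sigma g c h (psi : {lrmorphism D -> D}) p y :
  p_sigma (actG X eta xi g (actC X xi c h (actA X xi psi p))) (y + pi g) =
  orbit_sign psi c h (xi (y + pi g) - g - xi y) (tau xi (p_g p) y)
    * p_sigma p y.
Proof.
rewrite /= /orbit_sign addrK -!mulrA; congr (_ * (rsign _ * _)).
by rewrite /tau ![p_g p + h + _]addrAC.
Qed.

Lemma same_orbit_of_similitude p p' n n' (cls : 'I_n -> {quot T}) loc F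
    (cls' : 'I_n' -> {quot T}) loc' F' g c h psi U V :
  paramX Dg delta kind eta xi p -> paramX Dg delta kind eta xi p' ->
  model p cls loc F -> model p' cls' loc' F' ->
  groupC Dg phi0 c h -> groupA Dg T phi0 kind X nu psi ->
  p_g p' = p_g p + h - g *+ 2 -> similitude cls F cls' F' g c psi U V ->
  same_orbit Dg phi0 kind X eta xi nu p p'.
Proof.
move=> hp hp' hM hM' cC psiA hg hU; have psiG := groupA_phi0 psiA.
exists g, c, h, psi; split=> //.
have kE : p_kappa p' = p_kappa (actG X eta xi g (actC X xi c h (actA X xi psi
  p))).
  apply/funext => x /=.
  by have := similitude_kappa hM hM' hU (x - pi g); rewrite subrK.
have sE : p_sigma p' = p_sigma (actG X eta xi g (actC X xi c h (actA X xi psi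
  p))).
  apply/funext => x; rewrite -[x](subrK (pi g)); move: (x - pi g) => y.
  rewrite acted_sigma; have [st|nst] := pselect (sig (tau xi (p_g p) y)).
    by have := similitude_sigma hp hp' hM hM' cC psiG hg hU st.
  rewrite (sigma_nsig hp nst) mulr0; apply: (sigma_nsig hp') => st'; apply: nst.
  apply/(transport_sig _ psiG cC (similitude_shift g y)).
  by rewrite -(tau_shift hg).
by case: p' hg kE sE {hp' hM' hU} => g' k' s' /= -> -> ->.
Qed.

(** * From an isomorphism of the algebras to a common orbit *)

Section Malg.
Variables (p p' : param T) (m r m' r' : nat).
Variables (x : 'I_(m + r.*2) -> {quot T}) (x' : 'I_(m' + r'.*2) -> {quot T}).
Hypothesis hp : paramX Dg delta kind eta xi p.
Hypothesis hp' : paramX Dg delta kind eta xi p'.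
Hypothesis hx : enumeration p x.
Hypothesis hx' : enumeration p' x'.

Lemma M_compP q ms rs (z : 'I_(ms + rs.*2) -> {quot T}) h
    (A : 'M[D]_(\sum_(i < ms + rs.*2) p_kappa q (z i))) :
  M_comp Dg xi h A <->
  graded_mx (fun a => xi (z (tagnat.sig1 a)) - h)
    (fun a => xi (z (tagnat.sig1 a))) A.
Proof.
split=> [gA a b|gA i j a b].
  have := gA (tagnat.sig1 a) (tagnat.sig1 b) (tagnat.sig2 a) (tagnat.sig2 b).
  rewrite mxE !tagnat.sig2K; congr Dg; zmod.
rewrite mxE; have := gA (tagnat.Rank i a) (tagnat.Rank j b).
by rewrite !tagnat.Rank1K; congr Dg; zmod.
Qed.

Lemma Phi_invP q ms rs (z : 'I_(ms + rs.*2) -> {quot T}) :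
  paramX Dg delta kind eta xi q -> enumeration q z ->
  let P := Phi Dg delta kind X eta xi iu q z in
  let Q := Phi_inv Dg delta kind X eta xi iu q z in
  Q *m P = 1%:M /\ P *m Q = 1%:M.
Proof.
move=> hq hz; have [Fi FiE] := model_inverse hq (model_Phi hq hz).
rewrite /= /Phi_inv; case: xgetP => [A -> //|/(_ Fi)[]].
exact: FiE.
Qed.

Lemma same_orbit_of_iso :
  ginvAlg_iso (Malg Dg phi0 delta kind X eta xi iu p x)
    (Malg Dg phi0 delta kind X eta xi iu p' x') ->
  same_orbit Dg phi0 kind X eta xi nu p p'.
Proof.
case=> f [fbij fZ fdeg fphi].
have hM := model_Phi hp hx; have hM' := model_Phi hp' hx'.
have [g [c [h [psi [U [V [cC psiA hg hU]]]]]]] :=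
  @similitude_of_iso p p' _ _ _ _ _ _ _ _ _ _ hp hp' hM hM' (Phi_invP hp hx)
   (Phi_invP hp' hx') f (rmorphD f) (rmorphM f) (rmorph1 f) fZ fbij
   (fun h A => iff_trans (iff_sym (M_compP h A)) (iff_trans (fdeg h A)
     (M_compP h (f A))))
   fphi.
exact: same_orbit_of_similitude hp hp' hM hM' cC psiA hg hU.
Qed.

End Malg.

(** * From a common orbit to a similitude *)

Section SimilitudeOfOrbit.
Variables (p : param T) (n n' : nat).
Variables (g : G) (c : D) (h : G) (psi : {lrmorphism D -> D}).
Local Notation p' := (actG X eta xi g (actC X xi c h (actA X xi psi p))).
Variables (cls : 'I_n -> {quot T}) (loc : 'I_n -> nat) (F : 'M[D]_n).
Variables (cls' : 'I_n' -> {quot T}) (loc' : 'I_n' -> nat) (F' : 'M[D]_n').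
Hypothesis hp : paramX Dg delta kind eta xi p.
Hypothesis hM : model p cls loc F.
Hypothesis hM' : model p' cls' loc' F'.
Hypothesis cC : groupC Dg phi0 c h.
Hypothesis psi_A : groupA Dg T phi0 kind X nu psi.

Let psiA : graded_aut psi := groupA_phi0 psi_A.

Local Notation shift y := (xi (y + pi g) - g - xi y).
Local Notation sgn y := (orbit_sign psi c h (shift y) (tau xi (p_g p) y)).

Let kappaE y : p_kappa p' (y + pi g) = p_kappa p y.
Proof. by rewrite /= addrK. Qed.

Let tauE y : tau xi (p_g p') (y + pi g) =
  tau xi (p_g p) y + h + shift y *+ 2.
Proof. exact: tau_shift. Qed.

Let sigE y : sig (tau xi (p_g p') (y + pi g)) <-> sig (tau xi (p_g p) y).
Proof. by rewrite tauE -(transport_sig _ psiA cC (similitude_shift g y)). Qed.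

Let tauT y : tau xi (p_g p') (y + pi g) \in T <-> tau xi (p_g p) y \in T.
Proof.
rewrite tauE; have uT := similitude_shift g y; have h_T := groupC_T cC.
split=> tT; last by apply: TD; [exact: TD|rewrite mulr2n; exact: TD].
have -> : tau xi (p_g p) y = tau xi (p_g p) y + h + shift y *+ 2
    - shift y - shift y - h by zmod.
by do 3!(apply: TD; last exact: TN).
Qed.

Let altE' y : alt (tau xi (p_g p') (y + pi g)) <-> alt (tau xi (p_g p) y).
Proof.
split=> [/[dup] at_ [/tauT tT _]|/[dup] at_ [tT _]].
  by apply/(transport_alt psiA cC (similitude_shift g y) tT); rewrite -tauE.
by rewrite tauE; apply/(transport_alt psiA cC (similitude_shift g y) tT).
Qed.

Let sgn_pm y : sig (tau xi (p_g p) y) -> sgn y = 1 \/ sgn y = -1.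
Proof.
move=> st; have uT := similitude_shift g y.
have [r1 [r2 [r3 [[r1n r2n r3n] _ ->]]]] := orbit_factors psiA cC uT st.
have rn : r1 * r2 * r3 != 0 by rewrite !mulf_neq0.
by case: (eta_pm uT) => ->; case: (sgz_pm rn) => -[_ ->];
  rewrite ?mul1r ?mulN1r ?opprK; auto.
Qed.

(* Reversing the order exchanges the two parts of [diag(I, -I)].              *)
Let flip y l :=
  if `[< sig (tau xi (p_g p) y) /\ sgn y = -1 >] then (p_kappa p y - l.+1)%N
    else l.

Let flip_lt y l : (l < p_kappa p y)%N -> (flip y l < p_kappa p y)%N.
Proof. by rewrite /flip; case: ifP => _ //; lia. Qed.

Let flipK y l : (l < p_kappa p y)%N -> flip y (flip y l) = l.
Proof. by rewrite /flip; case: asboolP => _ //; lia. Qed.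

Let reindex : exists s : 'I_n -> 'I_n', bijective s /\
  forall a, cls' (s a) = cls a + pi g /\ loc' (s a) = flip (cls a) (loc a).
Proof.
have /choice[s sP] a : exists i,
  cls' i = cls a + pi g /\ loc' i = flip (cls a) (loc a).
  by apply: (model_surj hM'); rewrite kappaE flip_lt // (model_lt hM).
have /choice[s' s'P] i : exists a, cls a = cls' i - pi g /\
    loc a = flip (cls' i - pi g) (loc' i).
  apply: (model_surj hM); apply: flip_lt.
  by have := model_lt hM' i; rewrite /=.
exists s; split=> //; exists s' => [a|i].
  have [c1 l1] := sP a; have [c2 l2] := s'P (s a).
  rewrite c1 addrK in c2 l2; apply: (model_inj hM) => //.
  by rewrite l2 l1 flipK // (model_lt hM).
have [c1 l1] := s'P i; have [c2 l2] := sP (s' i).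
rewrite c1 subrK in c2; apply: (model_inj hM') => //.
by rewrite l2 l1 c1 flipK //; have := model_lt hM' i; rewrite /=.
Qed.

(** Reversal occurs only in blocks of type [sig], whose pairing is diagonal and so survives it. *)
Let linkedE y z k l : (k < p_kappa p y)%N -> (l < p_kappa p z)%N ->
  linked p' (y + pi g) (z + pi g) (flip y k) (flip z l) <-> linked p y z k l.
Proof.
move=> ky lz; have sumE : (y + pi g + (z + pi g) = - pi (p_g p')) <-> (y + z =
  - pi (p_g p)).
  rewrite !degree_inT -/(shift y) -/(shift z).
  have -> : p_g p' + xi (y + pi g) + xi (z + pi g) =
    p_g p + xi y + xi z + h + shift y + shift z by rewrite /=; zmod.
  have h_T := groupC_T cC.
  have yT := similitude_shift g y; have zT := similitude_shift g z.
  split=> tT; last by do 3!(apply: TD => //).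
  have -> : p_g p + xi y + xi z = p_g p + xi y + xi z + h + shift y + shift z
    - shift z - shift y - h by zmod.
  by do 3!(apply: TD; last exact: TN).
have flip_n y0 l0 : tau xi (p_g p) y0 \notin T -> flip y0 l0 = l0.
  by move=> tT; rewrite /flip asboolF // => -[[]]; rewrite (negPf tT).
rewrite /linked kappaE (asbool_equiv_eq (altE' y)) sumE.
have [sum|nsum] := pselect (y + z = - pi (p_g p)); last by split=> -[].
have [tT|tT] := boolP (tau xi (p_g p) y \in T); last first.
  rewrite !flip_n //; apply: contra tT => /self_pair zz; apply/self_pair.
  suff -> : y = z by [].
  by apply: (addIr z); rewrite sum zz.
have zy : z = y by apply: (addrI y); rewrite sum; apply/esym/self_pair.
rewrite {}zy in lz *; case: asboolP => [at_|nat_].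
  have nst := alt_nsig at_.
  by rewrite /flip !asboolF // => -[].
split=> -[? E]; split=> //; last by rewrite E.
by move: E => /(congr1 (flip y)); rewrite !flipK.
Qed.

(** Negating the signature exchanges the numbers of [1] and [-1], and reversing the positions sends
    each entry to one of opposite sign. *)
Let Sdiag_sgn y l : sig (tau xi (p_g p) y) -> (l < p_kappa p y)%N ->
  (flip y l < absz (((p_kappa p y)%:Z + sgn y * p_sigma p y) %/ 2)%Z)%N =
  ((l < absz (((p_kappa p y)%:Z + p_sigma p y) %/ 2)%Z)%N == (sgn y == 1)).
Proof.
move=> st ly; have [sk sm] : (absz (p_sigma p y) <= p_kappa p y)%N /\
    (p_sigma p y = (p_kappa p y)%:Z %[mod 2])%Z.
  by case: hp => _ /(_ y)[? sm _]; split=> //; apply: sm; exact/supp_sig.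
rewrite /flip; move: (p_kappa p y) (p_sigma p y) (sgn_pm st) ly sk sm => k s.
move: (sgn y) => e [] -> ly sk sm; last first.
  by rewrite asboolT // eqbF_neg; move: ly sk sm; clear; lia.
by rewrite asboolF => [|[]//]; rewrite mul1r eqb_id.
Qed.

(** The isometry equation for a row paired with itself. In type [sig] it reduces to a real equation
    solved by a real square root; over C outside K a complex square root serves; over H a real
    factor of [iu] is absorbed by [De_H_rescale]. *)
Let fixed_weight a i : cls' i = cls a + pi g ->
  loc' i = flip (cls a) (loc a) -> F a a != 0 ->
  exists w, [/\ Dg (- shift (cls a)) w, w != 0 &
    phi0 w * F' i i * w = c * psi (F a a)].
Proof.
set y := cls a => ci li Faa; have uT := similitude_shift g y.
have [ch c0 cZ phic] := cC; have [_ psiD _] := psiA.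
have uX := Xu uT; set u := shift y in uT uX *; set t := tau xi (p_g p) y.
have tT : t \in T by case/(model_neq0 hM): Faa => /self_pair.
have t'T : tau xi (p_g p') (cls' i) \in T by rewrite ci; apply/tauT.
have FE := model_self hM tT erefl; have F'E := model_self hM' t'T erefl.
rewrite -/y -/t in FE; rewrite ci tauE kappaE acted_sigma li -/u -/t -/y in F'E.
have weight z w : Dg 0 z -> z != 0 -> w = (X u)^-1 * z ->
    [/\ Dg (- u) w, w != 0 &
      phi0 w = phi0 z * ((X u)^-1 *~ eta u)].
  move=> z0 zn ->; split; last by rewrite phi0M phi0Xinv.
    by apply: (DgMe _ (Xinv uT) z0); rewrite addr0.
  by apply: (DgM_neq0 (Xinv uT) z0) => //; exact: inv_neq0.
have [st|nst] := pselect (sig t).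
  have st' : sig (t + h + u *+ 2) by rewrite -tauE; apply/sigE.
  have [r1 [r2 [r3 [[r1n r2n r3n] [E1 E2 E3] sgnE]]]] :=
    orbit_factors psiA cC uT st.
  have rn : r1 * r2 * r3 != 0 by rewrite !mulf_neq0.
  pose rho := r1 * r2 * r3 *~ eta u.
  pose q := absz (((p_kappa p y)%:Z + p_sigma p y) %/ 2)%Z.
  pose e := eps q (loc a).
  pose q' := absz (((p_kappa p y)%:Z + sgn y * p_sigma p y) %/ 2)%Z.
  pose e' := eps q' (flip y (loc a)).
  have epsE r l k : X k * Sdiag D r l l = eps r l *: X k.
    by rewrite /Sdiag eqxx /eps; case: ifP => _;
      rewrite ?mulr1 ?scale1r ?mulrN1 ?scaleN1r.
  rewrite S_entry_sig // epsE -/q -/e in FE.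
  rewrite S_entry_sig // epsE -/(sgn y) -/q' -/e' in F'E.
  have rhon : rho != 0.
    by rewrite /rho; case: (eta_pm uT) => ->; rewrite ?mulrNz ?oppr_eq0 mulr1z.
  have sgnE' : sgn y = sgz rho.
    rewrite [LHS]sgnE /rho; case: (eta_pm uT) => ->;
    by rewrite ?mulrNz mulr1z ?sgzN ?mulN1r ?mul1r.
  (* The sign of [rho] is absorbed by [flip], so only its absolute value needs a square root. *)
  have e'E : `|rho| * e' = e * rho.
    rewrite /e' /e /eps Sdiag_sgn ?(model_lt hM) // -/q sgnE'.
    case: (sgz_pm rhon) => -[rs ->].
      by rewrite eqxx eqb_id gtr0_norm // mulrC.
    rewrite (_ : (-1 == 1 :> int) = false) // eqbF_neg if_neg ltr0_norm //.
    by case: ifP => _; ring.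
  have w_neq0 : (Num.sqrt `|rho|)%:A != 0 :> D.
    by rewrite scaler_eq0 oner_eq0 orbF sqrtr_eq0 -ltNge normr_gt0.
  have [wD wn wphi] := weight _ _ (DgZ (Num.sqrt `|rho|) Dg1) w_neq0 erefl.
  exists ((X u)^-1 * (Num.sqrt `|rho|)%:A); split=> //.
  have X1u : X (t + h) \is a GRing.unit by rewrite Xu // TD // (groupC_T cC).
  have E1' : (X u)^-1 * X (t + h + u *+ 2) * (X u)^-1 = r1^-1 *: X (t + h).
    apply: (mulrI uX); apply: (mulIr uX);
      rewrite !mulrA divrr // mul1r divrK //.
    by rewrite -scalerAr -scalerAl E1 scalerA mulVf // scale1r.
  rewrite wphi FE F'E !linearZ /= phi01 E3.
  rewrite !(mulrzAr, mulrzAl) -!(scalerAr, scalerAl) !mulr1 mul1r E1'.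
  rewrite [c * _]cZ E2 !scalerA scalerMzl; congr (_ *: _).
  have sqE : Num.sqrt `|rho| * Num.sqrt `|rho| = `|rho|.
    by rewrite -expr2 sqr_sqrtr.
  rewrite -[e' * _ * _]mulrA sqE [e' * _]mulrC.
  rewrite e'E /rho; case: (eta_pm uT) => ->; rewrite ?mulrNz !mulr1z;
    field => //.
have nat_ : ~ alt t.
  move=> at_; have := proj1 (model_neq0 hM a a) Faa => -[_]; rewrite asboolT //.
  have := alt_even hp at_; have := model_lt hM a; rewrite -/y; lia.
have [s0 [s0t SE]] := S_entry_scalar tT nst nat_.
have nst' : ~ sig (t + h + u *+ 2) by rewrite -tauE => /sigE.
have nat' : ~ alt (t + h + u *+ 2) by rewrite -tauE => /altE'.
have t'T' : t + h + u *+ 2 \in T by rewrite -tauE; apply/tauT.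
have [s0' [s0't SE']] := S_entry_scalar t'T' nst' nat'.
have Sid1 l : Sid D l l = 1 by rewrite /Sid eqxx.
rewrite SE Sid1 mulr1 in FE; rewrite SE' Sid1 mulr1 in F'E.
(* [Y] has the degree of [c * psi (X t)], so the two differ by a factor [z1] of degree 0, which the
   weight must account for. *)
pose Y := ((X u)^-1 *~ eta u) * X (t + h + u *+ 2) * (X u)^-1.
have Yg : Dg (t + h) Y.
  by apply: (DgMe _ (DgM (DgMz _ (Xinv uT)) (Xg t'T')) (Xinv uT)); zmod.
have Y0 : Y != 0.
  apply: unit_neq0; rewrite /Y !unitrMl ?unitrV ?Xu //.
  by case: (eta_pm uT) => ->; rewrite ?mulrNz ?unitrN mulr1z unitrV.
have uY := Dg_unit Yg Y0.
have Qg : Dg (t + h) (c * psi (X t)).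
  by apply: (DgMe _ ch (psiD _ _ (Xg tT))); rewrite addrC.
have Q0 : c * psi (X t) != 0.
  apply: (DgM_neq0 ch (psiD _ _ (Xg tT))) => //.
  by apply: rmorph_unit_neq0 (Xg tT) (X0 tT).
pose z1 := Y^-1 * (c * psi (X t)).
have z1g : Dg 0 z1 by apply: (DgMe _ (Dg_inv Yg Y0) Qg); rewrite addNr.
have z1n : z1 != 0.
  by apply: (DgM_neq0 (Dg_inv Yg Y0) Qg) => //; exact: inv_neq0.
have QE : c * psi (X t) = Y * z1 by rewrite mulVKr.
clearbody z1.
case: s0t s0't => [[kC [tK [s0E _]]] [[_ [_ [s0'E _]]]|[kH]]|[kH [s0E _]]
  [[kC]|[_ [s0'E _]]]];
  try by rewrite kC in kH.
- have [z zg zE] := De_C_sqrt kC z1g.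
  have z0 : z != 0 by apply: contraNneq z1n => z0; rewrite -zE z0 mul0r.
  have [wD wn wphi] := weight _ _ zg z0 erefl.
  exists ((X u)^-1 * z); split=> //.
  have t1K : ~~ inK Dg T kind (t + h).
    apply/negP => /(inKP _ kC) st1; apply: nst;
      apply/(transport_sig t psiA cC T0).
    by rewrite mul0rn addr0.
  have t1T : t + h \in T by rewrite TD // (groupC_T cC).
  rewrite wphi F'E s0'E FE s0E !mulr1 QE -zE.
  rewrite (mulrA Y) (De_C_conj kC t1T t1K Yg zg) /Y; by rewrite !mulrA.
- have [iu0 _] := hiu kH; have iun := iu_neq0 kH.
  have Xcom s e : s \in T -> Dg 0 e -> e * (X s)^-1 = (X s)^-1 * e.
    move=> sT e0; case: (hX sT) => _ _ /(_ kH) Xc _.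
    by apply: (mulrI (Xu sT)); rewrite !mulrA Xc // mulrK ?divrr ?mul1r ?Xu.
  have psi_fix e : Dg 0 e -> psi e = e.
    by case: psi_A => _ _ + _; apply=> -[]; rewrite kH.
  have Xtc s : s \in T -> commutes_De Dg (X s).
    by move=> sT; case: (hX sT) => _ _ /(_ kH).
  have Yc : commutes_De Dg Y.
    move=> e e0; rewrite /Y -[LHS]mulrA -(Xcom _ _ uT e0) !mulrA; congr (_ * _).
    rewrite -[LHS]mulrA (Xtc _ t'T' e e0) !mulrA; congr (_ * _).
    by rewrite mulrzAl mulrzAr Xcom.
  have Qc : commutes_De Dg (c * psi (X t)).
    move=> e e0; rewrite -mulrA (proj2 (aut_commutes psiA _) (Xtc _ tT) e e0).
    by rewrite !mulrA cZ.
  have z1c e : Dg 0 e -> z1 * e = e * z1.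
    move=> e0; apply: (mulrI uY); rewrite !mulrA -QE (Yc e e0) -[RHS]mulrA -QE.
    exact: Qc.
  have [mu muE] := De_H_center kH z1g z1c.
  have mun : mu != 0 by apply: contraNneq z1n => mu0; rewrite muE mu0 scale0r.
  have [z zg zE] := De_H_rescale kH mun.
  have z0 : z != 0.
    apply/eqP => z0; move/eqP: zE; rewrite z0 mulr0 eq_sym scaler_eq0.
    by rewrite (negPf mun) (negPf iun).
  have [wD wn wphi] := weight _ _ zg z0 erefl.
  exists ((X u)^-1 * z); split=> //.
  rewrite wphi F'E s0'E FE s0E.
  have psiM e e2 : psi (e * e2) = psi e * psi e2 by exact: rmorphM.
  rewrite psiM (psi_fix iu) // [RHS]mulrA QE muE -[RHS]mulrA -scalerAl mul1r
    -zE.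
  rewrite -[phi0 z * iu * z]mulrA [RHS]mulrA (Yc _ (hdeg zg)) /Y !mulrA.
  by congr (_ * z); rewrite -[LHS]mulrA (Xcom _ _ uT iu0) !mulrA.
Qed.

(** The nonzero entries pair the rows by the involution [io], and [reindex] respects the pairing, so
    a monomial [U] with weights [w] leaves one equation per pair. For two distinct rows the weight
    of the smaller is [w0] and the other is solved for; the remaining rows use [fixed_weight]. *)
Lemma similitude_of_orbit : exists U V, similitude cls F cls' F' g c psi U V.
Proof.
have [s [sb sP]] := reindex; have [s_inv sK s_invK] := sb.
have [ch c0 cZ phic] := cC; have [_ psiD psiphi] := psiA.
have F'_neq0 a b : F' (s a) (s b) != 0 <-> F a b != 0.
  have [ca la] := sP a; have [cb lb] := sP b.
  rewrite (model_neq0 hM) (model_neq0 hM') ca la cb lb.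
  by apply: linkedE; exact: (model_lt hM).
have /choice[io ioP] := model_partner hp hM.
have ioE a b : F a b != 0 -> io a = b
    by exact: (model_partner_uniq hp hM (ioP a)).
have ioK a : io (io a) = a by apply: ioE; rewrite (model_sym hM).
have uT a : shift (cls a) \in T := similitude_shift g (cls a).
pose w0 a := (X (shift (cls a)))^-1.
have w0g a : Dg (- shift (cls a)) (w0 a) := Xinv (uT a).
have w0n a : w0 a != 0 by apply: inv_neq0; exact: Xu.
have /choice[w1 w1P] a : exists w, F a a != 0 ->
    [/\ Dg (- shift (cls a)) w, w != 0 &
      phi0 w * F' (s a) (s a) * w = c * psi (F a a)].
  have [Faa|Faa] := boolP (F a a != 0); last by exists 0.
  have [ca la] := sP a; have [w wP] := fixed_weight ca la Faa.
  by exists w.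
pose B a := phi0 (w0 a) * F' (s a) (s (io a)).
pose w a := if io a == a then w1 a else
  if (a < io a)%N then w0 a else (B (io a))^-1 * (c * psi (F (io a) a)).
have Bg a : Dg (- shift (cls a) + (p_g p' + xi (cls a + pi g) + xi (cls (io a)
  + pi g))) (B a).
  have [ca _] := sP a; have [cb _] := sP (io a).
  by have := DgM (hdeg (w0g a)) (model_Dg hM' (s a) (s (io a))); rewrite ca cb.
have Bn a : B a != 0.
  apply: (DgM_neq0 (hdeg (w0g a)) (model_Dg hM' _ _)); last exact/F'_neq0.
  by apply: unit_neq0; apply: phi0_unit; exact: (Dg_unit (w0g a)).
have wP a : Dg (- shift (cls a)) (w a) /\ w a != 0.
  rewrite /w; case: eqP => [ia|ia].
    by have [] := w1P a; first by rewrite -{2}ia.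
  case: ifP => _ //; have Fba : F (io a) a != 0 by rewrite (model_sym hM).
  have gQ := DgM ch (psiD _ _ (model_Dg hM (io a) a)).
  have gV := Dg_inv (Bg (io a)) (Bn (io a)); split.
    by apply: (DgMe _ gV gQ); rewrite ioK /=; zmod.
  apply: (DgM_neq0 gV gQ); first by apply: inv_neq0;
    exact: Dg_unit (Bg _) (Bn _).
  apply: (DgM_neq0 ch (psiD _ _ (model_Dg hM _ _))) => //.
  exact: rmorph_unit_neq0 (model_Dg hM _ _) Fba.
have weq_lt a b : F a b != 0 -> (a < b)%N ->
    phi0 (w a) * F' (s a) (s b) * w b = c * psi (F a b).
  move=> Fab ab; have ia := ioE _ _ Fab.
  have ib : io b = a by rewrite -ia ioK.
  have -> : w a = w0 a by rewrite /w ia ab; case: eqP => // ba;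
    rewrite ba ltnn in ab.
  have -> : w b = (B a)^-1 * (c * psi (F a b)).
    rewrite /w ib; case: eqP => [ba|_]; first by rewrite ba ltnn in ab.
    by rewrite ltnNge (ltnW ab).
  by rewrite /B ia mulVKr //; have := Dg_unit (Bg a) (Bn a); rewrite /B ia.
have weq a b : phi0 (w a) * F' (s a) (s b) * w b = c * psi (F a b).
  have [Fab|Fab] := eqVneq (F a b) 0.
    have -> : F' (s a) (s b) = 0.
      by apply/eqP; apply: contraT => /F'_neq0; rewrite Fab eqxx.
    by rewrite Fab raddf0 mulr0 mul0r mulr0.
  (* Both forms being [delta]-hermitian, [phi0] exchanges the equations at [(a, b)] and [(b, a)]. *)
  case: (ltngtP a b) => [ab|ba|/val_inj ab]; first exact: weq_lt.
    have Fba : F b a != 0 by rewrite (model_sym hM).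
    have := congr1 phi0 (weq_lt b a Fba ba); rewrite !phi0M phi0K phic psiphi.
    rewrite (model_herm hM) (model_herm hM') raddfMz /= mulrA -cZ.
    by case: hdelta => ->; rewrite ?mulrNz !mulr1z ?mulrN ?mulNr // =>
      /oppr_inj.
  subst b; rewrite /w (ioE _ _ Fab) eqxx.
  by case: (w1P a Fab).
pose U : 'M[D]_(n', n) := \matrix_(i, a) if i == s a then w a else 0.
pose V : 'M[D]_(n, n') := \matrix_(a, i) if i == s a then (w a)^-1 else 0.
have wu a : w a \is a GRing.unit by have [wg wn] := wP a; exact: Dg_unit wg wn.
exists U, V; split.
- split; apply/matrixP => a b; rewrite !mxE.
    rewrite (bigD1 (s a)) //= big1 ?addr0 => [|i ia]; last first.
      by rewrite !mxE (negPf ia) mul0r.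
    rewrite !mxE eqxx (inj_eq (bij_inj sb)); case: eqP => [->|_];
      first by rewrite mulVr.
    by rewrite mulr0.
  rewrite (bigD1 (s_inv a)) //= big1 ?addr0 => [|i ia]; last first.
    rewrite !mxE -(inj_eq (can_inj s_invK)) sK eq_sym (negPf ia) mul0r //.
  rewrite !mxE s_invK eqxx [b == a]eq_sym; case: eqP => [_|_];
    first by rewrite divrr.
  by rewrite mulr0.
- move=> i a; rewrite mxE; case: eqP => [->|_]; last exact: Dg0.
  have [ca _] := sP a; have [wg _] := wP a; rewrite ca.
  by move: wg; congr Dg; zmod.
- move=> a i; rewrite mxE; case: eqP => [->|_]; last exact: Dg0.
  have [ca _] := sP a; have [wg wn] := wP a; rewrite ca.
  by move: (Dg_inv wg wn); congr Dg; zmod.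
- apply/matrixP => a b; rewrite mxE (bigD1 (s b)) //= big1 ?addr0 => [|i ib];
    last first.
    by rewrite [U i b]mxE (negPf ib) mulr0.
  rewrite mxE (bigD1 (s a)) //= big1 ?addr0 => [|i ia]; last first.
    by rewrite !mxE (negPf ia) raddf0 mul0r.
  by rewrite !mxE !eqxx weq.
Qed.

End SimilitudeOfOrbit.

(** * From a similitude to an isomorphism of the algebras *)

Section IsoOfSimilitude.
Variables (p p' : param T) (n n' : nat).
Variables (cls : 'I_n -> {quot T}) (P Q : 'M[D]_n).
Variables (cls' : 'I_n' -> {quot T}) (P' Q' : 'M[D]_n').
Hypothesis hQ : Q *m P = 1%:M /\ P *m Q = 1%:M.
Hypothesis hQ' : Q' *m P' = 1%:M /\ P' *m Q' = 1%:M.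
Variables (g : G) (c : D) (h : G) (psi : {lrmorphism D -> D}).
Variables (U : 'M[D]_(n', n)) (V : 'M[D]_(n, n')).
Hypothesis cC : groupC Dg phi0 c h.
Hypothesis psiA : graded_aut psi.
Hypothesis hU : similitude cls P cls' P' g c psi U V.

Definition similitude_iso (A : 'M[D]_n) : 'M[D]_n' := U *m map_mx psi A *m V.

Lemma similitude_isoM A B :
  similitude_iso (A *m B) = similitude_iso A *m similitude_iso B.
Proof.
have [[VU UV] _ _ _] := hU; rewrite /similitude_iso map_mxM /= !mulmxA.
by rewrite -[_ *m V *m U]mulmxA VU mulmx1.
Qed.

Lemma similitude_iso_bij : bijective similitude_iso.
Proof.
have [[VU UV] _ _ _] := hU; have [[psi' psiK psi'K] _ _] := psiA.
exists (fun B => map_mx psi' (V *m B *m U)) => A; rewrite /similitude_iso.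
  apply/matrixP => i j; rewrite mxE !mulmxA VU mul1mx -mulmxA VU mulmx1.
  by rewrite mxE psiK.
have -> : map_mx psi (map_mx psi' (V *m A *m U)) = V *m A *m U.
  by apply/matrixP => i j; rewrite mxE [map_mx psi' _ _ _]mxE psi'K.
by rewrite !mulmxA UV mul1mx -mulmxA UV mulmx1.
Qed.

Lemma similitude_iso_deg k A :
  graded_mx (fun a => xi (cls a) - k) (fun a => xi (cls a)) A <->
  graded_mx (fun i => xi (cls' i) - k) (fun i =>
    xi (cls' i)) (similitude_iso A).
Proof.
have [[VU UV] gU gV _] := hU; have [[psi' psiK psi'K] psiD _] := psiA.
split=> gA.
  have gpsi : graded_mx (fun a => xi (cls a) - k) (fun a =>
    xi (cls a)) (map_mx psi A).
    by move=> a b; rewrite mxE; exact: psiD.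
  have gU' : graded_mx (fun i => xi (cls' i) - g - k) (fun a =>
    xi (cls a) - k) U.
    by apply: graded_mx_shift gU => i a; zmod.
  by apply: graded_mx_shift (graded_mulmx (graded_mulmx gU' gpsi) gV) => i j;
    zmod.
have gA' : graded_mx (fun i => xi (cls' i) - g - k) (fun i =>
  xi (cls' i) - g) (similitude_iso A).
  by apply: graded_mx_shift gA => i j; zmod.
have gV' : graded_mx (fun a => xi (cls a) - k) (fun i => xi (cls' i) - g - k) V.
  by apply: graded_mx_shift gV => i a; zmod.
have gpsi := graded_mulmx (graded_mulmx gV' gA') gU.
move=> a b; apply: (aut_reflects_Dg (can_inj psiK) psiD).
move: (gpsi a b); rewrite /similitude_iso !mulmxA VU mul1mx -mulmxA VU mulmx1.
by rewrite mxE.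
Qed.

(** Conjugation by [U] carries the adjoint for the pulled back form to the adjoint for [P'], and the
    central factor [c] does not change an adjoint. *)
Lemma similitude_iso_inv A :
  similitude_iso (Q *m star A *m P) = Q' *m star (similitude_iso A) *m P'.
Proof.
have [[VU UV] _ _ iso] := hU; have [QP PQ] := hQ; have [Q'P' P'Q'] := hQ'.
have [_ _ cZ _] := cC; have cu := groupC_unit cC.
rewrite /similitude_iso !star_mul star_map // !map_mxM /= !mulmxA.
have UP : star U *m P' = c%:M *m map_mx psi P *m V.
  by rewrite mul_scalar_mx -iso -mulmxA UV mulmx1.
have QV : Q' *m star V = U *m map_mx psi Q *m c^-1%:M.
  have : c%:M *m map_mx psi P *m V *m (U *m map_mx psi Q *m c^-1%:M) = 1%:M.
    rewrite !mulmxA -[_ *m V *m U]mulmxA VU mulmx1 -[_ *m _ *m map_mx psi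
      Q]mulmxA.
    by rewrite -map_mxM PQ map_mx1 mulmx1 -scalar_mxM divrr.
  rewrite -UP => E; rewrite -[LHS]mulmx1 -E !mulmxA.
  by rewrite -[_ *m star V *m star U]mulmxA -star_mul UV star1 mulmx1 Q'P'
    mul1mx.
have cM (M : 'M[D]_n) : c^-1%:M *m M *m c%:M = M.
  apply/matrixP => i j; rewrite mulmx_scalar_entry mul_scalar_mx mxE.
  by rewrite -mulrA -cZ mulKr.
rewrite -[_ *m star U *m P']mulmxA UP QV -[in LHS](cM (map_mx psi (star A))).
by rewrite !mulmxA.
Qed.

End IsoOfSimilitude.

Lemma iso_of_same_orbit (p p' : param T) (m r m' r' : nat)
    (x : 'I_(m + r.*2) -> {quot T}) (x' : 'I_(m' + r'.*2) -> {quot T}) :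
  paramX Dg delta kind eta xi p -> paramX Dg delta kind eta xi p' ->
  enumeration p x -> enumeration p' x' ->
  same_orbit Dg phi0 kind X eta xi nu p p' ->
  ginvAlg_iso (Malg Dg phi0 delta kind X eta xi iu p x)
    (Malg Dg phi0 delta kind X eta xi iu p' x').
Proof.
move=> hp hp' hx hx' [g [c [h [psi [cC psiA pE]]]]]; subst p'.
have hM := model_Phi hp hx; have hM' := model_Phi hp' hx'.
have hQ := Phi_invP hp hx; have hQ' := Phi_invP hp' hx'.
have psiG := groupA_phi0 psiA.
have [U [V hU]] := similitude_of_orbit hp hM hM' cC psiA.
have [[VU UV] gU gV iso] := hU.
pose f : ga_ring (Malg Dg phi0 delta kind X eta xi iu p x) ->
  ga_ring (Malg Dg phi0 delta kind X eta xi iu _ x') := similitude_iso psi U V.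
have fB : zmod_morphism f.
  move=> A B; rewrite /f /similitude_iso /= raddfB mulmxBr mulmxBl //.
have fM : monoid_morphism f.
  split; first by rewrite /f /similitude_iso /= map_mx1 mulmx1.
  by move=> A B; exact: similitude_isoM hU A B.
pose fa := GRing.isZmodMorphism.Build _ _ f fB.
pose fm := GRing.isMonoidMorphism.Build _ _ f fM.
pose F : {rmorphism _ -> _} := HB.pack f fa fm.
exists F; split.
- exact: similitude_iso_bij psiG hU.
- move=> a A; apply/matrixP => i j;
    rewrite /= /f /similitude_iso !mxE scaler_sumr.
  apply: eq_bigr => b _; rewrite !mxE !mulr_suml scaler_sumr.
  by apply: eq_bigr => d _; rewrite !mxE linearZ /= -scalerAr -scalerAl.
- by move=> k A; rewrite /= !M_compP; exact: similitude_iso_deg psiG hU k A.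
- by move=> A; exact: (similitude_iso_inv hQ hQ' cC psiG hU A).
Qed.

End GradedDivisionAlgebra.

Theorem theorem24 (R : realType) (G : zmodType) (D : unitAlgType R)
  (Dg : G -> set D) (T : zmodClosed G) (phi0 : {linear D -> D})
  (delta : int) (kind : De_kind)
  (X : G -> D) (eta : G -> int) (xi : {quot T} -> G) (iu : D) (nu : G -> int)
  (hD : graded_division Dg)
  (hT : is_support Dg T)
  (hinv : is_involution phi0)
  (hdeg : forall g d, Dg g d -> Dg g (phi0 d))
  (hDe : De_conjugation Dg kind phi0)
  (hdelta : delta = 1 \/ delta = -1)
  (hdeltaZ : (exists2 z, central z & phi0 z <> z) -> delta = 1)
  (hC : De_C_central Dg kind ->
     finite_set [set t | t \in T] /\ (forall d, central d <-> Dg 0 d))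
  (hX : X_choice Dg T phi0 delta kind X)
  (heta : eta_spec T phi0 X eta)
  (hxi : forall x, \pi_{quot T} (xi x) = x)
  (hiu : kind = De_H -> Dg 0 iu /\ iu ^+ 2 = -1)
  (hnu : nu_choice Dg T kind X nu)
  (p p' : param T)
  (hp : paramX Dg delta kind eta xi p)
  (hp' : paramX Dg delta kind eta xi p')
  (m r : nat) (x : 'I_(m + r.*2) -> {quot T}) (hx : enumeration p x)
  (m' r' : nat) (x' : 'I_(m' + r'.*2) -> {quot T}) (hx' : enumeration p' x') :
  ginvAlg_iso
    (Malg Dg phi0 delta kind X eta xi iu p x)
    (Malg Dg phi0 delta kind X eta xi iu p' x')
  <-> same_orbit Dg phi0 kind X eta xi nu p p'.
Proof.
split; first exact: same_orbit_of_iso.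
exact: iso_of_same_orbit.
Qed.
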